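(* Suppose that $p,q,\mathscr C\ge1$ with $p\le q$. Let $(\mathcal M,d_{\mathcal M})$ be a separable metric space and $(Y,\|\cdot\|_Y)$ a Banach space such that for every $n\in\mathbb N$, every symmetric stochastic matrix $A\in M_n(\mathbb R)$ satisfies $\gamma(A,d_{\mathcal M}^p)\le\mathscr C\,\gamma(A,\|\cdot\|_Y^q)$. Then the $\frac pq$-snowflake of $\mathcal M$ embeds into some ultrapower of $\ell_q(Y)$ with $q$-average distortion $2\mathscr C^{1/q}$. Furthermore, if in addition $\mathcal M$ has Markov type $p$ and the modulus of uniform convexity of $Y$ has power type $q$, then there exists $D\ge1$ with $D\le \kappa\,\mathbf M_p(\mathcal M)^{p/q}\mathscr K_q(Y)\mathscr C^{1/q}$, for a universal constant $\kappa$, such that the $\frac pq$-snowflake of $\mathcal M$ embeds into $\ell_q(Y)$ with $q$-average distortion $D$.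
   Context: For a metric space $(\mathcal N,d)$, $p>0$ and a symmetric stochastic $A=(a_{ij})\in M_n(\mathbb R)$, $\gamma(A,d^p)$ is the infimum of $\gamma\in[0,\infty]$ such that for all $x_1,\dots,x_n\in\mathcal N$: $\frac1{n^2}\sum_{i,j}d(x_i,x_j)^p\le\frac\gamma n\sum_{i,j}a_{ij}d(x_i,x_j)^p$ (for a normed space, $d(x,y)=\|x-y\|$). Markov type $p$: the Markov type $p$ constant $\mathbf M_p(\mathcal M)$ is the infimum of $M\ge1$ such that for every $n$, every probability vector $\pi$, every stochastic $\pi$-reversible ($\pi_ia_{ij}=\pi_ja_{ji}$) $A\in M_n(\mathbb R)$, all $x_1,\dots,x_n\in\mathcal M$ and $s\in\mathbb N$: $(\sum_{i,j}\pi_i(A^s)_{ij}d(x_i,x_j)^p)^{1/p}\le Ms^{1/p}(\sum_{i,j}\pi_ia_{ij}d(x_i,x_j)^p)^{1/p}$; $\mathcal M$ has Markov type $p$ if this is finite. $\mathscr K_q(Y)$ is the infimum of $K\ge1$ with $\|y\|^q\le K^q(\frac{\|x+y\|^q+\|x-y\|^q}2-\|x\|^q)$ for all $x,y\in Y$; the modulus of uniform convexity of $Y$ has power type $q$ iff $\mathscr K_q(Y)<\infty$. $\ell_q(Y)$ has norm $(\sum\|y_i\|^q)^{1/q}$. The $\omega$-snowflake of $(\mathcal M,d)$ is $(\mathcal M,d^\omega)$. A metric space embeds into a normed space with $q$-average distortion $D$ if for every Borel probability measure $\mu$ on it there is a $D$-Lipschitz $f$ with $\iint\|f(x)-f(y)\|^qd\mu\,d\mu\ge\iint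 d(x,y)^qd\mu\,d\mu$. *)

(* Defs.v *)
From HB Require Import structures.
From mathcomp Require Import all_boot all_order all_algebra.
From mathcomp Require Import all_classical all_reals all_analysis.
Set Implicit Arguments. Unset Strict Implicit. Unset Printing Implicit Defensive.
Import Order.TTheory GRing.Theory Num.Theory.
Import numFieldNormedType.Exports.
Local Open Scope classical_set_scope.
Local Open Scope ring_scope.

Section Defs.
Variable R : realType.

Definition is_metric (T : Type) (d : T -> T -> R) : Prop :=
  (forall x y, 0 <= d x y) /\ (forall x y, d x y = 0 <-> x = y) /\
  (forall x y, d x y = d y x) /\ (forall x y z, d x z <= d x y + d y z).

Definition separable (T : Type) (d : T -> T -> R) : Prop :=
  exists S : set T, countable S /\
    forall x (e : R), 0 < e -> exists2 s, S s & d x s < e.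

Definition metric_open (T : Type) (d : T -> T -> R) : set (set T) :=
  [set O | forall x, O x -> exists2 e : R, 0 < e & [set y | d x y < e] `<=` O].

Definition borel_space (T : pointedType) (d : T -> T -> R) :=
  g_sigma_algebraType (metric_open d).

Definition stochastic (n : nat) (A : 'M[R]_n) : Prop :=
  (forall i j, 0 <= A i j) /\ (forall i, \sum_j A i j = 1).
Definition sym_stochastic (n : nat) (A : 'M[R]_n) : Prop :=
  stochastic A /\ A^T = A.

(** gamma(A, K) for a kernel K (K = d^p, or ||x-y||^q), as an extended real:
    the infimum of the admissible gamma in [0,oo] (the infimum of the empty set
    being +oo) *)
Definition gamma_const (T : Type) (n : nat) (A : 'M[R]_n) (K : T -> T -> R)
  : \bar R :=
  ereal_inf [set g%:E | g in [set g : R | 0 <= g /\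
    forall x : 'I_n -> T,
      (n%:R ^+ 2)^-1 * (\sum_i \sum_j K (x i) (x j))
      <= g / n%:R * (\sum_i \sum_j A i j * K (x i) (x j))]].

Definition markov_type_const (T : Type) (d : T -> T -> R) (p : R) : \bar R :=
  ereal_inf [set M%:E | M in [set M : R | 1 <= M /\
    forall (n : nat) (pi : 'I_n -> R) (A : 'M[R]_n) (x : 'I_n -> T) (s : nat),
      (forall i, 0 <= pi i) -> \sum_i pi i = 1 -> stochastic A ->
      (forall i j, pi i * A i j = pi j * A j i) ->
      (\sum_i \sum_j pi i * (A ^+ s) i j * d (x i) (x j) `^ p) `^ p^-1
      <= M * s%:R `^ p^-1 *
         (\sum_i \sum_j pi i * A i j * d (x i) (x j) `^ p) `^ p^-1]].

Definition has_markov_type (T : Type) (d : T -> T -> R) (p : R) : Prop :=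
  (markov_type_const d p < +oo)%E.

Definition unif_convex_const (Y : normedModType R) (q : R) : \bar R :=
  ereal_inf [set K%:E | K in [set K : R | 1 <= K /\
    forall x y : Y, `|y| `^ q <=
      K `^ q * ((`|x + y| `^ q + `|x - y| `^ q) / 2 - `|x| `^ q)]].

Definition in_lq (Y : normedModType R) (q : R) (u : nat -> Y) : Prop :=
  (\sum_(i <oo) (`|u i| `^ q)%:E < +oo)%E.

Definition lq_norm (Y : normedModType R) (q : R) (u : nat -> Y) : R :=
  (fine (\sum_(i <oo) (`|u i| `^ q)%:E)%E) `^ q^-1.

Definition ultrafilter (I : Type) (U : set (set I)) : Prop :=
  U setT /\ ~ U set0 /\
  (forall A B, U A -> U B -> U (A `&` B)) /\
  (forall A B, A `<=` B -> U A -> U B) /\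
  (forall A, U A \/ U (~` A)).

Definition ulim (I : Type) (U : set (set I)) (a : I -> R) : R :=
  xget 0 [set L : R | forall e : R, 0 < e -> U [set i | `|a i - L| < e]].

Definition avg_embeds_lq (T : pointedType) (d : T -> T -> R)
  (delta : T -> T -> R) (Y : normedModType R) (q D : R) : Prop :=
  forall mu : probability (borel_space d) R,
  exists f : T -> nat -> Y,
    (forall x, in_lq q (f x)) /\
    (forall x y, lq_norm q (f x - f y) <= D * delta x y) /\
    (\int[mu]_x \int[mu]_y ((lq_norm q (f x - f y)) `^ q)%:E >=
     \int[mu]_x \int[mu]_y ((delta x y) `^ q)%:E)%E.

(** q-average distortion D embedding of (T, delta) into the ultrapower
    (l_q(Y))^I / U.  A map into the ultrapower is given by a representative
    family (f_i)_{i in I} of maps into l_q(Y), bounded at every point; the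
    distance in the ultrapower is the U-limit of the l_q(Y) distances. *)
Definition avg_embeds_ultrapower_lq (T : pointedType) (d : T -> T -> R)
  (delta : T -> T -> R) (Y : normedModType R) (q D : R)
  (I : Type) (U : set (set I)) : Prop :=
  forall mu : probability (borel_space d) R,
  exists f : I -> T -> nat -> Y,
    (forall i x, in_lq q (f i x)) /\
    (forall x, exists B : R, forall i, lq_norm q (f i x) <= B) /\
    (forall x y, ulim U (fun i => lq_norm q (f i x - f i y)) <= D * delta x y) /\
    (\int[mu]_x \int[mu]_y ((ulim U (fun i => lq_norm q (f i x - f i y))) `^ q)%:E
     >= \int[mu]_x \int[mu]_y ((delta x y) `^ q)%:E)%E.

End Defs.

(* Main.v *)
Require Import Defs.
From HB Require Import structures.
From mathcomp Require Import all_boot all_order all_algebra.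
From mathcomp Require Import all_classical all_reals all_analysis.
From mathcomp Require Import measurable_realfun ring lra.
Import Order.TTheory GRing.Theory Num.Theory.
Import numFieldNormedType.Exports.
Local Open Scope classical_set_scope.
Local Open Scope ring_scope.

Set Implicit Arguments.
Unset Strict Implicit.
Unset Printing Implicit Defensive.

(** The snowflake [delta = d `^ (p / q)] is a metric with [delta ^ q = d ^ p], so
    the exponent [p] disappears.

    On a finite set, the matrices [(|f i - f j|^q)] of maps [f] into l_q(Y) form
    a convex cone.  A minimax argument shows that if none of them is at the same
    time bounded by [C delta^q] and on average at least [delta^q], then some
    weights satisfy a Poincare inequality for Y but not, even up to the factor C,
    for delta; after adding a diagonal, such weights are a multiple of a
    symmetric stochastic matrix, against the hypothesis on [gamma].  Masses of
    points are realised by repeating points.  A general measure is pushed forward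
    to the nearest points of a finite part of a dense sequence; along a diagonal
    subsequence the distances between the images converge everywhere, and
    dominated convergence passes to the limit.  Measures with infinite moment are
    handled by the distance to a point.

    For the second part, the map obtained on a finite set is extended to the
    whole space by Ball's argument.  By minimax, it is enough to extend it with
    respect to given weights, and this is done by running a lazy Markov chain:
    Markov type controls the energy after many steps, and a martingale
    inequality for spaces of power type q produces a time at which the averaged
    map varies little.  Finally, near-minimal extensions to more and more points
    form a Cauchy sequence by uniform convexity. *)

(** The argument works with q-th powers of distances: they add up over the coordinates of l_q(Y), so
    that averages are linear and the images form a cone. The price is a triangle inequality with the
    factor [2 ^ q]. Every use of it multiplies a constant by a power of [2 ^ q], hence the
    distortion, after a q-th root, by a number that depends on nothing; this is why [kappa] is
    universal.

    The factor 2 of the first part is used up on finite sets: [(3/2) ^ q] for making the copies of a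
    point coincide, 16/15 for the slack of the minimax, 5/4 for rounding the masses. As [1 <= q],
    the product is at most [2 ^ q], and the limits lose nothing more.

    The maps obtained on larger and larger finite sets share no bound on the number of coordinates,
    and no compactness gives them a limit in l_q(Y); only their distances converge, which is what an
    ultrapower records. The second part takes no such limit: it stops at one finite stage, where the
    map is enlarged by the factor 32 so that its average survives the extension and the
    approximation. *)

(** * Inequalities for powers of nonnegative reals *)

Section PowerInequalities.
Context {R : realType}.
Implicit Types u v w t q : R.

Lemma ler_powR2 q u v : 0 <= q -> 0 <= u -> u <= v -> u `^ q <= v `^ q.
Proof.
move=> q0 u0 uv; apply: ge0_ler_powR => //; rewrite nnegrE //.
exact: le_trans uv.
Qed.

Lemma powR_rootK q u : q != 0 -> 0 <= u -> (u `^ q^-1) `^ q = u.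
Proof. by move=> q0 u0; rewrite -powRrM mulVf// powRr1. Qed.

Lemma powRK_root q u : q != 0 -> 0 <= u -> (u `^ q) `^ q^-1 = u.
Proof. by move=> q0 u0; rewrite -powRrM mulfV// powRr1. Qed.

Lemma powR_div q u v : 0 <= u -> 0 < v -> (u / v) `^ q = u `^ q / v `^ q.
Proof.
move=> u0 v0; have vq : v `^ q != 0 by rewrite gt_eqF ?powR_gt0.
apply: (mulIf vq); rewrite -powRM ?divr_ge0 ?(ltW v0)//.
by rewrite (divfK (lt0r_neq0 v0)) (divfK vq).
Qed.

(** Whichever of [v] and [e * u] is larger absorbs the other term. With [e = 1/2] the first
    coefficient is only [(3/2) ^ q], which matters for the constant 2 of the first part; elsewhere
    [e = 1] is enough. *)
Lemma powR_addE_le q u v e : 0 <= q -> 0 < e -> 0 <= u -> 0 <= v ->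
  (u + v) `^ q <= (1 + e) `^ q * u `^ q + (1 + e^-1) `^ q * v `^ q.
Proof.
move=> q0 e0 u0 v0.
have ei0 : 0 < e^-1 by rewrite invr_gt0.
have [le_veu|lt_euv] := leP v (e * u).
  apply: (@le_trans _ _ ((1 + e) `^ q * u `^ q)).
    rewrite -powRM ?(addr_ge0, ler01, ltW e0)//.
    by apply: ler_powR2 => //; [exact: addr_ge0 | lra].
  by rewrite lerDl mulr_ge0 ?powR_ge0.
apply: (@le_trans _ _ ((1 + e^-1) `^ q * v `^ q)).
  rewrite -powRM ?(addr_ge0, ler01, ltW ei0)//.
  apply: ler_powR2 => //; first exact: addr_ge0.
  have : u <= e^-1 * v by rewrite mulrC ler_pdivlMr// mulrC ltW.
  lra.
by rewrite lerDr mulr_ge0 ?powR_ge0.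
Qed.

Lemma powR_add_le q u v : 0 <= q -> 0 <= u -> 0 <= v ->
  (u + v) `^ q <= 2 `^ q * (u `^ q + v `^ q).
Proof.
move=> q0 u0 v0.
have := @powR_addE_le q u v 1 q0 ltr01 u0 v0.
by rewrite invr1 mulrDr.
Qed.

Lemma powR_convex2 q u v a b : 1 <= q -> 0 <= u -> 0 <= v -> 0 <= a -> 0 <= b ->
  a + b = 1 -> (a * u + b * v) `^ q <= a * u `^ q + b * v `^ q.
Proof.
move=> q1 u0 v0 a0 b0 ab.
have a1 : a <= 1 by lra.
have bE : b = 1 - a by lra.
have := @convex_powR R q q1 (Itv01 a0 a1) u v.
by rewrite !inE/= !in_itv/= !andbT bE => /(_ u0 v0).
Qed.

(** The weights are not normalised, which lets the two-point inequality run along the list; when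
    their total is 0 they all vanish, and so do both sides. *)
Lemma jensen_powR (J : Type) (s : seq J) (a u : J -> R) q : 1 <= q ->
  (forall j, 0 <= a j) -> (forall j, 0 <= u j) ->
  (\sum_(j <- s) a j) * ((\sum_(j <- s) a j * u j) / \sum_(j <- s) a j) `^ q
  <= \sum_(j <- s) a j * u j `^ q.
Proof.
move=> q1 a0 u0; elim: s => [|j s IH]; first by rewrite !big_nil mul0r.
rewrite !big_cons; set A := \sum_(i <- s) a i in IH *.
set S := \sum_(i <- s) a i * u i in IH *.
have A0 : 0 <= A by exact: sumr_ge0.
have S0 : 0 <= S by apply: sumr_ge0 => i _; exact: mulr_ge0.
have [aj0|aj0] := eqVneq (a j) 0; first by rewrite aj0 !(mul0r, add0r).
have aj : 0 < a j by rewrite lt_def aj0 a0.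
have AA : 0 < a j + A by exact: ltr_pwDl.
have -> : (a j * u j + S) / (a j + A)
    = a j / (a j + A) * u j + A / (a j + A) * (S / A).
  have [A00|A00] := eqVneq A 0; last by field; rewrite A00 gt_eqF.
  suff -> : S = 0 by rewrite A00 !(addr0, mul0r) mulrAC.
  rewrite /S; move: A00; rewrite /A {IH A0 AA S0}.
  elim: s {A S} => [|i s IHs] /=.
    by rewrite !big_nil.
  rewrite !big_cons => /eqP; rewrite paddr_eq0 ?sumr_ge0//.
  by case/andP => /eqP-> /eqP /IHs ->; rewrite mul0r addr0.
have h := @powR_convex2 q (u j) (S / A) (a j / (a j + A)) (A / (a j + A)) q1
  (u0 j) (divr_ge0 S0 A0) (divr_ge0 (a0 j) (ltW AA)) (divr_ge0 A0 (ltW AA)).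
have {h} h := h (ltac:(by rewrite -mulrDl divff// gt_eqF)).
apply: (@le_trans _ _ ((a j + A) *
  (a j / (a j + A) * u j `^ q + A / (a j + A) * (S / A) `^ q))).
  by rewrite ler_pM2l.
rewrite [leLHS](_ : _ = a j * u j `^ q + A * (S / A) `^ q); last first.
  by field; rewrite gt_eqF.
by rewrite lerD2l.
Qed.

(** [u j + v j] is [A + B] times the convex combination of [u j / A] and [v j / B] with weights
    [A / (A + B)] and [B / (A + B)]; convexity of the power is applied term by term. *)
Lemma minkowski_sum (J : Type) (s : seq J) (u v : J -> R) q : 1 <= q ->
  (forall j, 0 <= u j) -> (forall j, 0 <= v j) ->
  (\sum_(j <- s) (u j + v j) `^ q) `^ q^-1
  <= (\sum_(j <- s) u j `^ q) `^ q^-1 + (\sum_(j <- s) v j `^ q) `^ q^-1.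
Proof.
move=> q1 u0 v0.
have q0 : 0 < q by exact: lt_le_trans q1.
have qn : q != 0 by rewrite gt_eqF.
have qi : 0 <= q^-1 by rewrite invr_ge0 ltW.
have sum0 (w : J -> R) : 0 <= \sum_(j <- s) w j `^ q.
  by apply: sumr_ge0 => *; exact: powR_ge0.
set U := (\sum_(j <- s) u j `^ q) `^ q^-1.
set V := (\sum_(j <- s) v j `^ q) `^ q^-1.
have U0 : 0 <= U by exact: powR_ge0.
have V0 : 0 <= V by exact: powR_ge0.
have UE : U `^ q = \sum_(j <- s) u j `^ q by exact: powR_rootK.
have VE : V `^ q = \sum_(j <- s) v j `^ q by exact: powR_rootK.
clearbody U V.
(* perturbing U and V avoids treating vanishing sums separately *)
apply/ler_addgt0Pr => e e0.
rewrite -[leRHS](@powRK_root q)//; last by lra.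
apply: ler_powR2 => //.
have [A AE] : exists A, A = U + e / 2 by eexists.
have [B BE] : exists B, B = V + e / 2 by eexists.
have A0 : 0 < A by lra.
have B0 : 0 < B by lra.
have -> : U + V + e = A + B by lra.
have AB0 : 0 < A + B by exact: addr_gt0.
have step j : (u j + v j) `^ q <= (A + B) `^ q *
    (A / (A + B) * (u j `^ q / A `^ q) + B / (A + B) * (v j `^ q / B `^ q)).
  have -> : u j + v j
      = (A + B) * (A / (A + B) * (u j / A) + B / (A + B) * (v j / B)).
    by field; rewrite !gt_eqF.
  have nn a b c d : 0 <= a -> 0 <= b -> 0 < c -> 0 < d ->
      0 <= a / c * (b / d) :> R by move=> *; rewrite mulr_ge0// divr_ge0// ltW.
  rewrite powRM ?addr_ge0 ?nn ?(ltW A0) ?(ltW B0) ?(ltW AB0)//.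
  rewrite ler_pM2l ?powR_gt0//.
  apply: (le_trans (@powR_convex2 q (u j / A) (v j / B) _ _ q1 _ _ _ _ _)).
  - by rewrite divr_ge0 ?(ltW A0).
  - by rewrite divr_ge0 ?(ltW B0).
  - by rewrite divr_ge0 ?(ltW A0) ?(ltW AB0).
  - by rewrite divr_ge0 ?(ltW B0) ?(ltW AB0).
  - by rewrite -mulrDl divff// gt_eqF.
  by rewrite !powR_div.
apply: (le_trans (ler_sum _ (fun j _ => step j))).
rewrite -mulr_sumr big_split/= -!mulr_sumr -!mulr_suml -UE -VE.
rewrite -[leRHS]mulr1 ler_pM2l ?powR_gt0//.
apply: (@le_trans _ _ (A / (A + B) * 1 + B / (A + B) * 1)).
  apply: lerD; rewrite ler_pM2l ?divr_gt0// ler_pdivrMr ?powR_gt0// mul1r.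
    by apply: ler_powR2; rewrite ?(ltW q0)//; lra.
  by apply: ler_powR2; rewrite ?(ltW q0)//; lra.
by rewrite !mulr1 -mulrDl divff// gt_eqF.
Qed.
End PowerInequalities.

(** * A finite minimax principle *)

Section Minimax.
Context {R : realType}.

(* A point of V almost minimising the squared distance to the orthant
   {v <= c} gives, through its excess over c, the weights whose response
   improves on it. *)
Lemma minimax_finite (I : finType) (i0 : I) (V : set (I -> R)) (c : R) :
  0 <= c -> (forall v, V v -> forall i, 0 <= v i) ->
  (forall u v t, V u -> V v -> 0 <= t -> t <= 1 ->
     V (fun i => (1 - t) * u i + t * v i)) ->
  (forall l : I -> R, (forall i, 0 < l i) ->
     exists2 v, V v & \sum_i l i * v i <= c * \sum_i l i) ->
  forall e, 0 < e -> exists2 v, V v & forall i, v i <= c + e.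
Proof.
move=> c0 V0 Vconv resp e e0; apply: contrapT => noV.
pose a (v : I -> R) i := Num.max (v i - c) 0.
have a0 v i : 0 <= a v i by rewrite /a le_max lexx orbT.
pose psi v := \sum_i a v i ^+ 2.
have psi_e v : V v -> e ^+ 2 <= psi v.
  move=> Vv; have [i vi] : exists i, c + e < v i.
    apply: contrapT => h; apply: noV; exists v => // i.
    by rewrite leNgt; apply/negP => hi; apply: h; exists i.
  rewrite /psi (bigD1 i)//= -[leLHS]addr0 lerD//; last first.
    by apply: sumr_ge0 => *; exact: sqr_ge0.
  rewrite ler_sqr ?nnegrE ?(ltW e0)//.
  by rewrite /a le_max; apply/orP; left; lra.
have [v1 Vv1 _] := resp (fun=> 1) (fun=> ltr01).
have hinf : has_inf (psi @` V).
  split; first by exists (psi v1), v1.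
  by exists (e ^+ 2) => _ [v Vv <-]; exact: psi_e.
have [D DE] : exists D, D = inf (psi @` V) by eexists.
have D0 : 0 < D.
  apply: (@lt_le_trans _ _ (e ^+ 2)); first by rewrite exprn_gt0.
  rewrite DE; apply: lb_le_inf; first by case: hinf.
  by move=> _ [v Vv <-]; exact: psi_e.
have psi_D v : V v -> D <= psi v.
  by move=> Vv; rewrite DE; apply: ge_inf; [case: hinf | exists v].
have near_D h : 0 < h -> exists2 v, V v & psi v < D + h.
  move=> h0; have [_ [v Vv <-] hv] := inf_adherent h0 hinf.
  by exists v => //; rewrite DE.
pose n : R := #|I|%:R.
have n0 : 0 <= n by exact: ler0n.
have sum_const (x : R) : \sum_(i : I) x = n * x.
  by rewrite sumr_const mulr_natl.
have nc0 : 0 <= n * c by exact: mulr_ge0.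
(* The weights must be positive, so [th] is added to the excess; it is small enough to change the
   estimate [ab] below by at most [D / 4]. *)
have [th thE] : exists th, th = D / (4 * (n * c + 1)) by eexists.
have th0 : 0 < th by rewrite thE divr_gt0//; lra.
have thnc : th * (n * c) <= D / 4.
  have -> : D / 4 = th * (n * c + 1) by rewrite thE; field; lra.
  by rewrite ler_pM2l//; lra.
have [L LE] : exists L, L = n + (D + 1) + n * th by eexists.
have L0 : 0 <= L by have := mulr_ge0 n0 (ltW th0); lra.
have [B BE] : exists B, B = n * ((c * L / th) ^+ 2 + c ^+ 2) by eexists.
have B0 : 0 <= B by rewrite BE mulr_ge0// addr_ge0 ?sqr_ge0.
(* Step length from [v0] towards the response. The first-order gain [3/2 * t * D] beats the
   second-order terms, at most [t * D / 2] by the choice of [t], and the defect [h <= t * D / 2] of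
   the near-minimiser. *)
have [t tE] : exists t, t = D / (2 * (D + 1 + B)) by eexists.
have t0 : 0 < t by rewrite tE divr_gt0//; lra.
have tD : t * (D + 1 + B) = D / 2 by rewrite tE; field; lra.
have t1 : t <= 1 by rewrite tE ler_pdivrMr; lra.
have [h hE] : exists h, h = Num.min 1 (t * D / 2) by eexists.
have h0 : 0 < h by rewrite hE lt_min ltr01/= divr_gt0// mulr_gt0.
have h1 : h <= 1 by rewrite hE ge_min lexx.
have h2 : h <= t * D / 2 by rewrite hE ge_min lexx orbT.
have [v0 Vv0 v0D] := near_D h h0.
pose l i := a v0 i + th.
have l0 i : 0 < l i by rewrite /l; have := a0 v0 i; lra.
have [v Vv hv] := resp l l0.
have lL : \sum_i l i <= L.
  rewrite /l big_split/= sum_const LE lerD2r.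
  apply: (@le_trans _ _ (\sum_i (1 + a v0 i ^+ 2))).
    by apply: ler_sum => i _; nra.
  by rewrite big_split/= sum_const mulr1 lerD2l -/(psi v0); lra.
have vub i : v i <= c * L / th.
  rewrite ler_pdivlMr// mulrC; apply: (@le_trans _ _ (c * \sum_i l i)); last first.
    by rewrite ler_wpM2l.
  apply: le_trans hv; rewrite (bigD1 i)//= -[leLHS]addr0 lerD//.
    by rewrite ler_wpM2r ?V0// /l lerDr.
  by apply: sumr_ge0 => j _; apply: mulr_ge0; [exact: ltW | exact: V0].
pose b i := v i - c.
have bB : \sum_i b i ^+ 2 <= B.
  rewrite BE -sum_const; apply: ler_sum => i _.
  have vv : v i ^+ 2 <= (c * L / th) ^+ 2.
    by rewrite ler_sqr ?nnegrE ?V0// (le_trans (V0 _ Vv i)).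
  by have := V0 _ Vv i; rewrite /b; nra.
have ab : \sum_i a v0 i * b i <= D / 4.
  have h3 : \sum_i l i * b i <= 0.
    under eq_bigr do rewrite /b mulrBr.
    by rewrite sumrB -mulr_suml subr_le0 [leRHS]mulrC.
  have h4 : - (n * c) <= \sum_i b i.
    rewrite -mulrN -sum_const; apply: ler_sum => i _.
    by have := V0 _ Vv i; rewrite /b; lra.
  have h5 : \sum_i l i * b i = \sum_i a v0 i * b i + th * \sum_i b i.
    by rewrite mulr_sumr -big_split/=; apply: eq_bigr => i _; rewrite /l mulrDl.
  have h6 : th * - (n * c) <= th * \sum_i b i by rewrite ler_pM2l.
  by rewrite mulrN in h6; lra.
have := psi_D _ (Vconv _ _ t Vv0 Vv (ltW t0) t1); apply/negP; rewrite -ltNge.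
(* This bound removes the positive parts: [a v0] dominates [v0 - c], and a positive part is at most
   the absolute value. *)
apply: (@le_lt_trans _ _ (\sum_i ((1 - t) * a v0 i + t * b i) ^+ 2)).
  apply: ler_sum => i _; rewrite -[leRHS]real_normK ?num_real//.
  rewrite ler_sqr ?nnegrE//.
  apply: (@le_trans _ _ (Num.max ((1 - t) * a v0 i + t * b i) 0)); last first.
    by rewrite ge_max ler_norm normr_ge0.
  rewrite /a ge_max !le_max lexx orbT andbT; apply/orP; left.
  have : v0 i - c <= a v0 i by rewrite /a le_max lexx.
  move=> hh; have : (1 - t) * (v0 i - c) <= (1 - t) * a v0 i.
    by rewrite ler_wpM2l; lra.
  by rewrite -/(a v0 i) /b; lra.
have [X XE] : exists X, X = \sum_i a v0 i * b i by eexists.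
have [Q QE] : exists Q, Q = \sum_i b i ^+ 2 by eexists.
have [S SE] : exists S, S = psi v0 by eexists.
have -> : \sum_i ((1 - t) * a v0 i + t * b i) ^+ 2
    = (1 - t) ^+ 2 * S + 2 * t * (1 - t) * X + t ^+ 2 * Q.
  rewrite SE XE QE /psi !mulr_sumr -!big_split/=.
  by apply: eq_bigr => i _; ring.
rewrite -SE in v0D; rewrite -XE in ab; rewrite -QE in bB.
have i1 : (1 - t) ^+ 2 * S <= (1 - t) ^+ 2 * (D + h).
  by rewrite ler_wpM2l ?sqr_ge0// ltW.
have i2 : 2 * t * (1 - t) * X <= 2 * t * (1 - t) * (D / 4).
  by rewrite ler_wpM2l// !mulr_ge0// ?(ltW t0)//; lra.
have i3 : t ^+ 2 * Q <= t ^+ 2 * B by rewrite ler_wpM2l ?sqr_ge0.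
have i4 : t * (t * (D + 1 + B)) = t * (D / 2) by rewrite tD.
have i5 : t ^+ 2 * h <= t ^+ 2 * 1 by rewrite ler_wpM2l ?sqr_ge0.
have i6 : 0 <= t * h by rewrite mulr_ge0 ?ltW.
have i7 : 0 < t * D by rewrite mulr_gt0.
have i8 : 0 <= t ^+ 2 * D by rewrite mulr_ge0 ?sqr_ge0 ?ltW.
by move: i1 i2 i3 i4 i5; rewrite !expr2; lra.
Qed.
End Minimax.

(** * Sums of q-th powers of distances in Y *)

Section NormPower.
Context {R : realType} {Y : normedModType R}.
Variable q : R.
Hypothesis q1 : 1 <= q.

Lemma normpow_sum (J : finType) (a : J -> R) (z : J -> Y) :
  (forall j, 0 <= a j) -> \sum_j a j = 1 ->
  `|\sum_j a j *: z j| `^ q <= \sum_j a j * `|z j| `^ q.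
Proof.
move=> a0 a1.
have := @jensen_powR R J (index_enum J) a (fun j => `|z j|) q q1 a0
  (fun j => normr_ge0 _).
rewrite a1 mul1r divr1; apply: le_trans.
apply: ler_powR2; rewrite ?(le_trans ler01 q1)//.
apply: (le_trans (ler_norm_sum _ _ _)); apply: ler_sum => j _.
by rewrite normrZ ger0_norm.
Qed.

Lemma normpow_add (y z : Y) :
  `|y + z| `^ q <= 2 `^ q * (`|y| `^ q + `|z| `^ q).
Proof.
have q0 : 0 <= q by rewrite (le_trans ler01 q1).
apply: le_trans (powR_add_le q0 (normr_ge0 _) (normr_ge0 _)).
by apply: ler_powR2 => //; exact: ler_normD.
Qed.
End NormPower.

Section SumDist.
Context {R : realType} {Y : normedModType R}.
Variable q : R.

(* The q-th power of the distance between the images of [i] and [j] under the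
   map into l_q(Y) whose coordinates are the entries of [G]. *)
Definition sumdist (I : Type) (G : seq (I -> Y)) (i j : I) : R :=
  \sum_(g <- G) `|g i - g j| `^ q.

Lemma sumdist_ge0 I (G : seq (I -> Y)) i j : 0 <= sumdist G i j.
Proof. by apply: sumr_ge0 => *; exact: powR_ge0. Qed.

Lemma sumdist_sym I (G : seq (I -> Y)) i j : sumdist G i j = sumdist G j i.
Proof. by apply: eq_bigr => g _; rewrite distrC. Qed.

Lemma sumdist_xx I (G : seq (I -> Y)) i : q != 0 -> sumdist G i i = 0.
Proof. by move=> q0; rewrite /sumdist big1// => g _; rewrite subrr normr0 powR0. Qed.

Lemma sumdist_cat I (G H : seq (I -> Y)) i j :
  sumdist (G ++ H) i j = sumdist G i j + sumdist H i j.
Proof. by rewrite /sumdist big_cat. Qed.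

Lemma sumdist_scale I (G : seq (I -> Y)) (r : R) i j : q != 0 -> 0 <= r ->
  sumdist [seq (fun k => r `^ q^-1 *: g k) | g <- G] i j = r * sumdist G i j.
Proof.
move=> q0 r0; rewrite /sumdist big_map mulr_sumr; apply: eq_bigr => g _.
rewrite -scalerBr normrZ ger0_norm ?powR_ge0// powRM ?powR_ge0//.
by rewrite powR_rootK.
Qed.
End SumDist.

(** * Duality between Poincare inequalities and embeddings of finite sets *)

Section FiniteDuality.
Context {R : realType} {T : Type} {Y : normedModType R}.
Variables (q C : R) (K : T -> T -> R).
Hypothesis q1 : 1 <= q.
Hypothesis C1 : 1 <= C.
Hypothesis K0 : forall x y, 0 <= K x y.
Hypothesis Kxx : forall x, K x x = 0.
Hypothesis Ksym : forall x y, K x y = K y x.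
Hypothesis gammaC : forall (n : nat) (A : 'M[R]_n), sym_stochastic A ->
  (gamma_const A K
   <= C%:E * gamma_const A (fun x y : Y => (`|x - y| `^ q)%R))%E.

Let q0 : 0 <= q. Proof. exact: le_trans q1. Qed.
Let qn0 : q != 0. Proof. by rewrite gt_eqF// (lt_le_trans ltr01). Qed.

(** Dividing the weights by [W] and filling the diagonal gives a matrix [A] for which the assumed
    inequality says that [W / n] is admissible for [|x - y| ^ q]. The diagonal is invisible because
    both kernels vanish there. *)
Lemma poincare_transfer (J : finType) (x : J -> T) (w : J -> J -> R) :
  (forall a b, 0 <= w a b) -> (forall a b, w a b = w b a) ->
  (forall g : J -> Y, \sum_a \sum_b `|g a - g b| `^ q
     <= \sum_a \sum_b w a b * `|g a - g b| `^ q) ->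
  \sum_a \sum_b K (x a) (x b) <= C * \sum_a \sum_b w a b * K (x a) (x b).
Proof.
move=> w0 wsym poinc.
have [J0|Jpos] := posnP #|J|.
  have Je (F : J -> R) : \sum_a F a = 0.
    by apply: big_pred0 => a; exact: (card0_eq J0 a).
  by rewrite !Je mulr0.
set n := #|J|; pose e (i : 'I_n) : J := enum_val i.
have reJ (F : J -> R) : \sum_a F a = \sum_(i < n) F (e i).
  by rewrite (reindex e)//; exact/onW_bij/enum_val_bij.
have reJJ (F : J -> J -> R) :
    \sum_a \sum_b F a b = \sum_(i < n) \sum_(j < n) F (e i) (e j).
  by rewrite reJ; apply: eq_bigr => i _; rewrite reJ.
have n0 : 0 < n%:R :> R by rewrite ltr0n.
have nN0 : n%:R != 0 :> R by rewrite gt_eqF.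
(* [W] bounds all row sums; the summand 1 keeps it positive when all weights vanish. *)
pose W := 1 + \sum_i \sum_j w (e i) (e j).
have W0 : 0 < W by rewrite ltr_pwDl// sumr_ge0// => i _; exact: sumr_ge0.
have WN0 : W != 0 by rewrite gt_eqF.
have WiW i : \sum_(j | j != i) w (e i) (e j) <= W.
  apply: (@le_trans _ _ (\sum_j w (e i) (e j))).
    by rewrite [leRHS](bigD1 i)//= lerDr.
  rewrite /W [X in _ <= _ + X](bigD1 i)//= addrCA lerDl addr_ge0// sumr_ge0// => k _.
  exact: sumr_ge0.
pose A : 'M[R]_n := \matrix_(i, j)
  if i == j then 1 - (\sum_(k | k != i) w (e i) (e k)) / W
  else w (e i) (e j) / W.
have Ast : sym_stochastic A.
  split; last first.
    apply/matrixP => i j; rewrite !mxE eq_sym.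
    by case: eqVneq => [->|_] //; rewrite wsym.
  split=> [i j|i].
    rewrite mxE; case: ifP => _; last by rewrite divr_ge0// ltW.
    by rewrite subr_ge0 ler_pdivrMr// mul1r.
  rewrite (bigD1 i)//= mxE eqxx.
  under eq_bigr => j ji do rewrite mxE eq_sym (negbTE ji).
  by rewrite -mulr_suml subrK.
have sumA (k : 'I_n -> 'I_n -> R) : (forall i, k i i = 0) ->
    \sum_i \sum_j A i j * k i j = (\sum_i \sum_j w (e i) (e j) * k i j) / W.
  move=> k0; rewrite mulr_suml; apply: eq_bigr => i _.
  rewrite mulr_suml; apply: eq_bigr => j _; rewrite mxE.
  by case: eqVneq => [->|_]; [rewrite k0 !(mulr0, mul0r)|rewrite mulrAC].
set SW := \sum_a \sum_b w a b * K (x a) (x b).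
set SK := \sum_a \sum_b K (x a) (x b).
have SW0 : 0 <= SW.
  by do 2 (apply: sumr_ge0 => ? _); rewrite mulr_ge0.
have gY : (gamma_const A (fun x y : Y => (`|x - y| `^ q)%R)
    <= (W / n%:R)%:E)%E.
  apply: ereal_inf_lbound; exists (W / n%:R) => //; split.
    by rewrite divr_ge0 ?ltW.
  move=> y; rewrite sumA; last by move=> i; rewrite subrr normr0 powR0.
  have := poinc (fun a => y (enum_rank a)).
  rewrite !reJJ /e.
  under eq_bigr => i _ do under eq_bigr => j _ do rewrite !enum_valK.
  under [in X in _ <= X]eq_bigr => i _ do
    under eq_bigr => j _ do rewrite !enum_valK.
  move=> h; set S := (X in _ <= _ * (X / W)).
  have -> : W / n%:R / n%:R * (S / W) = (n%:R ^+ 2)^-1 * S.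
    by field; rewrite nN0 WN0.
  by rewrite ler_pM2l// invr_gt0 exprn_gt0.
have gK : (gamma_const A K <= (C * (W / n%:R))%:E)%E.
  apply: (le_trans (gammaC Ast)); rewrite EFinM.
  by apply: lee_wpmul2l => //; rewrite lee_fin (le_trans ler01).
apply/ler_addgt0Pr => h h0.
have nSW : 0 < n%:R * SW / W + 1.
  by rewrite ltr_wpDl// divr_ge0 ?(ltW W0)// mulr_ge0// ltW.
(* The infimum defining gamma need not be attained. An admissible constant within [h'] of the bound
   costs at most [h] in the conclusion. *)
pose h' := h / (n%:R * SW / W + 1).
have h'0 : 0 < h' by exact: divr_gt0.
have hlt : (gamma_const A K < (C * (W / n%:R) + h')%:E)%E.
  by apply: (le_lt_trans gK); rewrite lte_fin ltrDl.
have [_ [g [g0 hg] <-]] := ereal_inf_lt hlt; rewrite lte_fin => glt.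
have := hg (fun i => x (e i)); rewrite sumA; last by move=> i; exact: Kxx.
rewrite -(reJJ (fun a b => K (x a) (x b))).
rewrite -(reJJ (fun a b => w a b * K (x a) (x b))) -/SK -/SW => hSK.
have n2 : 0 < n%:R ^+ 2 :> R by rewrite exprn_gt0.
have {}hSK : SK <= n%:R ^+ 2 * (g / n%:R * (SW / W)).
  by rewrite -ler_pdivrMl.
apply: (le_trans hSK).
apply: (@le_trans _ _ (n%:R ^+ 2 * ((C * (W / n%:R) + h') / n%:R * (SW / W)))).
  rewrite ler_pM2l// ler_wpM2r ?divr_ge0 ?(ltW W0)//.
  by rewrite ler_pM2r ?invr_gt0// ltW.
have -> : n%:R ^+ 2 * ((C * (W / n%:R) + h') / n%:R * (SW / W))
    = C * SW + h' * (n%:R * SW / W) by field; rewrite nN0 WN0.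
rewrite lerD2l /h' mulrAC ler_pdivrMr// ler_wpM2l ?(ltW h0)//.
by rewrite lerDl.
Qed.

(* The weighted Poincare inequality is transferred to the multiset J of copies
   of points of I; heavy edges between copies of the same point make them
   coincide up to the factor (3/2)^q, and cost nothing for K. *)
Lemma poincare_transfer_copies (I J : finType) (tau : J -> I) (sig : I -> J)
    (x : I -> T) (w : I -> I -> R) :
  cancel sig tau -> (forall i j, 0 <= w i j) -> (forall i j, w i j = w j i) ->
  (forall g : I -> Y, \sum_a \sum_b `|g (tau a) - g (tau b)| `^ q
     <= \sum_i \sum_j w i j * `|g i - g j| `^ q) ->
  \sum_a \sum_b K (x (tau a)) (x (tau b))
  <= (3 / 2) `^ q * C * \sum_i \sum_j w i j * K (x i) (x j).
Proof.
move=> sigK w0 wsym poinc.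
set c32 : R := (3 / 2) `^ q.
have c0 : 0 <= c32 by exact: powR_ge0.
(* [H] pays for the deviations of copies from their representatives: 6 is 3 from the splitting with
   [e = 1/2], times 2 for separating the two deviations, and each deviation occurs [2 * #|J|] times
   in the double sum. *)
pose H : R := 2 * 6 `^ q * #|J|%:R.
have H0 : 0 <= H by rewrite /H !mulr_ge0 ?powR_ge0.
pose isrep a := sig (tau a) == a.
(* The weights [w], enlarged by the loss [(3/2) ^ q], join representatives only; [H] joins all
   copies of one point. *)
pose om a b : R := c32 * (if isrep a && isrep b then w (tau a) (tau b) else 0)
  + (if tau a == tau b then H else 0).
have sumrep (G : J -> R) : \sum_(a | isrep a) G a = \sum_i G (sig i).
  rewrite (reindex_onto sig tau); last by move=> a /eqP.
  by apply: eq_bigl => i; rewrite /isrep sigK !eqxx.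
have sumom (F : J -> J -> R) : \sum_a \sum_b om a b * F a b
    = c32 * (\sum_i \sum_j w i j * F (sig i) (sig j))
      + \sum_a \sum_(b | tau a == tau b) H * F a b.
  have -> : \sum_i \sum_j w i j * F (sig i) (sig j)
      = \sum_a \sum_b (if isrep a && isrep b then w (tau a) (tau b) else 0) * F a b.
    transitivity (\sum_(a | isrep a) \sum_(b | isrep b)
        w (tau a) (tau b) * F a b).
      rewrite sumrep; apply: eq_bigr => i _; rewrite sumrep.
      by apply: eq_bigr => j _; rewrite !sigK.
    rewrite big_mkcond/=; apply: eq_bigr => a _; case: ifP => ra /=.
      rewrite big_mkcond/=; apply: eq_bigr => b _.
      by case: ifP => //; rewrite mul0r.
    by under eq_bigr do rewrite mul0r; rewrite big1.
  rewrite mulr_sumr -big_split/=; apply: eq_bigr => a _.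
  rewrite [X in _ + X]big_mkcond/= mulr_sumr -big_split/=.
  apply: eq_bigr => b _; rewrite /om mulrDl -mulrA; congr (_ + _).
  by case: ifP => //; rewrite mul0r.
have om0 a b : 0 <= om a b.
  by rewrite /om addr_ge0//; [rewrite mulr_ge0//|]; case: ifP.
have omsym a b : om a b = om b a.
  by rewrite /om andbC wsym [tau a == _]eq_sym.
have := @poincare_transfer J (fun a => x (tau a)) om om0 omsym.
rewrite sumom [X in C * (_ + X)]big1; last first.
  move=> a _; rewrite big1// => b /eqP->; by rewrite Kxx mulr0.
rewrite addr0.
have -> : \sum_i \sum_j w i j * K (x (tau (sig i))) (x (tau (sig j)))
    = \sum_i \sum_j w i j * K (x i) (x j).
  by apply: eq_bigr => i _; apply: eq_bigr => j _; rewrite !sigK.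
rewrite mulrA [C * c32]mulrC; apply => h.
rewrite sumom.
have step a b : `|h a - h b| `^ q <=
    c32 * `|h (sig (tau a)) - h (sig (tau b))| `^ q
    + 6 `^ q * (`|h a - h (sig (tau a))| `^ q + `|h b - h (sig (tau b))| `^ q).
  set a' := sig (tau a); set b' := sig (tau b).
  apply: (@le_trans _ _ ((`|h a' - h b'|
      + (`|h a - h a'| + `|h b - h b'|)) `^ q)).
    apply: ler_powR2 => //.
    have -> : h a - h b = (h a' - h b') + ((h a - h a') - (h b - h b')).
      by rewrite opprB addrACA [h a' + _]addrC subrK addKr.
    by apply: (le_trans (ler_normD _ _)); rewrite lerD2l ler_normB.
  have e0 : 0 < 1 / 2 :> R by lra.
  apply: (le_trans (powR_addE_le q0 e0 (normr_ge0 _) _)).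
    exact: addr_ge0.
  have -> : 1 + 1 / 2 = 3 / 2 :> R by lra.
  have -> : 1 + (1 / 2)^-1 = 3 :> R by lra.
  rewrite lerD2l.
  have -> : 6 `^ q = 3 `^ q * 2 `^ q :> R.
    by rewrite -powRM//; congr (_ `^ _); lra.
  by rewrite -mulrA ler_wpM2l ?powR_ge0// powR_add_le.
apply: (le_trans (ler_sum _ (fun a _ => ler_sum _ (fun b _ => step a b)))).
pose D a := `|h a - h (sig (tau a))| `^ q.
have -> : \sum_a \sum_b (c32 * `|h (sig (tau a)) - h (sig (tau b))| `^ q
      + 6 `^ q * (D a + D b))
    = c32 * (\sum_a \sum_b `|h (sig (tau a)) - h (sig (tau b))| `^ q)
      + H * \sum_a D a.
  have -> : H * (\sum_a D a) = 6 `^ q * \sum_a \sum_b (D a + D b).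
    have sc (y : R) : \sum_(b : J) y = #|J|%:R * y by rewrite sumr_const mulr_natl.
    under [in RHS]eq_bigr do rewrite big_split/= sc.
    by rewrite big_split/= sc -mulr_sumr /H; ring.
  rewrite !mulr_sumr -big_split/=; apply: eq_bigr => a _.
  by rewrite !mulr_sumr -big_split.
apply: lerD.
  by rewrite ler_wpM2l//; exact: (poinc (fun i => h (sig i))).
rewrite mulr_sumr; apply: ler_sum => a _.
rewrite (bigD1 (sig (tau a))) ?sigK//= lerDl sumr_ge0// => b _.
by rewrite mulr_ge0 ?powR_ge0.
Qed.

(** The minimax applies to the ratios [sumdist q G / K] over families normalised to the [P]-average
    of [K]; concatenation of scaled families makes these ratios a convex set. Weights without a
    response, tested on one-element families, yield a Poincare inequality for Y, which [HP]
    transfers to [K] with a constant [B < c]: a contradiction. *)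
Lemma cone_duality (I : finType) (x : I -> T) (P : I -> I -> R) (B B' : R) :
  0 < B -> B < B' -> (forall i j, 0 <= P i j) ->
  (forall i j, i != j -> 0 < K (x i) (x j)) ->
  (forall w : I -> I -> R, (forall i j, 0 <= w i j) ->
     (forall i j, w i j = w j i) ->
     (forall g : I -> Y, \sum_i \sum_j P i j * `|g i - g j| `^ q
        <= \sum_i \sum_j w i j * `|g i - g j| `^ q) ->
     \sum_i \sum_j P i j * K (x i) (x j)
     <= B * \sum_i \sum_j w i j * K (x i) (x j)) ->
  0 < \sum_i \sum_j P i j * K (x i) (x j) ->
  exists2 G : seq (I -> Y), forall i j, sumdist q G i j <= B' * K (x i) (x j)
    & \sum_i \sum_j P i j * sumdist q G i j
      = \sum_i \sum_j P i j * K (x i) (x j).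
Proof.
move=> B0 BB' P0 Kpos HP.
set S := \sum_i \sum_j P i j * K (x i) (x j) => S0.
have [i0|I0] := pickP (fun _ : I => true); last first.
  by move: S0; rewrite /S big_pred0 ?ltxx.
move=> _.
(* On the diagonal the ratio is 0 divided by 0, that is 0. *)
pose V : set (I * I -> R) := [set v | exists2 G : seq (I -> Y),
  \sum_i \sum_j P i j * sumdist q G i j = S &
  forall ij, v ij = sumdist q G ij.1 ij.2 / K (x ij.1) (x ij.2)].
pose c := (B + B') / 2.
have c0 : 0 < c by rewrite /c; lra.
have Bc : B < c by rewrite /c; lra.
have e0 : 0 < (B' - B) / 2 by lra.
have V0 v : V v -> forall i, 0 <= v i.
  by case=> G _ vE i; rewrite vE divr_ge0 ?sumdist_ge0.
have Vconv u v t : V u -> V v -> 0 <= t -> t <= 1 ->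
    V (fun i => (1 - t) * u i + t * v i).
  move=> [G GS uE] [H HS vE] t0 t1.
  have t10 : 0 <= 1 - t by lra.
  exists ([seq (fun k => (1 - t) `^ q^-1 *: g k) | g <- G]
          ++ [seq (fun k => t `^ q^-1 *: g k) | g <- H]).
    under eq_bigr do under eq_bigr do
      rewrite sumdist_cat !sumdist_scale// mulrDr mulrCA [P _ _ * (t * _)]mulrCA.
    under eq_bigr do rewrite big_split/= -!mulr_sumr.
    by rewrite big_split/= -!mulr_sumr GS HS -mulrDl subrK mul1r.
  by move=> ij; rewrite uE vE sumdist_cat !sumdist_scale//; ring.
have [v [G GS vE] vle] : exists2 v, V v & forall i, v i <= c + (B' - B) / 2.
  apply: (@minimax_finite R _ (i0, i0) V c (ltW c0) V0 Vconv) => // l l0.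
  apply: contrapT => nores.
  set L := \sum_i l i in nores.
  have L0 : 0 < L.
    by rewrite /L (bigD1 (i0, i0))//= ltr_pwDl// sumr_ge0// => *; rewrite ltW.
  have cL0 : 0 < c * L by exact: mulr_gt0.
  pose r i j := l (i, j) / K (x i) (x j).
  have r0 i j : 0 <= r i j by rewrite divr_ge0// ltW.
  (* With this scale, the failure [c * L < S / s * t] of the response on a normalised map gives
     [s <= sl * t], the Poincare inequality. The weights are symmetrised because [l] need not be
     symmetric. *)
  have [sl slE] : exists sl, sl = S / (c * L) by eexists.
  have SL0 : 0 < sl by rewrite slE; exact: divr_gt0.
  pose w i j := sl * ((r i j + r j i) / 2).
  have w0 i j : 0 <= w i j.
    by rewrite /w mulr_ge0 ?(ltW SL0)// divr_ge0// addr_ge0.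
  have wsym i j : w i j = w j i by rewrite /w [r i j + _]addrC.
  have symsum (k : I -> I -> R) : (forall i j, k i j = k j i) ->
      \sum_i \sum_j w i j * k i j = sl * \sum_i \sum_j r i j * k i j.
    move=> ksym.
    have e1 : \sum_i \sum_j r j i * k i j = \sum_i \sum_j r i j * k i j.
      rewrite exchange_big/=; apply: eq_bigr => i _; apply: eq_bigr => j _.
      by rewrite ksym.
    transitivity (sl * ((\sum_i \sum_j r i j * k i j
        + \sum_i \sum_j r j i * k i j) / 2)); last first.
      by rewrite e1 -mulr2n -[X in X / 2]mulr_natr mulfK ?pnatr_eq0.
    rewrite -big_split/= mulr_suml mulr_sumr; apply: eq_bigr => i _.
    rewrite -big_split/= mulr_suml mulr_sumr; apply: eq_bigr => j _.
    by rewrite /w; field.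
  have sumr (k : I -> I -> R) :
      \sum_ij l ij * (k ij.1 ij.2 / K (x ij.1) (x ij.2))
      = \sum_i \sum_j r i j * k i j.
    rewrite pair_bigA/=; apply: eq_bigr => -[i j] _ /=.
    by rewrite /r mulrA mulrAC.
  have poinc (g : I -> Y) : \sum_i \sum_j P i j * `|g i - g j| `^ q
      <= \sum_i \sum_j w i j * `|g i - g j| `^ q.
    rewrite symsum; last by move=> i j; rewrite distrC.
    set s := \sum_i \sum_j P i j * _; set t := \sum_i \sum_j r i j * _.
    have t0 : 0 <= t.
      by do 2 (apply: sumr_ge0 => ? _); rewrite mulr_ge0 ?powR_ge0.
    have s0 : 0 <= s.
      by do 2 (apply: sumr_ge0 => ? _); rewrite mulr_ge0 ?powR_ge0.
    (* A map with [s = 0] cannot be normalised, but satisfies the inequality trivially. *)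
    have [->|sN0] := eqVneq s 0; first by rewrite mulr_ge0// ltW.
    have {}s0 : 0 < s by rewrite lt_def sN0.
    have sc0 : 0 <= S / s by rewrite divr_ge0 ?(ltW S0)// ltW.
    pose G := [seq (fun k => (S / s) `^ q^-1 *: g k) | g <- [:: g]].
    have GE i j : sumdist q G i j = S / s * `|g i - g j| `^ q.
      by rewrite /G sumdist_scale// /sumdist big_seq1.
    have GS : \sum_i \sum_j P i j * sumdist q G i j = S.
      under eq_bigr do under eq_bigr do rewrite GE mulrCA.
      under eq_bigr do rewrite -mulr_sumr.
      by rewrite -mulr_sumr -/s divfK.
    have : ~ (\sum_ij l ij * (sumdist q G ij.1 ij.2 / K (x ij.1) (x ij.2))
        <= c * L).
      move=> h; apply: nores.
      by exists (fun ij => sumdist q G ij.1 ij.2 / K (x ij.1) (x ij.2)) => //; exists G.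
    move/negP; rewrite -ltNge sumr.
    have -> : \sum_i \sum_j r i j * sumdist q G i j = S / s * t.
      under eq_bigr do under eq_bigr do rewrite GE mulrCA.
      by under eq_bigr do rewrite -mulr_sumr; rewrite -mulr_sumr.
    rewrite [S / s * t]mulrAC ltr_pdivlMr// => h.
    by rewrite slE [S / (c * L) * t]mulrAC ler_pdivlMr// mulrC ltW.
  have := HP w w0 wsym poinc; rewrite symsum// slE.
  apply/negP; rewrite -ltNge -/S.
  have rK : \sum_i \sum_j r i j * K (x i) (x j) <= L.
    rewrite pair_bigA /L; apply: ler_sum => -[i j] _ /=; rewrite /r.
    have [->|ij] := eqVneq i j; first by rewrite Kxx mulr0 ltW.
    by rewrite divfK// gt_eqF ?Kpos.
  apply: (@le_lt_trans _ _ (B * (S / (c * L) * L))).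
    by rewrite ler_pM2l// ler_pM2l// -slE.
  have -> : B * (S / (c * L) * L) = S * (B / c) by field; rewrite !gt_eqF.
  by rewrite gtr_pMr// ltr_pdivrMr// mul1r.
exists G => // i j.
have [->|ij] := eqVneq i j; first by rewrite sumdist_xx// Kxx mulr0.
have := vle (i, j); rewrite vE/= ler_pdivrMr ?Kpos//.
by rewrite (_ : c + (B' - B) / 2 = B')// /c; lra.
Qed.

Lemma finite_embedding (I : finType) (x : I -> T) (m : I -> R) :
  (forall i, 0 <= m i) -> (forall i j, i != j -> 0 < K (x i) (x j)) ->
  exists2 G : seq (I -> Y),
    forall i j, sumdist q G i j <= 2 `^ q * C * K (x i) (x j)
    & \sum_i \sum_j m i * m j * K (x i) (x j)
      <= \sum_i \sum_j m i * m j * sumdist q G i j.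
Proof.
move=> m0 Kpos; set D := \sum_i \sum_j m i * m j * K (x i) (x j).
have D0 : 0 <= D by do 2 (apply: sumr_ge0 => ? _); rewrite !mulr_ge0.
have C0 : 0 < C by exact: lt_le_trans C1.
have [DE|DN0] := eqVneq D 0.
  exists [::]; first by move=> i j; rewrite /sumdist big_nil !mulr_ge0 ?powR_ge0// ltW.
  by rewrite DE; do 2 (apply: sumr_ge0 => ? _); rewrite !mulr_ge0// sumdist_ge0.
have {}D0 : 0 < D by rewrite lt_def DN0.
pose E := \sum_i \sum_j (m i + m j + 1) * (2 `^ q * C * K (x i) (x j)).
have E0 : 0 <= E.
  by do 2 (apply: sumr_ge0 => ? _); rewrite !mulr_ge0 ?addr_ge0 ?powR_ge0// ltW.
(* [E] bounds the effect of rounding [N * m i] to an integer; relative to [N ^+ 2], this effect is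
   at most [D / 20], less than the gain from the factor 5/4. *)
pose N := (Num.truncn (20 * E / D)).+1.
have N1 : 1 <= N%:R :> R by rewrite ler1n.
have N0 : 0 < N%:R :> R by rewrite ltr0n.
have NE : E <= N%:R * (D / 20).
  have := truncnS_gt (20 * E / D); rewrite -/N ltr_pdivrMr// => h.
  by lra.
pose k i := Num.truncn (N%:R * m i).
(* The successor gives a copy to every point, even of mass 0, so that each point has a
   representative. *)
pose c i : R := (k i).+1%:R.
have Nm0 i : 0 <= N%:R * m i by rewrite mulr_ge0.
have cl i : N%:R * m i <= c i by rewrite /c ltW// truncnS_gt.
have cu i : c i <= N%:R * m i + 1.
  by rewrite /c -natr1 lerD2r truncn_le.
have c0 i : 0 <= c i by rewrite /c.
pose J := {i : I & 'I_(k i).+1}.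
have sumJ (F : I -> R) : \sum_(a : J) F (tag a) = \sum_i c i * F i.
  rewrite -(@sig_big_dep _ _ _ _ _ xpredT (fun=> xpredT) (fun i _ => F i))/=.
  by apply: eq_bigr => i _; rewrite sumr_const card_ord mulr_natl.
have sumJJ (F : I -> I -> R) : \sum_(a : J) \sum_(b : J) F (tag a) (tag b)
    = \sum_i \sum_j c i * c j * F i j.
  under eq_bigr do rewrite (sumJ (F _)).
  rewrite (sumJ (fun i => \sum_j c j * F i j)).
  by apply: eq_bigr => i _; rewrite mulr_sumr; apply: eq_bigr => j _; rewrite mulrA.
pose B := (3 / 2) `^ q * C.
have B0 : 0 < B by rewrite mulr_gt0// powR_gt0; lra.
have BB : B < 16 / 15 * B by lra.
have HP (w : I -> I -> R) : (forall i j, 0 <= w i j) ->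
     (forall i j, w i j = w j i) ->
     (forall g : I -> Y, \sum_i \sum_j c i * c j * `|g i - g j| `^ q
        <= \sum_i \sum_j w i j * `|g i - g j| `^ q) ->
     \sum_i \sum_j c i * c j * K (x i) (x j)
     <= B * \sum_i \sum_j w i j * K (x i) (x j).
  move=> w0 wsym h; rewrite -(sumJJ (fun i j => K (x i) (x j))).
  apply: (@poincare_transfer_copies I J (@tag I (fun i => 'I_(k i).+1))
    (fun i => Tagged (fun i => 'I_(k i).+1) ord0)) => // g.
  by rewrite (sumJJ (fun i j => `|g i - g j| `^ q)).
have cD : N%:R ^+ 2 * D <= \sum_i \sum_j c i * c j * K (x i) (x j).
  rewrite mulr_sumr; apply: ler_sum => i _; rewrite mulr_sumr.
  apply: ler_sum => j _; rewrite mulrA ler_wpM2r//.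
  by rewrite expr2 mulrACA ler_pM.
have cD0 : 0 < \sum_i \sum_j c i * c j * K (x i) (x j).
  by apply: lt_le_trans cD; rewrite mulr_gt0// exprn_gt0.
have cc0 i j : 0 <= c i * c j by rewrite mulr_ge0.
have [G Gle GS] := cone_duality B0 BB cc0 Kpos HP cD0.
have b0 : 0 <= 5 / 4 :> R by lra.
pose G' := [seq (fun k => (5 / 4) `^ q^-1 *: g k) | g <- G].
have G'E i j : sumdist q G' i j = 5 / 4 * sumdist q G i j.
  by rewrite /G' sumdist_scale.
have G'le i j : sumdist q G' i j <= 2 `^ q * C * K (x i) (x j).
  rewrite G'E; apply: (@le_trans _ _ (5 / 4 * (16 / 15 * B * K (x i) (x j)))).
    by rewrite ler_wpM2l.
  have -> : 5 / 4 * (16 / 15 * B * K (x i) (x j)) = 4 / 3 * B * K (x i) (x j).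
    by lra.
  rewrite ler_wpM2r// /B mulrA ler_wpM2r ?(ltW C0)//.
  (* [5/4 * 16/15] is [4/3], which is at most [(4/3) ^ q] since [1 <= q]. *)
  have -> : 2 `^ q = (4 / 3) `^ q * (3 / 2) `^ q :> R.
    by rewrite -powRM; [congr (_ `^ _); lra|lra|lra].
  by rewrite ler_wpM2r ?powR_ge0//; apply: le1r_powR => //; lra.
exists G' => //.
set M := \sum_i \sum_j m i * m j * sumdist q G' i j.
have hM : \sum_i \sum_j c i * c j * sumdist q G' i j <= N%:R ^+ 2 * M + N%:R * E.
  rewrite !mulr_sumr -big_split/=; apply: ler_sum => i _.
  rewrite !mulr_sumr -big_split/=; apply: ler_sum => j _.
  apply: (@le_trans _ _ ((N%:R ^+ 2 * (m i * m j) + N%:R * (m i + m j + 1))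
      * sumdist q G' i j)).
    rewrite ler_wpM2r ?sumdist_ge0//.
    apply: (@le_trans _ _ ((N%:R * m i + 1) * (N%:R * m j + 1))).
      by rewrite ler_pM.
    by have := m0 i; have := m0 j; nra.
  rewrite mulrDl !mulrA lerD2l -!mulrA ler_pM2l// ler_wpM2l ?addr_ge0//.
  by rewrite mulrA; exact: G'le.
have hS : \sum_i \sum_j c i * c j * sumdist q G' i j
    = 5 / 4 * \sum_i \sum_j c i * c j * K (x i) (x j).
  rewrite -GS mulr_sumr; apply: eq_bigr => i _; rewrite mulr_sumr.
  by apply: eq_bigr => j _; rewrite G'E mulrCA.
rewrite -(ler_pM2l (exprn_gt0 2 N0)).
have : N%:R * E <= N%:R * (N%:R * (D / 20)) by rewrite ler_pM2l.
move: hM; rewrite hS; move: cD; rewrite !expr2.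
set X := \sum_i \sum_j c i * c j * _.
have [n nE] : exists n : R, n = N%:R by eexists.
have : 0 <= n * n * D by rewrite mulr_ge0 ?(ltW D0)// nE mulr_ge0.
rewrite -nE; clearbody X M D E.
by move=> *; lra.
Qed.
End FiniteDuality.

(** * Reversible Markov chains and a martingale inequality from uniform convexity *)

Section StochasticPowers.
Context {R : realType}.
Variables (n : nat) (A : 'M[R]_n) (pi : 'I_n -> R).
Hypothesis stA : stochastic A.

Lemma powmx0E i j : (A ^+ 0) i j = (i == j)%:R.
Proof. by rewrite expr0 mxE. Qed.

Lemma powmxSE s i j : (A ^+ s.+1) i j = \sum_k A i k * (A ^+ s) k j.
Proof. by rewrite exprS mxE. Qed.

Lemma stochasticX s : stochastic (A ^+ s).
Proof.
case: stA => A0 A1; elim: s => [|s [IH0 IH1]].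
  split=> [i j|i]; first by rewrite powmx0E ler0n.
  under eq_bigr do rewrite powmx0E.
  by rewrite (bigD1 i)//= eqxx big1 ?addr0// => j /negbTE; rewrite eq_sym => ->.
split=> [i j|i]; first by rewrite powmxSE sumr_ge0// => k _; rewrite mulr_ge0.
under eq_bigr do rewrite powmxSE.
rewrite exchange_big/=; under eq_bigr do rewrite -mulr_sumr IH1 mulr1.
exact: A1.
Qed.

Hypothesis revA : forall i j, pi i * A i j = pi j * A j i.

Lemma stationary (X : 'I_n -> R) :
  \sum_i pi i * (\sum_j A i j * X j) = \sum_j pi j * X j.
Proof.
under eq_bigr do rewrite mulr_sumr.
rewrite exchange_big/=; apply: eq_bigr => j _.
under eq_bigr do rewrite mulrA revA -mulrA mulrCA.
by rewrite -mulr_suml (proj2 stA) mul1r.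
Qed.

Lemma stationaryX s (X : 'I_n -> R) :
  \sum_i pi i * (\sum_j (A ^+ s) i j * X j) = \sum_j pi j * X j.
Proof.
elim: s X => [|s IH] X.
  apply: eq_bigr => i _; congr (_ * _).
  rewrite (bigD1 i)//= powmx0E eqxx mul1r big1 ?addr0// => j ji.
  by rewrite powmx0E eq_sym (negbTE ji) mul0r.
transitivity (\sum_i pi i * (\sum_l A i l * (\sum_j (A ^+ s) l j * X j))).
  2: by rewrite stationary IH.
apply: eq_bigr => i _; congr (_ * _).
under eq_bigr do rewrite powmxSE mulr_suml.
rewrite exchange_big/=; apply: eq_bigr => k _; rewrite mulr_sumr.
by apply: eq_bigr => j _; rewrite mulrA.
Qed.
End StochasticPowers.

(* The q-th power N of a norm with modulus of convexity of power type q,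
   isolated through the few properties used in the extension argument. *)
Section MarkovCotype.
Context {R : realType} {Z : lmodType R}.
Variables (N : Z -> R) (b k : R).
Hypothesis N0 : forall z, 0 <= N z.
Hypothesis NN : forall z, N (- z) = N z.
Hypothesis Njensen : forall (J : finType) (a : J -> R) (z : J -> Z),
  (forall j, 0 <= a j) -> \sum_j a j = 1 ->
  N (\sum_j a j *: z j) <= \sum_j a j * N (z j).
Hypothesis b1 : 1 <= b.
Hypothesis k1 : 1 <= k.
Hypothesis Nadd : forall y z, N (y + z) <= b * (N y + N z).
Hypothesis Nuc : forall x y, N y <= k * ((N (x + y) + N (x - y)) / 2 - N x).

Let b0 : 0 <= b. Proof. exact: le_trans b1. Qed.
Let k0 : 0 <= k. Proof. exact: le_trans k1. Qed.

Lemma N_distC y z : N (y - z) = N (z - y).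
Proof. by rewrite -NN opprB. Qed.

Lemma scaler_halfD (v : Z) : 2^-1 *: v + 2^-1 *: v = v.
Proof. by rewrite -scalerDl (_ : 2^-1 + 2^-1 = 1 :> R) ?scale1r//; lra. Qed.

(** The convexity inequality is applied at the midpoint, with half the difference as increment;
    returning to the whole difference through [Nadd] costs [2 * b]. *)
Lemma uc_half y z :
  N (y - z) <= 2 * (b * k) * ((N y + N z) / 2 - N (2^-1 *: (y + z))).
Proof.
have h1 := Nadd (2^-1 *: (y - z)) (2^-1 *: (y - z)).
rewrite scaler_halfD in h1.
have h2 := Nuc (2^-1 *: (y + z)) (2^-1 *: (y - z)).
have e1 : 2^-1 *: (y + z) + 2^-1 *: (y - z) = y.
  by rewrite !scalerDr addrACA scaler_halfD -scalerDr subrr scaler0 addr0.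
have e2 : 2^-1 *: (y + z) - 2^-1 *: (y - z) = z.
  by rewrite -scalerBr opprB [z - _]addrC addrACA subrr add0r scalerDr scaler_halfD.
rewrite e1 e2 in h2; apply: (le_trans h1).
have : b * N (2^-1 *: (y - z)) <=
    b * (k * ((N y + N z) / 2 - N (2^-1 *: (y + z)))) by rewrite ler_wpM2l.
by lra.
Qed.

(** A variance inequality: [uc_half] compares each [z j] with the mean, and Jensen, applied to the
    midpoints, whose mean is the same, absorbs the midpoint terms. *)
Lemma uc_mean (J : finType) (a : J -> R) (z : J -> Z) :
  (forall j, 0 <= a j) -> \sum_j a j = 1 ->
  \sum_j a j * N (z j - \sum_i a i *: z i)
  <= b * k * (\sum_j a j * N (z j) - N (\sum_i a i *: z i)).
Proof.
move=> a0 a1; set m := \sum_i a i *: z i.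
apply: (@le_trans _ _ (\sum_j a j *
    (2 * (b * k) * ((N (z j) + N m) / 2 - N (2^-1 *: (z j + m)))))).
  by apply: ler_sum => j _; rewrite ler_wpM2l//; exact: uc_half.
have -> : \sum_j a j * (2 * (b * k) * ((N (z j) + N m) / 2
      - N (2^-1 *: (z j + m))))
    = b * k * ((\sum_j a j * N (z j)) + N m
      - 2 * \sum_j a j * N (2^-1 *: (z j + m))).
  have mE : N m = \sum_j a j * N m by rewrite -mulr_suml a1 mul1r.
  rewrite [X in _ + X - _]mE mulr_sumr -big_split/= -sumrB.
  by rewrite mulr_sumr; apply: eq_bigr => j _; field.
rewrite ler_wpM2l ?mulr_ge0//.
have : N m <= \sum_j a j * N (2^-1 *: (z j + m)).
  apply: le_trans (Njensen _ a0 a1).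
  suff -> : \sum_j a j *: (2^-1 *: (z j + m)) = m by [].
  under eq_bigr do rewrite scalerA mulrC -scalerA scalerDr.
  by rewrite -scaler_sumr big_split/= -scaler_suml a1 scale1r scalerDr scaler_halfD.
by lra.
Qed.

Variables (n : nat) (A : 'M[R]_n) (pi : 'I_n -> R) (u : 'I_n -> Z).
Hypothesis stA : stochastic A.
Hypothesis pi0 : forall i, 0 <= pi i.
Hypothesis revA : forall i j, pi i * A i j = pi j * A j i.
Hypothesis lazyA : forall i, 1 / 2 <= A i i.

(** The expectation of [u (X_s)] for the chain [X] started at [i]. *)
Definition chain_avg s i : Z := \sum_j (A ^+ s) i j *: u j.

Definition chain_var s i : R :=
  \sum_j A i j * N (chain_avg s j - chain_avg s.+1 i).

Definition chain_energy s : R :=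
  \sum_i pi i * (\sum_j (A ^+ s) i j * N (u j - u i)).

(** The expected sum of [N] over the [t] increments of the martingale [(A^(t-k) u)(X_k)] of the
    chain started at [i]: the first increment, then those of the chain restarted after one step. *)
Fixpoint cumul t i : R :=
  if t is t'.+1 then chain_var t' i + \sum_l A i l * cumul t' l else 0.

Lemma chain_avgS s i : chain_avg s.+1 i = \sum_j A i j *: chain_avg s j.
Proof.
rewrite /chain_avg; under eq_bigr do rewrite powmxSE scaler_suml.
rewrite exchange_big/=; apply: eq_bigr => l _; rewrite scaler_sumr.
by apply: eq_bigr => j _; rewrite scalerA.
Qed.

Lemma chain_avg0 i : chain_avg 0 i = u i.
Proof.
rewrite /chain_avg (bigD1 i)//= powmx0E eqxx scale1r big1 ?addr0// => j ji.
by rewrite powmx0E eq_sym (negbTE ji) scale0r.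
Qed.

(* the martingale (A^(t-k) u)(X_k) of the chain X started at i *)
Lemma cumul_le t i w : cumul t i + b * k * N (chain_avg t i - w)
  <= b * k * \sum_j (A ^+ t) i j * N (u j - w).
Proof.
have [A0 A1] := stA.
elim: t i => [|t IH] i.
  rewrite /= add0r chain_avg0 (bigD1 i)//= powmx0E eqxx mul1r big1 ?addr0//.
  by move=> j ji; rewrite powmx0E eq_sym (negbTE ji) mul0r.
have -> : b * k * (\sum_j (A ^+ t.+1) i j * N (u j - w))
    = \sum_l A i l * (b * k * \sum_j (A ^+ t) l j * N (u j - w)).
  under eq_bigr do rewrite powmxSE mulr_suml.
  rewrite exchange_big/= mulr_sumr; apply: eq_bigr => l _.
  rewrite [RHS]mulrCA; congr (_ * _); rewrite mulr_sumr.
  by apply: eq_bigr => j _; rewrite mulrA.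
apply: le_trans (ler_sum _ (fun l _ => ler_wpM2l (A0 i l) (IH l))).
under [leRHS]eq_bigr do rewrite mulrDr mulrCA.
rewrite big_split/= -mulr_sumr addrAC addrC lerD2l.
(* Translation by [w] leaves the increments unchanged, so [uc_mean] treats the first step. *)
have mE : chain_avg t.+1 i - w = \sum_j A i j *: (chain_avg t j - w).
  under eq_bigr do rewrite scalerBr.
  by rewrite sumrB -scaler_suml A1 scale1r -chain_avgS.
have := uc_mean (fun j => chain_avg t j - w) (A0 i) (A1 i).
rewrite -mE.
under eq_bigr do rewrite opprB addrA subrK.
by rewrite -/(chain_var t i); lra.
Qed.

Lemma sum_cumul t :
  \sum_i pi i * cumul t i = \sum_(s < t) \sum_i pi i * chain_var s i.
Proof.
elim: t => [|t IH]; first by rewrite big_ord0 big1// => i _; rewrite mulr0.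
rewrite big_ord_recr/= -IH; under eq_bigr do rewrite mulrDr.
by rewrite big_split/= stationary// addrC.
Qed.

(** By stationarity the mean increments at the times [s < t] add up to the mean of [cumul t], so one
    of them is at most the average. *)
Lemma chain_var_small t : (0 < t)%N -> exists2 s, (s < t)%N &
  t%:R * \sum_i pi i * chain_var s i <= b * k * chain_energy t.
Proof.
move=> t0; apply: contrapT => h.
have h1 (s : 'I_t) : b * k * chain_energy t / t%:R
    < \sum_i pi i * chain_var s i.
  rewrite ltr_pdivrMr ?ltr0n// [ltRHS]mulrC ltNge; apply/negP => hs; apply: h.
  by exists s.
have : \sum_i pi i * cumul t i <= b * k * chain_energy t.
  rewrite mulr_sumr; apply: ler_sum => i _.
  (* With the offset [u i], the right-hand side of [cumul_le] averages to the energy. *)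
  rewrite mulrCA ler_wpM2l//; apply: le_trans (cumul_le t i (u i)).
  by rewrite lerDl !mulr_ge0.
rewrite sum_cumul; apply/negP; rewrite -ltNge.
have -> : b * k * chain_energy t = \sum_(s < t) (b * k * chain_energy t / t%:R).
  by rewrite sumr_const card_ord -[RHS]mulr_natr divfK// pnatr_eq0 -lt0n.
apply: ltr_sum => //; apply/hasP.
by exists (Ordinal t0); rewrite ?mem_index_enum.
Qed.

(** [F] is [chain_avg s] at a time of small increment. An increment compares [chain_avg s] at [j]
    with [chain_avg s.+1] at [i]; laziness gives, with a factor 2, the same comparison at [j = i],
    and the two together bound the energy of [F]. The distance from [F] to [u] is bounded by
    Jensen. *)
Lemma markov_cotype t : (0 < t)%N -> exists s (F : 'I_n -> Z),
  [/\ (s <= t)%N,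
      t%:R * (\sum_i pi i * \sum_j A i j * N (F i - F j))
        <= 3 * b ^+ 2 * k * chain_energy t
    & \sum_i pi i * N (F i - u i) <= chain_energy s].
Proof.
move=> t0; have [s st hs] := chain_var_small t0; have [A0 A1] := stA.
exists s, (chain_avg s); split; first exact: ltnW.
  apply: (@le_trans _ _ (t%:R * (3 * b * \sum_i pi i * chain_var s i))).
    rewrite ler_wpM2l// mulr_sumr; apply: ler_sum => i _.
    rewrite mulrCA ler_wpM2l//.
    have d i' : N (chain_avg s i' - chain_avg s.+1 i') <= 2 * chain_var s i'.
      have : A i' i' * N (chain_avg s i' - chain_avg s.+1 i') <= chain_var s i'.
        rewrite /chain_var (bigD1 i')//= lerDl sumr_ge0// => j _.
        by rewrite mulr_ge0.
      have := lazyA i'; have := N0 (chain_avg s i' - chain_avg s.+1 i'); nra.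
    apply: (@le_trans _ _ (\sum_j A i j * (b *
      (N (chain_avg s i - chain_avg s.+1 i)
       + N (chain_avg s j - chain_avg s.+1 i))))).
      apply: ler_sum => j _; rewrite ler_wpM2l//.
      rewrite [N (chain_avg s j - _)]N_distC.
      by apply: le_trans (Nadd _ _); rewrite addrA subrK.
    under eq_bigr do rewrite mulrCA mulrDr.
    rewrite -mulr_sumr big_split/= -mulr_suml A1 mul1r -/(chain_var s i).
    rewrite [3 * b]mulrC -mulrA ler_wpM2l//.
    by have := d i; lra.
  have -> : t%:R * (3 * b * \sum_i pi i * chain_var s i)
      = 3 * b * (t%:R * \sum_i pi i * chain_var s i) by ring.
  apply: (@le_trans _ _ (3 * b * (b * k * chain_energy t))).
    by rewrite ler_wpM2l// mulr_ge0.
  by rewrite expr2; lra.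
apply: ler_sum => i _; rewrite ler_wpM2l//.
have [X0 X1] := stochasticX stA s.
have -> : chain_avg s i - u i = \sum_j (A ^+ s) i j *: (u j - u i).
  under [RHS]eq_bigr do rewrite scalerBr.
  by rewrite sumrB -scaler_suml X1 scale1r.
exact: Njensen.
Qed.
End MarkovCotype.

(** * Ball's extension of Lipschitz maps *)

Section Extension.
Context {R : realType} {T : choiceType} {Z : lmodType R}.
Variables (N : Z -> R) (b k : R) (K : T -> T -> R) (M : R).
Hypothesis N0 : forall z, 0 <= N z.
Hypothesis N00 : N 0 = 0.
Hypothesis NN : forall z, N (- z) = N z.
Hypothesis Njensen : forall (J : finType) (a : J -> R) (z : J -> Z),
  (forall j, 0 <= a j) -> \sum_j a j = 1 ->
  N (\sum_j a j *: z j) <= \sum_j a j * N (z j).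
Hypothesis b1 : 1 <= b.
Hypothesis k1 : 1 <= k.
Hypothesis M1 : 1 <= M.
Hypothesis Nadd : forall y z, N (y + z) <= b * (N y + N z).
Hypothesis Nuc : forall x y, N y <= k * ((N (x + y) + N (x - y)) / 2 - N x).
Hypothesis K0 : forall x y, 0 <= K x y.
Hypothesis Kxx : forall x, K x x = 0.
Hypothesis Kpos : forall x y, x != y -> 0 < K x y.
Hypothesis Ksym : forall x y, K x y = K y x.
Hypothesis Ktri : forall x y z, K x z <= b * (K x y + K y z).
Hypothesis Kmarkov : forall (n : nat) (pi : 'I_n -> R) (A : 'M[R]_n)
    (x : 'I_n -> T) (s : nat),
  (forall i, 0 <= pi i) -> \sum_i pi i = 1 -> stochastic A ->
  (forall i j, pi i * A i j = pi j * A j i) ->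
  \sum_i \sum_j pi i * (A ^+ s) i j * K (x i) (x j)
  <= M * s%:R * \sum_i \sum_j pi i * A i j * K (x i) (x j).

Let b0 : 0 <= b. Proof. exact: le_trans b1. Qed.
Let k0 : 0 <= k. Proof. exact: le_trans k1. Qed.
Let M0 : 0 <= M. Proof. exact: le_trans M1. Qed.

Section Weighted.
Variables (n : nat) (S : finType) (r0 : S) (x : 'I_n -> T) (z : S -> T).
Variables (f : S -> Z) (L : R).
Hypothesis L0 : 0 <= L.
Hypothesis fLip : forall r r', N (f r - f r') <= L * K (z r) (z r').

(* harmonic-type extension: average f with the weights B, then run a lazy
   Markov chain with transition weights H for a well-chosen number of steps *)
Lemma weighted_extension (H : 'I_n -> 'I_n -> R) (B : 'I_n -> S -> R) :
  (forall i j, 0 <= H i j) -> (forall i r, 0 < B i r) ->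
  exists F : 'I_n -> Z,
    \sum_i \sum_j H i j * N (F i - F j) + \sum_i \sum_r B i r * N (F i - f r)
    <= 7 * k * b ^+ 4 * L * M * (\sum_i \sum_j H i j * K (x i) (x j)
                                + \sum_i \sum_r B i r * K (x i) (z r)).
Proof.
move=> H0 B0.
case: n x H B H0 B0 => [|n'] x' H B H0 B0.
  by exists (fun=> 0); rewrite !big_ord0 !addr0 mulr0.
clear x n; move: n' x' H B H0 B0 => n' x; set n := n'.+1 => H B H0 B0.
pose be i := \sum_r B i r.
have be0 i : 0 < be i.
  by rewrite /be (bigD1 r0)//= ltr_pwDl// sumr_ge0// => r _; rewrite ltW.
pose BB := \sum_i be i.
have BB0 : 0 < BB.
  by rewrite /BB (bigD1 ord0)//= ltr_pwDl// sumr_ge0// => i _; rewrite ltW.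
pose p i r := B i r / be i.
have p0 i r : 0 <= p i r by rewrite divr_ge0 ?ltW.
have p1 i : \sum_r p i r = 1.
  by rewrite -mulr_suml -/(be i) divff// gt_eqF.
have bep i r : be i * p i r = B i r by rewrite mulrC divfK// gt_eqF.
pose h i j := H i j + H j i.
have h0 i j : 0 <= h i j by rewrite addr_ge0.
have hsym i j : h i j = h j i by rewrite /h addrC.
pose off i := \sum_(j | j != i) h i j.
have off0 i : 0 <= off i by rewrite sumr_ge0.
(* [t] is the number of steps. The jump probabilities are divided by [t], so that the total movement
   in [t] steps is controlled independently of [t]; a large [t] makes the chain lazy. *)
pose t := (Num.truncn (\sum_i 2 * off i / be i)).+1.
have t0 : 0 < t%:R :> R by rewrite ltr0n.
have tbig i : 2 * off i <= t%:R * be i.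
  rewrite -ler_pdivrMr//; apply/ltW/(le_lt_trans _ (truncnS_gt _)).
  rewrite (bigD1 i)//= lerDl sumr_ge0// => j _.
  by rewrite divr_ge0 ?(ltW (be0 _))// mulr_ge0.
have tbe0 i : 0 < t%:R * be i by rewrite mulr_gt0.
pose A : 'M[R]_n := \matrix_(i, j)
  if i == j then 1 - off i / (t%:R * be i) else h i j / (t%:R * be i).
have Aoff i j : i != j -> A i j = h i j / (t%:R * be i).
  by move=> ij; rewrite mxE (negbTE ij).
have lazyA i : 1 / 2 <= A i i.
  rewrite mxE eqxx.
  have : off i / (t%:R * be i) <= 1 / 2.
    by rewrite ler_pdivrMr//; have := tbig i; lra.
  by lra.
have stA : stochastic A.
  split=> [i j|i].
    have [->|ij] := eqVneq i j; first by apply: le_trans (lazyA j); lra.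
    by rewrite Aoff// divr_ge0// ltW.
  rewrite (bigD1 i)//= mxE eqxx.
  under eq_bigr => j ji do rewrite Aoff 1?eq_sym//.
  by rewrite -mulr_suml subrK.
pose pi i := be i / BB.
have pi0 i : 0 <= pi i by rewrite divr_ge0// ltW.
have pi1 : \sum_i pi i = 1 by rewrite -mulr_suml divff// gt_eqF.
have piA i j : i != j -> pi i * A i j = h i j / (t%:R * BB).
  by move=> ij; rewrite Aoff// /pi; field; rewrite !gt_eqF.
have revA i j : pi i * A i j = pi j * A j i.
  have [->//|ij] := eqVneq i j.
  by rewrite !piA// 1?eq_sym// hsym.
have BBpi i : BB * pi i = be i by rewrite /pi mulrC divfK// gt_eqF.
have sumA (g : 'I_n -> 'I_n -> R) : (forall i, g i i = 0) ->
    (forall i j, g i j = g j i) ->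
    BB * (t%:R * \sum_i \sum_j pi i * A i j * g i j)
    = 2 * \sum_i \sum_j H i j * g i j.
  move=> g0 gsym.
  have e1 : \sum_i \sum_j H j i * g i j = \sum_i \sum_j H i j * g i j.
    rewrite exchange_big/=; apply: eq_bigr => i _; apply: eq_bigr => j _.
    by rewrite gsym.
  rewrite mulr2n mulrDl mul1r -{1}e1 -big_split/= mulrA mulr_sumr.
  apply: eq_bigr => i _; rewrite -big_split/= mulr_sumr.
  apply: eq_bigr => j _; rewrite -mulrDl.
  have [->|ij] := eqVneq i j; first by rewrite g0 !mulr0.
  by rewrite piA// /h; field; rewrite !gt_eqF.
pose u i := \sum_r p i r *: f r.
pose ka i := \sum_r p i r * K (x i) (z r).
have ka0 i : 0 <= ka i by apply: sumr_ge0 => r _; rewrite mulr_ge0.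
have uf i v : u i - v = \sum_r p i r *: (f r - v).
  under [RHS]eq_bigr do rewrite scalerBr.
  by rewrite sumrB -scaler_suml p1 scale1r.
have Nuf i y r : N (u i - f r)
    <= L * b * (ka i + b * (K (x i) y + K y (z r))).
  rewrite uf; apply: (le_trans (Njensen _ (p0 i) (p1 i))).
  apply: (@le_trans _ _ (\sum_r' p i r' * (L * b *
      (K (x i) (z r') + b * (K (x i) y + K y (z r)))))).
    apply: ler_sum => r' _; rewrite ler_wpM2l//.
    apply: (le_trans (fLip _ _)); rewrite -mulrA ler_wpM2l//.
    apply: (le_trans (Ktri _ (x i) _)).
    by rewrite Ksym ler_wpM2l// lerD2l.
  under eq_bigr do rewrite mulrCA mulrDr.
  by rewrite -mulr_sumr big_split/= -mulr_suml p1 mul1r.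
have Nuf' i r : N (u i - f r) <= L * b ^+ 2 * (ka i + K (x i) (z r)).
  apply: (le_trans (Nuf i (x i) r)); rewrite Kxx add0r expr2 -!mulrA.
  rewrite ler_wpM2l// ler_wpM2l// mulrDr lerD2r.
  by rewrite ler_peMl.
have Nuu i j : N (u j - u i) <= L * b ^+ 2 * (ka i + K (x i) (x j) + ka j).
  rewrite N_distC// uf.
  apply: (le_trans (Njensen _ (p0 i) (p1 i))).
  apply: (@le_trans _ _ (\sum_r p i r * (L * b ^+ 2 *
      (K (x i) (z r) + (K (x i) (x j) + ka j))))).
    apply: ler_sum => r _; rewrite ler_wpM2l// N_distC//.
    apply: (le_trans (Nuf j (x i) r)); rewrite expr2 -!mulrA.
    rewrite ler_wpM2l// ler_wpM2l// [K (x j) _]Ksym.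
    have : ka j <= b * ka j by rewrite ler_peMl.
    by rewrite !mulrDr; lra.
  under eq_bigr do rewrite mulrCA mulrDr.
  by rewrite -mulr_sumr big_split/= -mulr_suml p1 mul1r -/(ka i) addrA.
set SH := \sum_i \sum_j H i j * K (x i) (x j).
set SB := \sum_i \sum_r B i r * K (x i) (z r).
have SH0 : 0 <= SH by do 2 (apply: sumr_ge0 => ? _); rewrite mulr_ge0.
have SB0 : 0 <= SB by do 2 (apply: sumr_ge0 => ? _); rewrite mulr_ge0// ltW.
have Bka : BB * (\sum_i pi i * ka i) = SB.
  rewrite mulr_sumr; apply: eq_bigr => i _; rewrite mulrA BBpi mulr_sumr.
  by apply: eq_bigr => r _; rewrite mulrA bep.
(* In the energy of [u], each end contributes its averaging error [ka], whose mean is independent of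
   [s] by stationarity. The displacement of the chain is bounded by Markov type, whose linear growth
   in [s <= t] compensates the factor [1 / t] in the jump probabilities. *)
have Q s : (s <= t)%N -> BB * chain_energy N A pi u s
    <= 2 * L * b ^+ 2 * M * (SH + SB).
  move=> st; have [X0 X1] := stochasticX stA s.
  have : chain_energy N A pi u s <= L * b ^+ 2 * (\sum_i pi i * ka i
      + \sum_i \sum_j pi i * (A ^+ s) i j * K (x i) (x j)
      + \sum_i pi i * ka i).
    rewrite -[X in _ + X](stationaryX stA revA s) -!big_split/= mulr_sumr.
    apply: ler_sum => i _.
    have -> : L * b ^+ 2 * (pi i * ka i
          + \sum_j pi i * (A ^+ s) i j * K (x i) (x j)
          + pi i * \sum_j (A ^+ s) i j * ka j)
        = pi i * \sum_j (A ^+ s) i j *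
            (L * b ^+ 2 * (ka i + K (x i) (x j) + ka j)).
      have -> : pi i * ka i = \sum_j pi i * ((A ^+ s) i j * ka i).
        by rewrite -mulr_sumr -mulr_suml X1 mul1r.
      rewrite !mulr_sumr -!big_split/= mulr_sumr; apply: eq_bigr => j _.
      by ring.
    by rewrite ler_wpM2l//; apply: ler_sum => j _; rewrite ler_wpM2l.
  move=> h1.
  have h2 := Kmarkov x s pi0 pi1 stA revA.
  set E := \sum_i \sum_j pi i * A i j * K (x i) (x j) in h2.
  have hE : BB * (t%:R * E) = 2 * SH by exact: sumA.
  have E0 : 0 <= E.
    do 2 (apply: sumr_ge0 => ? _); apply: mulr_ge0 => //; apply: mulr_ge0 => //.
    exact: (proj1 stA).
  have h3 : M * s%:R * E <= M * (t%:R * E).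
    by rewrite -mulrA ler_wpM2l// ler_wpM2r// ler_nat.
  have h4 : BB * chain_energy N A pi u s <= BB * (L * b ^+ 2 *
      (\sum_i pi i * ka i + M * (t%:R * E) + \sum_i pi i * ka i)).
    rewrite ler_pM2l//; apply: (le_trans h1); rewrite ler_wpM2l//.
      by rewrite mulr_ge0// exprn_ge0.
    by rewrite lerD2r lerD2l (le_trans h2).
  apply: (le_trans h4).
  have -> : BB * (L * b ^+ 2 * (\sum_i pi i * ka i + M * (t%:R * E)
       + \sum_i pi i * ka i))
      = L * b ^+ 2 * (2 * (BB * \sum_i pi i * ka i) + M * (BB * (t%:R * E))).
    by ring.
  rewrite hE Bka.
  have -> : 2 * L * b ^+ 2 * M * (SH + SB)
     = L * b ^+ 2 * (2 * (M * SB) + M * (2 * SH)) by ring.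
  rewrite ler_wpM2l ?mulr_ge0 ?exprn_ge0// lerD2r ler_pM2l//.
  by rewrite ler_peMl.
have tpos : (0 < t)%N by [].
have [s [F [st hF1 hF2]]] := markov_cotype N0 NN Njensen b1 k1 Nadd Nuc u
  stA pi0 revA lazyA tpos.
exists F.
set W := SH + SB in Q *.
have W0 : 0 <= W by exact: addr_ge0.
set c := L * M * W.
have c0 : 0 <= c by rewrite !mulr_ge0.
have e1 : \sum_i \sum_j H i j * N (F i - F j) <= 3 * k * b ^+ 4 * c.
  have hs := sumA (fun i j => N (F i - F j)).
  have {hs} hs : BB * (t%:R * \sum_i \sum_j pi i * A i j * N (F i - F j))
      = 2 * \sum_i \sum_j H i j * N (F i - F j).
    by apply: hs => [i|i j]; [rewrite subrr|rewrite N_distC].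
  have e2 : \sum_i \sum_j pi i * A i j * N (F i - F j)
      = \sum_i pi i * \sum_j A i j * N (F i - F j).
    apply: eq_bigr => i _; rewrite mulr_sumr; apply: eq_bigr => j _.
    by rewrite mulrA.
  rewrite -e2 in hF1.
  have h5 : BB * (t%:R * \sum_i \sum_j pi i * A i j * N (F i - F j))
      <= BB * (3 * b ^+ 2 * k * chain_energy N A pi u t) by rewrite ler_pM2l.
  have h6 : 3 * b ^+ 2 * k * (BB * chain_energy N A pi u t)
      <= 3 * b ^+ 2 * k * (2 * L * b ^+ 2 * M * W).
    by rewrite ler_wpM2l ?Q// !mulr_ge0 ?exprn_ge0.
  have h7 : 3 * b ^+ 2 * k * (2 * L * b ^+ 2 * M * W)
     = 2 * (3 * k * b ^+ 4 * c) by rewrite /c; ring.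
  rewrite h7 in h6; rewrite hs in h5.
  have h8 : BB * (3 * b ^+ 2 * k * chain_energy N A pi u t)
     = 3 * b ^+ 2 * k * (BB * chain_energy N A pi u t) by ring.
  rewrite h8 in h5; have h9 := le_trans h5 h6.
  by rewrite ler_pM2l in h9.
have e2 : \sum_i \sum_r B i r * N (F i - f r) <= 4 * b ^+ 3 * c.
  apply: (@le_trans _ _ (\sum_i \sum_r B i r * (b * (N (F i - u i)
      + L * b ^+ 2 * (ka i + K (x i) (z r)))))).
    apply: ler_sum => i _; apply: ler_sum => r _; rewrite ler_pM2l//.
    rewrite -[F i - f r](subrKA (u i)).
    apply: (le_trans (Nadd _ _)); rewrite ler_wpM2l// lerD2l.
    exact: Nuf'.
  have BBsum (g : 'I_n -> R) : BB * (\sum_i pi i * g i) = \sum_i be i * g i.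
    by rewrite mulr_sumr; apply: eq_bigr => i _; rewrite mulrA BBpi.
  have -> : \sum_i \sum_r B i r * (b * (N (F i - u i)
      + L * b ^+ 2 * (ka i + K (x i) (z r))))
    = b * (BB * (\sum_i pi i * N (F i - u i)))
      + L * b ^+ 3 * (BB * (\sum_i pi i * ka i) + SB).
    rewrite !BBsum -big_split/= !mulr_sumr -big_split/=.
    apply: eq_bigr => i _.
    transitivity (\sum_r (B i r * (b * N (F i - u i) + L * b ^+ 3 * ka i)
        + L * b ^+ 3 * (B i r * K (x i) (z r)))).
      by apply: eq_bigr => r _; ring.
    by rewrite big_split/= -mulr_suml -mulr_sumr -/(be i); ring.
  have h1 : b * (BB * (\sum_i pi i * N (F i - u i))) <= b * (2 * L * b ^+ 2 * M * W).
    by rewrite ler_wpM2l// (le_trans _ (Q _ st))// ler_pM2l.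
  have h2 : L * b ^+ 3 * (BB * (\sum_i pi i * ka i) + SB) <= 2 * b ^+ 3 * c.
    rewrite Bka.
    have -> : 2 * b ^+ 3 * c = L * b ^+ 3 * (2 * (M * W)) by rewrite /c; ring.
    rewrite ler_wpM2l ?mulr_ge0 ?exprn_ge0//.
    have : W <= M * W by rewrite ler_peMl.
    by rewrite /W; lra.
  have h3 : b * (2 * L * b ^+ 2 * M * W) = 2 * b ^+ 3 * c by rewrite /c; ring.
  rewrite h3 in h1; apply: (le_trans (lerD h1 h2)).
  by rewrite -mulrDl -mulrDl; lra.
apply: (le_trans (lerD e1 e2)).
have -> : 7 * k * b ^+ 4 * L * M * W = 3 * k * b ^+ 4 * c + 4 * (k * b ^+ 4) * c.
  by rewrite /c; ring.
rewrite lerD2l ler_wpM2r// ler_pM2l// [b ^+ 4]exprS mulrA.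
by rewrite ler_peMl ?exprn_ge0// -[1]mulr1 ler_pM.
Qed.
End Weighted.

Lemma Nconv y z t : 0 <= t -> t <= 1 ->
  N ((1 - t) *: y + t *: z) <= (1 - t) * N y + t * N z.
Proof.
move=> t0 t1.
have := @Njensen bool (fun c => if c then t else 1 - t)
  (fun c => if c then z else y).
rewrite !big_bool /= [t *: z + _]addrC [t * N z + _]addrC; apply.
  by case=> //; lra.
by lra.
Qed.

(** The minimax runs over the functions [v] that dominate the ratios of some map on the new points;
    domination instead of equality makes them a convex set. The response is [weighted_extension],
    with constant 7, and the slack of the minimax makes it 8. New points are taken outside [S0] and
    without repetition, so that the denominators are positive off the diagonal. *)
Lemma finite_extension (S0 X : seq T) (f : T -> Z) (L : R) (a : T) : a \in S0 ->
  0 < L -> {in S0 &, forall r r', N (f r - f r') <= L * K r r'} ->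
  exists F : T -> Z, {in S0, F =1 f} /\
    {in S0 ++ X &, forall y z, N (F y - F z) <= 8 * k * b ^+ 4 * L * M * K y z}.
Proof.
move=> aS L0 fLip.
pose X' := undup [seq x <- X | x \notin S0].
pose n := size X'; pose x (i : 'I_n) := nth a X' i.
have xX' i : x i \in X' by rewrite mem_nth.
have xS i : x i \notin S0.
  by have := xX' i; rewrite mem_undup mem_filter => /andP[].
have xinj : injective x.
  move=> i j /eqP; rewrite nth_uniq// ?undup_uniq// => /eqP; exact: val_inj.
pose S : finType := seq_sub S0.
pose z (r : S) : T := val r.
have zS r : z r \in S0 by exact: valP.
have xz i r : 0 < K (x i) (z r).
  by apply: Kpos; apply: contraNneq (xS i) => ->.
have xx i j : i != j -> 0 < K (x i) (x j).
  by move=> ij; apply: Kpos; apply: contraNneq ij => /xinj ->.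
pose r0 : S := SeqSub aS.
pose f' (r : S) := f (z r).
have f'Lip r r' : N (f' r - f' r') <= L * K (z r) (z r') by exact: fLip.
pose D := 7 * k * b ^+ 4 * L * M.
have D0 : 0 <= D by rewrite !mulr_ge0 ?exprn_ge0// ltW.
pose V : set ('I_n * 'I_n + 'I_n * S -> R) := [set v |
  (forall c, 0 <= v c) /\ exists F : 'I_n -> Z,
    (forall i j, N (F i - F j) <= v (inl (i, j)) * K (x i) (x j)) /\
    (forall i r, N (F i - f' r) <= v (inr (i, r)) * K (x i) (z r))].
have [F [F1 F2]] : exists F : 'I_n -> Z,
    (forall i j, N (F i - F j) <= 8 * k * b ^+ 4 * L * M * K (x i) (x j)) /\
    (forall i r, N (F i - f' r) <= 8 * k * b ^+ 4 * L * M * K (x i) (z r)).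
  have [n0|npos] := posnP n.
    have no (i : 'I_n) : False by case: i => m; rewrite n0.
    by exists (fun=> 0); split => i; case: (no i).
  have V0 v : V v -> forall c, 0 <= v c by case.
  have Vconv v w t : V v -> V w -> 0 <= t -> t <= 1 ->
      V (fun c => (1 - t) * v c + t * w c).
    move=> [v0 [F [Fx Fz]]] [w0 [G [Gx Gz]]] t0 t1.
    have t10 : 0 <= 1 - t by lra.
    split=> [c|]; first by rewrite addr_ge0 ?mulr_ge0.
    exists (fun i => (1 - t) *: F i + t *: G i); split => [i j|i r].
      have -> : (1 - t) *: F i + t *: G i - ((1 - t) *: F j + t *: G j)
          = (1 - t) *: (F i - F j) + t *: (G i - G j).
        by rewrite !scalerBr opprD addrACA.
      apply: (le_trans (Nconv _ _ t0 t1)); rewrite [leRHS]mulrDl -!mulrA.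
      by apply: lerD; rewrite ler_wpM2l.
    have -> : (1 - t) *: F i + t *: G i - f' r
        = (1 - t) *: (F i - f' r) + t *: (G i - f' r).
      rewrite !scalerBr addrACA -opprD -scalerDl subrK scale1r//.
    apply: (le_trans (Nconv _ _ t0 t1)); rewrite [leRHS]mulrDl -!mulrA.
    by apply: lerD; rewrite ler_wpM2l.
  have e0 : 0 < k * b ^+ 4 * L * M.
    by rewrite !mulr_gt0 ?exprn_gt0//; exact: lt_le_trans ltr01 _.
  have [v [v0 [F [Fx Fz]]] vle] : exists2 v, V v &
      forall c, v c <= D + k * b ^+ 4 * L * M.
    apply: (@minimax_finite R _ (inr (Ordinal npos, r0)) V D) => // l l0.
    pose H i j := l (inl (i, j)) / K (x i) (x j).
    pose B i r := l (inr (i, r)) / K (x i) (z r).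
    have H0 i j : 0 <= H i j by rewrite divr_ge0// ltW.
    have B0 i r : 0 < B i r by rewrite divr_gt0.
    have [F hF] := weighted_extension r0 x (ltW L0) f'Lip H0 B0.
    exists (fun c => match c with
        | inl ij => N (F ij.1 - F ij.2) / K (x ij.1) (x ij.2)
        | inr ir => N (F ir.1 - f' ir.2) / K (x ir.1) (z ir.2) end).
      split; first by case=> -[i j]/=; rewrite divr_ge0.
      exists F; split => [i j|i r]/=; last by rewrite divfK// gt_eqF.
      have [->|ij] := eqVneq i j; first by rewrite subrr N00 Kxx mulr0.
      by rewrite divfK// gt_eqF ?xx.
    have split_sum (g : 'I_n * 'I_n + 'I_n * S -> R) : \sum_c g c =
        \sum_i \sum_j g (inl (i, j)) + \sum_i \sum_r g (inr (i, r)).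
      by rewrite big_sumType/= !pair_bigA/=; congr (_ + _);
         apply: eq_bigr => -[].
    rewrite !split_sum/=.
    have -> : \sum_i \sum_j l (inl (i, j)) * (N (F i - F j) / K (x i) (x j))
        = \sum_i \sum_j H i j * N (F i - F j).
      by apply: eq_bigr => i _; apply: eq_bigr => j _; rewrite /H mulrA mulrAC.
    have -> : \sum_i \sum_r l (inr (i, r)) * (N (F i - f' r) / K (x i) (z r))
        = \sum_i \sum_r B i r * N (F i - f' r).
      by apply: eq_bigr => i _; apply: eq_bigr => j _; rewrite /B mulrA mulrAC.
    apply: (le_trans hF); rewrite -/D ler_wpM2l//; apply: lerD.
      apply: ler_sum => i _; apply: ler_sum => j _.
      have [->|ij] := eqVneq i j; first by rewrite Kxx mulr0 ltW.
      by rewrite /H divfK// gt_eqF ?xx.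
    apply: ler_sum => i _; apply: ler_sum => r _.
    by rewrite /B divfK// gt_eqF.
  have DE : D + k * b ^+ 4 * L * M = 8 * k * b ^+ 4 * L * M by rewrite /D; ring.
  exists F; split => [i j|i r].
    by apply: (le_trans (Fx i j)); rewrite ler_wpM2r// -DE.
  by apply: (le_trans (Fz i r)); rewrite ler_wpM2r// -DE.
pose G t := if t \in S0 then f t else
  (if insub (index t X') is Some i then F i else 0).
have GS t : t \in S0 -> G t = f t by rewrite /G => ->.
have GX i : G (x i) = F i.
  rewrite /G (negbTE (xS i)) /x index_uniq ?undup_uniq//.
  by rewrite valK.
have inX t : t \in S0 ++ X -> t \notin S0 -> exists i, t = x i.
  rewrite mem_cat => /orP[->//|tX] tS.
  have tX' : t \in X' by rewrite mem_undup mem_filter tS.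
  have ti : (index t X' < n)%N by rewrite index_mem.
  by exists (Ordinal ti); rewrite /x nth_index.
have DL : L <= 8 * k * b ^+ 4 * L * M.
  have kb : 1 <= k * b ^+ 4 by rewrite -[1]mulr1 ler_pM// exprn_ege1.
  have kbM : 1 <= k * b ^+ 4 * M by rewrite -[1]mulr1 ler_pM.
  have -> : 8 * k * b ^+ 4 * L * M = 8 * (k * b ^+ 4 * M) * L by ring.
  by rewrite ler_peMl ?ltW//; lra.
exists G; split=> // y w yin win.
have [yS|yS] := boolP (y \in S0); have [wS|wS] := boolP (w \in S0).
- by rewrite !GS//; apply: (le_trans (fLip _ _ yS wS)); rewrite ler_wpM2r.
- have [i ->] := inX _ win wS; rewrite GS// GX N_distC// Ksym.
  exact: (F2 i (SeqSub yS)).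
- have [i ->] := inX _ yin yS; rewrite (GS w)// GX.
  exact: (F2 i (SeqSub wS)).
- by have [i ->] := inX _ yin yS; have [j ->] := inX _ win wS; rewrite !GX.
Qed.

Lemma Ntri3 y1 y2 y3 y4 :
  N (y1 - y4) <= b ^+ 2 * (N (y1 - y2) + N (y2 - y3) + N (y3 - y4)).
Proof.
have h1 : N (y1 - y4) <= b * (N (y1 - y2) + N (y2 - y4)).
  by apply: le_trans (Nadd _ _); rewrite addrA subrK.
have h2 : N (y2 - y4) <= b * (N (y2 - y3) + N (y3 - y4)).
  by apply: le_trans (Nadd _ _); rewrite addrA subrK.
apply: (le_trans h1); rewrite expr2 -mulrA ler_wpM2l// -addrA mulrDr.
by apply: lerD => //; rewrite ler_peMl.
Qed.

Lemma Ktri3 x1 x2 x3 x4 : K x1 x4 <= b ^+ 2 * (K x1 x2 + K x2 x3 + K x3 x4).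
Proof.
apply: (le_trans (Ktri _ x2 _)); rewrite expr2 -mulrA ler_wpM2l// -addrA mulrDr.
by apply: lerD => //; rewrite ler_peMl.
Qed.

Hypothesis Ncomplete : forall z : nat -> Z,
  (forall e, 0 < e -> exists m, forall i j, (m <= i)%N -> (m <= j)%N ->
     N (z i - z j) <= e) ->
  exists l, forall e, 0 < e -> exists m, forall i, (m <= i)%N -> N (z i - l) <= e.
Variable s : nat -> T.
Hypothesis sdense : forall x e, 0 < e -> exists i, K x (s i) < e.

(* Near-minimisers of the weighted energies Phi over the decreasing convex sets
   E i of extensions to finitely many points form a Cauchy sequence by uniform
   convexity; this replaces weak compactness. *)
Lemma dense_extension (S0 : seq T) (f : T -> Z) (L : R) (a : T) : a \in S0 ->
  0 < L -> {in S0 &, forall r r', N (f r - f r') <= L * K r r'} ->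
  exists G : nat -> Z,
    (forall i j, N (G i - G j)
       <= 8 * k * b ^+ 6 * L * M * K (s i) (s j)) /\
    (forall i, {in S0, forall r, N (G i - f r)
       <= 8 * k * b ^+ 6 * L * M * K (s i) r}).
Proof.
move=> aS L0 fLip; set D := 8 * k * b ^+ 4 * L * M.
have D0 : 0 <= D by rewrite !mulr_ge0 ?exprn_ge0// ltW.
have -> : 8 * k * b ^+ 6 * L * M = b ^+ 2 * D by rewrite /D; ring.
pose pts i := S0 ++ [seq s j | j <- iota 0 i.+1].
pose E i : set (T -> Z) := [set F : T -> Z | {in S0, F =1 f} /\
  {in pts i &, forall y z, N (F y - F z) <= D * K y z}].
have E0 i : exists F, E i F by exact: finite_extension aS L0 fLip.
have spts n i : (n <= i)%N -> s n \in pts i.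
  by move=> ni; rewrite mem_cat map_f ?orbT// mem_iota.
have Spts r i : r \in S0 -> r \in pts i by rewrite mem_cat => ->.
have Esub i j : (i <= j)%N -> E j `<=` E i.
  have ptsS y : (i <= j)%N -> y \in pts i -> y \in pts j.
    move=> ij; rewrite !mem_cat => /orP[->//|/mapP[n nin ->]].
    rewrite map_f ?orbT//; move: nin; rewrite !mem_iota /= !add0n => /leq_trans.
    by apply.
  by move=> ij F [FS FL]; split=> // y z yi zi; apply: FL; exact: ptsS.
have Emid i F G : E i F -> E i G -> E i (fun t => 2^-1 *: (F t + G t)).
  move=> [FS FL] [GS GL]; split=> [y yS|y z yi zi].
    by rewrite FS// GS// scalerDr; exact: scaler_halfD.
  have h12 : 1 - 2^-1 = 2^-1 :> R by lra.
  have -> : 2^-1 *: (F y + G y) - 2^-1 *: (F z + G z)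
      = (1 - 2^-1) *: (F y - F z) + 2^-1 *: (G y - G z).
    by rewrite h12 -scalerDr -scalerBr opprD addrACA.
  apply: (le_trans (Nconv _ _ _ _)); [lra|lra|].
  by have := FL _ _ yi zi; have := GL _ _ yi zi; rewrite h12; lra.
(* The denominator bounds, up to a constant, [N (F (s n))] for [F] in [E i] and [n <= i]; hence the
   energies have a bound independent of [i]. *)
pose w n : R := 2 ^- n / (1 + N (f a) + K (s n) a).
have den n : 0 < 1 + N (f a) + K (s n) a.
  by rewrite -addrA ltr_pwDl// addr_ge0.
have w0 n : 0 < w n by rewrite divr_gt0// invr_gt0 exprn_gt0.
pose Phi i (F : T -> Z) := \sum_(n < i.+1) w n * N (F (s n)).
have Phi0 i F : 0 <= Phi i F.
  by apply: sumr_ge0 => n _; rewrite mulr_ge0// ltW.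
have geo m : \sum_(n < m) 2 ^- n <= 2 :> R.
  have : \sum_(n < m) 2 ^- n + 2 * 2 ^- m = 2 :> R.
    elim: m => [|m IH]; first by rewrite big_ord0 expr0 invr1; lra.
    rewrite big_ord_recr/= -[RHS]IH exprS invfM; lra.
  have : 0 <= 2 ^- m :> R by rewrite invr_ge0 exprn_ge0.
  by lra.
have Phiub i F : E i F -> Phi i F <= b * (D + 1) * 2.
  move=> [FS FL].
  apply: (@le_trans _ _ (\sum_(n < i.+1) b * (D + 1) * 2 ^- n)); last first.
    by rewrite -mulr_sumr ler_wpM2l// mulr_ge0// addr_ge0.
  apply: ler_sum => n _; rewrite /w mulrAC ler_pdivrMr// mulrC mulrAC.
  rewrite ler_pM2r ?invr_gt0 ?exprn_gt0//.
  have h1 : N (F (s n)) <= b * (N (F (s n) - f a) + N (f a)).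
    by apply: le_trans (Nadd _ _); rewrite subrK.
  have h2 : N (F (s n) - f a) <= D * K (s n) a.
    by rewrite -(FS a aS); apply: FL; [apply: spts; rewrite -ltnS|exact: Spts].
  apply: (le_trans h1); rewrite -mulrA ler_wpM2l//.
  have := mulr_ge0 D0 (N0 (f a)); have := K0 (s n) a; have := N0 (f a).
  by rewrite !mulrDr !mulrDl; lra.
pose r i := inf (Phi i @` E i).
have hinf i : has_inf (Phi i @` E i).
  split; first by have [F EF] := E0 i; exists (Phi i F), F.
  by exists 0 => _ [F _ <-].
have rle i F : E i F -> r i <= Phi i F.
  by move=> EF; apply: ge_inf; [case: (hinf i)|exists F].
have rmon i j : (i <= j)%N -> r i <= r j.
  move=> ij; apply: lb_le_inf; first by case: (hinf j).
  move=> _ [F EF <-]; apply: (le_trans (rle i F (Esub _ _ ij _ EF))).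
  rewrite /Phi -!(big_mkord xpredT (fun n => w n * N (F (s n)))).
  rewrite (@big_cat_nat _ _ _ i.+1 0 j.+1)//= lerDl sumr_ge0// => n _.
  by rewrite mulr_ge0// ltW.
have hsup : has_sup (range r).
  split; first by exists (r 0%N), 0%N.
  exists (b * (D + 1) * 2) => _ [i _ <-].
  by have [F EF] := E0 i; apply: (le_trans (rle i F EF)); exact: Phiub.
have rcauchy e : 0 < e -> exists m, forall i j, (m <= i)%N -> (i <= j)%N ->
    r j - r i <= e.
  move=> e0; have [_ [m _ <-] hm] := sup_adherent e0 hsup.
  exists m => i j mi ij.
  have h1 : r j <= sup (range r) by apply: ub_le_sup; [case: hsup|exists j].
  by have := rmon _ _ mi; lra.
have /choice[F FP] : forall i, exists G : T -> Z,
    E i G /\ Phi i G < r i + i.+1%:R^-1.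
  move=> i.
  have i0 : 0 < i.+1%:R^-1 :> R by rewrite invr_gt0 ltr0n.
  by have [_ [G EG <-] hG] := inf_adherent i0 (hinf i); exists G.
(* The midpoint of [F i] and [F j] lies in [E i], so its energy is at least [r i], while the
   energies of both maps are nearly at most [r j]; uniform convexity turns this small defect into
   closeness. *)
have key n i j : (n <= i)%N -> (i <= j)%N -> w n * N (F i (s n) - F j (s n))
    <= 2 * (b * k) * ((r j - r i) + i.+1%:R^-1).
  move=> ni ij; have [Ei hi] := FP i; have [Ej hj] := FP j.
  have Eji := Esub _ _ ij _ Ej.
  have hm := rle _ _ (Emid _ _ _ Ei Eji).
  have hji : Phi i (F j) <= Phi j (F j).
    rewrite /Phi -!(big_mkord xpredT (fun n => w n * N (F j (s n)))).
    rewrite (@big_cat_nat _ _ _ i.+1 0 j.+1)//= lerDl sumr_ge0// => l _.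
    by rewrite mulr_ge0// ltW.
  have hinv : j.+1%:R^-1 <= i.+1%:R^-1 :> R by rewrite lef_pV2 ?posrE ?ltr0n ?ler_nat.
  apply: (@le_trans _ _ (\sum_(n < i.+1) w n * N (F i (s n) - F j (s n)))).
    have ni' : (n < i.+1)%N by [].
    rewrite (bigD1 (Ordinal ni'))//= lerDl sumr_ge0// => l _.
    by rewrite mulr_ge0// ltW.
  apply: (@le_trans _ _ (2 * (b * k) * ((Phi i (F i) + Phi i (F j)) / 2
      - Phi i (fun t => 2^-1 *: (F i t + F j t))))).
    rewrite /Phi -big_split/= mulr_suml -sumrB mulr_sumr.
    apply: ler_sum => l _.
    have := uc_half b1 Nadd Nuc (F i (s l)) (F j (s l)).
    have := w0 l.
    set X := N _; set Y1 := N _; set Y2 := N _; set Y3 := N _ => wl hX.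
    apply: (le_trans (ler_wpM2l (ltW wl) hX)).
    by rewrite le_eqVlt; apply/orP; left; apply/eqP; field.
  rewrite ler_wpM2l//; first by rewrite mulr_ge0// mulr_ge0.
  have := rmon _ _ ij; move: hi hj hinv.
  by move: (i.+1%:R^-1) (j.+1%:R^-1) => u v hi hj hinv hr; lra.
have bk0 : 0 < 2 * (b * k).
  by rewrite !mulr_gt0//; exact: lt_le_trans ltr01 _.
have cau n : exists l, forall e, 0 < e -> exists m, forall i, (m <= i)%N ->
    N (F i (s n) - l) <= e.
  apply: Ncomplete => e e0.
  pose e' := e * w n / (2 * (b * k)) / 2.
  have e'0 : 0 < e' by rewrite !divr_gt0// mulr_gt0.
  have [m1 hm1] := rcauchy _ e'0.
  pose m2 := Num.truncn e'^-1.
  have hm2 i : (m2 <= i)%N -> i.+1%:R^-1 <= e'.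
    move=> mi; rewrite -[leRHS]invrK lef_pV2 ?posrE ?ltr0n ?invr_gt0//.
    by apply/ltW/(lt_le_trans (truncnS_gt _)); rewrite ler_nat ltnS.
  have half_case i j : (maxn n (maxn m1 m2) <= i)%N -> (i <= j)%N ->
      N (F i (s n) - F j (s n)) <= e.
    rewrite !geq_max => /andP[ni /andP[m1i m2i]] ij.
    have := key n i j ni ij; have := hm1 i j m1i ij; have := hm2 i m2i => h2 h1 h.
    rewrite -(ler_pM2l (w0 n)); apply: (le_trans h).
    apply: (@le_trans _ _ (2 * (b * k) * (e' + e'))).
      by rewrite ler_pM2l//; exact: lerD.
    rewrite le_eqVlt; apply/orP; left; apply/eqP; rewrite /e'; field.
    by rewrite !gt_eqF//; exact: lt_le_trans ltr01 _.
  exists (maxn n (maxn m1 m2)) => i j mi mj.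
  by have [ij|/ltnW ji] := leqP i j; [|rewrite N_distC//]; exact: half_case.
have [G hG] := choice cau.
have eps (X c C0 : R) : 0 <= C0 -> (forall e, 0 < e -> X <= c + C0 * e) -> X <= c.
  move=> C00 h; apply/ler_addgt0Pr => e e0.
  have C1 : 0 < C0 + 1 by lra.
  apply: (le_trans (h _ (divr_gt0 e0 C1))); rewrite lerD2l mulrA ler_pdivrMr//.
  by lra.
exists G; split=> [i j|i c cS].
  apply: (eps _ _ (b ^+ 2 * 2)); first by rewrite mulr_ge0 ?exprn_ge0.
  move=> e e0; have [m1 h1] := hG i e e0; have [m2 h2] := hG j e e0.
  pose m := maxn (maxn i j) (maxn m1 m2).
  have [[mi mj] [mm1 mm2]] : ((i <= m)%N /\ (j <= m)%N) /\
      ((m1 <= m)%N /\ (m2 <= m)%N).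
    by rewrite !leq_max !leqnn ?orbT.
  apply: (le_trans (Ntri3 _ (F m (s i)) (F m (s j)) _)).
  have -> : b ^+ 2 * D * K (s i) (s j) + b ^+ 2 * 2 * e
    = b ^+ 2 * (e + D * K (s i) (s j) + e) by ring.
  rewrite ler_wpM2l ?exprn_ge0//; apply: lerD; last exact: h2.
  apply: lerD; first by rewrite N_distC//; exact: h1.
  by case: (proj1 (FP m)) => _; apply; exact: spts.
apply: (eps _ _ (b ^+ 2)); first by rewrite exprn_ge0.
move=> e e0; have [m1 h1] := hG i e e0; pose m := maxn i m1.
have [mi mm1] : (i <= m)%N /\ (m1 <= m)%N by rewrite !leq_max !leqnn ?orbT.
apply: (le_trans (Ntri3 _ (F m (s i)) (f c) _)); rewrite subrr N00 addr0.
have -> : b ^+ 2 * D * K (s i) c + b ^+ 2 * e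
    = b ^+ 2 * (e + D * K (s i) c) by ring.
rewrite ler_wpM2l ?exprn_ge0//; apply: lerD; first by rewrite N_distC//; exact: h1.
have [[FS FL] _] := FP m.
by rewrite -(FS c cS); apply: FL; [exact: spts|exact: Spts].
Qed.

(** The value at [x] is the limit of [G] along points of the dense sequence tending to [x]. As [N]
    and [K] satisfy the triangle inequality only up to [b], the limit does not keep the constant: a
    four-point inequality for each of them costs [b ^+ 4] in all. *)
Lemma full_extension (S0 : seq T) (f : T -> Z) (L : R) (a : T) : a \in S0 ->
  0 < L -> {in S0 &, forall r r', N (f r - f r') <= L * K r r'} ->
  exists F : T -> Z,
    (forall x y, N (F x - F y) <= 8 * k * b ^+ 10 * L * M * K x y) /\
    (forall x, {in S0, forall r, N (F x - f r)
       <= 8 * k * b ^+ 10 * L * M * K x r}).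
Proof.
move=> aS L0 fLip; have [G [G1 G2]] := dense_extension aS L0 fLip.
set D := 8 * k * b ^+ 6 * L * M in G1 G2.
have D0 : 0 <= D by rewrite !mulr_ge0 ?exprn_ge0// ltW.
have -> : 8 * k * b ^+ 10 * L * M = b ^+ 4 * D by rewrite /D; ring.
clearbody D.
have inv0 (j : nat) : 0 < j.+1%:R^-1 :> R by rewrite invr_gt0 ltr0n.
have invle e : 0 < e -> exists m : nat, forall i, (m <= i)%N -> i.+1%:R^-1 <= e :> R.
  move=> e0; exists (Num.truncn e^-1) => i mi.
  rewrite -[leRHS]invrK lef_pV2 ?posrE ?ltr0n ?invr_gt0//.
  by apply/ltW/(lt_le_trans (truncnS_gt _)); rewrite ler_nat ltnS.
have /choice[h hP] : forall xj : T * nat, exists n, K xj.1 (s n) < xj.2.+1%:R^-1.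
  by move=> [x j]; exact: sdense.
have hK x j : K x (s (h (x, j))) <= j.+1%:R^-1 by exact/ltW/(hP (x, j)).
have cau x : exists l, forall e, 0 < e -> exists m, forall i, (m <= i)%N ->
    N (G (h (x, i)) - l) <= e.
  apply: Ncomplete => e e0.
  have c0 : 0 < D * b * 2 + 1 by rewrite ltr_wpDl// !mulr_ge0.
  have [m hm] := invle _ (divr_gt0 e0 c0).
  exists m => i j mi mj; apply: (le_trans (G1 _ _)).
  apply: (@le_trans _ _ (D * (b * (i.+1%:R^-1 + j.+1%:R^-1)))).
    rewrite ler_wpM2l//; apply: (le_trans (Ktri _ x _)); rewrite ler_wpM2l//.
    by apply: lerD; rewrite 1?Ksym// ?[K (s _) _]Ksym.
  apply: (@le_trans _ _ (D * b * 2 * (e / (D * b * 2 + 1)))).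
    have -> : D * b * 2 * (e / (D * b * 2 + 1))
        = D * (b * (e / (D * b * 2 + 1) + e / (D * b * 2 + 1))) by ring.
    rewrite ler_wpM2l// ler_wpM2l//; apply: lerD; exact: hm.
  rewrite mulrA ler_pdivrMr//; have := mulr_ge0 (mulr_ge0 D0 b0) (ler0n R 2).
  by nra.
have [F hF] := choice cau.
have eps (X c C0 : R) : 0 <= C0 -> (forall e, 0 < e -> X <= c + C0 * e) -> X <= c.
  move=> C00 hX; apply/ler_addgt0Pr => e e0.
  have C1 : 0 < C0 + 1 by lra.
  apply: (le_trans (hX _ (divr_gt0 e0 C1))); rewrite lerD2l mulrA ler_pdivrMr//.
  by lra.
exists F; split=> [x y|x c cS].
  apply: (eps _ _ (b ^+ 2 * 2 + b ^+ 4 * D * 2)).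
    by rewrite addr_ge0// !mulr_ge0 ?exprn_ge0.
  move=> e e0; have [m1 h1] := hF x e e0; have [m2 h2] := hF y e e0.
  have [m3 h3] := invle e e0.
  pose m := maxn m1 (maxn m2 m3).
  have [mm1 mm2 mm3] : [/\ (m1 <= m)%N, (m2 <= m)%N & (m3 <= m)%N].
    by split; rewrite !leq_max leqnn ?orbT.
  apply: (le_trans (Ntri3 _ (G (h (x, m))) (G (h (y, m))) _)).
  have -> : b ^+ 4 * D * K x y + (b ^+ 2 * 2 + b ^+ 4 * D * 2) * e
    = b ^+ 2 * (e + D * (b ^+ 2 * (e + K x y + e)) + e) by ring.
  rewrite ler_wpM2l ?exprn_ge0//; apply: lerD; last exact: h2.
  apply: lerD; first by rewrite N_distC//; exact: h1.
  apply: (le_trans (G1 _ _)); rewrite ler_wpM2l//.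
  apply: (le_trans (Ktri3 _ x y _)); rewrite ler_wpM2l ?exprn_ge0//.
  have h3m := h3 m mm3.
  apply: lerD; [apply: lerD => //; rewrite Ksym|];
    exact: le_trans (hK _ m) h3m.
apply: (eps _ _ (b ^+ 2 + b ^+ 4 * D)).
  by rewrite addr_ge0// ?mulr_ge0 ?exprn_ge0.
move=> e e0; have [m1 h1] := hF x e e0; have [m3 h3] := invle e e0.
pose m := maxn m1 m3.
have [mm1 mm3] : (m1 <= m)%N /\ (m3 <= m)%N by rewrite !leq_max !leqnn ?orbT.
apply: (le_trans (Ntri3 _ (G (h (x, m))) (f c) _)); rewrite subrr N00 addr0.
have -> : b ^+ 4 * D * K x c + (b ^+ 2 + b ^+ 4 * D) * e
    = b ^+ 2 * (e + D * (b ^+ 2 * (e + K x c))) by ring.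
rewrite ler_wpM2l ?exprn_ge0//; apply: lerD; first by rewrite N_distC//; exact: h1.
apply: (le_trans (G2 _ _ cS)); rewrite ler_wpM2l//.
apply: (le_trans (Ktri3 _ x c _)); rewrite Kxx addr0 ler_wpM2l ?exprn_ge0//.
rewrite lerD2r Ksym; exact: le_trans (hK _ m) (h3 m mm3).
Qed.
End Extension.

(** * The space l_q(Y) with finitely many coordinates *)

Section LqFinite.
Context {R : realType} {Y : completeNormedModType R} {m : nat}.
Variables (q Kc : R).
Hypothesis q1 : 1 <= q.
Hypothesis Kuc : forall x y : Y, `|y| `^ q <=
  Kc `^ q * ((`|x + y| `^ q + `|x - y| `^ q) / 2 - `|x| `^ q).

Let q0 : 0 <= q. Proof. exact: le_trans q1. Qed.
Let qn0 : q != 0. Proof. by rewrite gt_eqF// (lt_le_trans ltr01). Qed.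
Let Z := {ffun 'I_m -> Y}.

(** The instance of [N] in the extension argument, with [b = 2 ^ q] and [k = Kc ^ q]. *)
Definition lqpow (z : Z) : R := \sum_l `|z l| `^ q.

Lemma lqpow_ge0 z : 0 <= lqpow z.
Proof. by apply: sumr_ge0 => *; exact: powR_ge0. Qed.

Lemma lqpow0 : lqpow 0 = 0.
Proof. by rewrite /lqpow big1// => l _; rewrite ffunE normr0 powR0. Qed.

Lemma lqpowN z : lqpow (- z) = lqpow z.
Proof. by apply: eq_bigr => l _; rewrite ffunE normrN. Qed.

Lemma lqpow_jensen (J : finType) (a : J -> R) (z : J -> Z) :
  (forall j, 0 <= a j) -> \sum_j a j = 1 ->
  lqpow (\sum_j a j *: z j) <= \sum_j a j * lqpow (z j).
Proof.
move=> a0 a1; under [leRHS]eq_bigr do rewrite mulr_sumr.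
rewrite exchange_big/=; apply: ler_sum => l _.
have -> : (\sum_j a j *: z j) l = \sum_j a j *: z j l.
  by rewrite sum_ffunE; apply: eq_bigr => j _; rewrite ffunE.
exact: normpow_sum.
Qed.

Lemma lqpow_add (y z : Z) : lqpow (y + z) <= 2 `^ q * (lqpow y + lqpow z).
Proof.
rewrite /lqpow -big_split/= mulr_sumr; apply: ler_sum => l _.
by rewrite ffunE; exact: normpow_add.
Qed.

Lemma lqpow_uc (x y : Z) : lqpow y <=
  Kc `^ q * ((lqpow (x + y) + lqpow (x - y)) / 2 - lqpow x).
Proof.
rewrite /lqpow -big_split/= mulr_suml -sumrB mulr_sumr; apply: ler_sum => l _.
by rewrite !ffunE; exact: Kuc.
Qed.

Lemma lqpow_complete (z : nat -> Z) :
  (forall e, 0 < e -> exists n, forall i j, (n <= i)%N -> (n <= j)%N ->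
     lqpow (z i - z j) <= e) ->
  exists l, forall e, 0 < e -> exists n, forall i, (n <= i)%N ->
    lqpow (z i - l) <= e.
Proof.
move=> cau.
have coord (w : Z) l : `|w l| `^ q <= lqpow w.
  by rewrite /lqpow (bigD1 l)//= lerDl sumr_ge0// => *; exact: powR_ge0.
have cvgl l : cvg ((fun i => z i l) @ \oo).
  apply/cauchy_cvgP/cauchy_exP => e e0.
  have e2 : 0 < (e / 2) `^ q by rewrite powR_gt0// divr_gt0.
  have [n hn] := cau _ e2; exists (z n l).
  exists n => // i /= ni.
  rewrite -ball_normE/=; apply: (@le_lt_trans _ _ (e / 2)); last by lra.
  have := le_trans (coord (z n - z i) l) (hn n i (leqnn _) ni).
  rewrite !ffunE => h.
  rewrite leNgt; apply/negP => hlt.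
  move: h; apply/negP; rewrite -ltNge.
  by rewrite gt0_ltr_powR ?nnegrE ?(lt_le_trans ltr01)//; lra.
exists [ffun l => lim ((fun i => z i l) @ \oo)] => e e0.
have e1 : 0 < e / m.+1%:R by rewrite divr_gt0// ltr0n.
have e2 : 0 < (e / m.+1%:R) `^ q^-1 by rewrite powR_gt0.
have hl l : exists n, forall i, (n <= i)%N ->
    `|(z i - [ffun l => lim ((fun i => z i l) @ \oo)]) l| `^ q <= e / m.+1%:R.
  have /cvgrPdist_le /(_ _ e2) [n _ hn] := cvgl l.
  exists n => i ni; rewrite !ffunE -[leRHS](@powR_rootK _ q)//; last exact: ltW.
  by apply: ler_powR2 => //; rewrite distrC; exact: hn.
have /choice[h hP] := hl.
exists (\max_l h l)%N => i hi.
apply: (@le_trans _ _ (\sum_(l < m) (e / m.+1%:R))).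
  apply: ler_sum => l _; apply: hP; apply: leq_trans hi; exact: leq_bigmax.
rewrite sumr_const card_ord -[leLHS]mulr_natr mulrAC ler_pdivrMr ?ltr0n//.
by rewrite ler_wpM2l ?(ltW e0)// ler_nat.
Qed.
End LqFinite.

(** * Dominated convergence for iterated integrals *)

Section IteratedConvergence.
Context {dsp : measure_display} {B : measurableType dsp} {R : realType}.
Variable mu : probability B R.

Lemma dominated_ge0_cvg (f_ : nat -> B -> \bar R) (f g : B -> \bar R) :
  (forall n, measurable_fun setT (f_ n)) -> measurable_fun setT g ->
  (forall n x, (0 <= f_ n x)%E) -> (forall n x, (f_ n x <= g x)%E) ->
  (\int[mu]_x g x < +oo)%E -> (forall x, f_ n x @[n --> \oo] --> f x) ->
  measurable_fun setT f /\
  (\int[mu]_x f_ n x)%E @[n --> \oo] --> (\int[mu]_x f x)%E.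
Proof.
move=> mf mg f0 fg gfin fcvg.
have mf' : measurable_fun setT f.
  by apply: (emeasurable_fun_cvg f_) => // x _; exact: fcvg.
split=> //.
have g0 x : (0 <= g x)%E by apply: le_trans (fg 0%N x); exact: f0.
have ig : mu.-integrable setT g.
  apply/integrableP; split=> //.
  by under eq_integral do rewrite gee0_abs//.
have aeg : \forall x \ae mu, forall n, setT x -> (`|f_ n x| <= g x)%E.
  by apply: aeW => x n _; rewrite gee0_abs.
have aec : \forall x \ae mu, setT x -> f_ n x @[n --> \oo] --> f x.
  by apply: aeW => x _; exact: fcvg.
by have [_ _] := dominated_convergence measurableT mf mf' aec ig aeg.
Qed.

Variables (g : B -> R) (G : R).
Hypothesis mg : measurable_fun setT g.
Hypothesis g0 : forall x, 0 <= g x.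
Hypothesis intg : (\int[mu]_x (g x)%:E = G%:E)%E.

Lemma integral_affine (c a : R) : 0 <= c -> 0 <= a ->
  (\int[mu]_y (c * (a + g y))%:E = (c * (a + G))%:E)%E.
Proof.
move=> c0 a0.
have mg' : measurable_fun setT (EFin \o g) by exact/measurable_EFinP.
under eq_integral do rewrite EFinM EFinD.
rewrite ge0_integralZl_EFin//; last 2 first.
- by move=> x _; rewrite adde_ge0// lee_fin.
- by apply: emeasurable_funD => //; exact: measurable_cst.
rewrite ge0_integralD//; last 1 first.
  by move=> x _; rewrite lee_fin.
have -> : (\int[mu]_(x in setT) a%:E = a%:E)%E.
  rewrite (integral_cst mu measurableT a%:E) -[RHS]mule1; congr (_ * _)%E.
  exact: probability_setT.
by rewrite intg -EFinD -EFinM.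
Qed.

(** Dominated convergence is used twice, the inner integrals being dominated by [c * (G + g x)].
    Measurability of the limit and of its inner integral is a conclusion: it is inherited from the
    approximations at each stage. *)
Lemma iterated_dominated_cvg (h_ : nat -> B -> B -> R) (h : B -> B -> R)
    (c : R) :
  0 <= c -> (forall n x, measurable_fun setT (h_ n x)) ->
  (forall n, measurable_fun setT (fun x => \int[mu]_y (h_ n x y)%:E)%E) ->
  (forall n x y, 0 <= h_ n x y) ->
  (forall n x y, h_ n x y <= c * (g x + g y)) ->
  (forall x y, h_ n x y @[n --> \oo] --> h x y) ->
  [/\ forall x, measurable_fun setT (h x),
      measurable_fun setT (fun x => \int[mu]_y (h x y)%:E)%E &
      (\int[mu]_x \int[mu]_y (h_ n x y)%:E)%E @[n --> \oo]
        --> (\int[mu]_x \int[mu]_y (h x y)%:E)%E].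
Proof.
move=> c0 mh mih h0 hc hcvg.
have maff a : measurable_fun setT (fun y => (c * (a + g y))%:E).
  apply/measurable_EFinP; apply: measurable_funM => //.
  by apply: measurable_funD.
have G0 : 0 <= G.
  by rewrite -lee_fin -intg; apply: integral_ge0 => y _; rewrite lee_fin.
have inner x : measurable_fun setT (fun y => (h x y)%:E) /\
    (\int[mu]_y (h_ n x y)%:E)%E @[n --> \oo] --> (\int[mu]_y (h x y)%:E)%E.
  apply: (@dominated_ge0_cvg _ _ (fun y => (c * (g x + g y))%:E)) => //.
  - by move=> n; exact/measurable_EFinP.
  - by move=> n y; rewrite lee_fin.
  - by move=> n y; rewrite lee_fin.
  - by rewrite integral_affine// ltry.
  - by move=> y; apply: cvg_EFin; [exact: nearW | exact: hcvg].
have [mo co] : measurable_fun setT (fun x => \int[mu]_y (h x y)%:E)%E /\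
    (\int[mu]_x \int[mu]_y (h_ n x y)%:E)%E @[n --> \oo]
        --> (\int[mu]_x \int[mu]_y (h x y)%:E)%E.
  apply: (@dominated_ge0_cvg _ _ (fun x => (c * (G + g x))%:E)) => //.
  - by move=> n x; apply: integral_ge0 => y _; rewrite lee_fin.
  - move=> n x; rewrite addrC -integral_affine//.
    apply: ge0_le_integral => //.
    + by move=> y _; rewrite lee_fin.
    + exact/measurable_EFinP.
    + by move=> y _; rewrite lee_fin.
  - by rewrite integral_affine// ltry.
  - by move=> x; exact: (proj2 (inner x)).
split=> // x; apply/measurable_EFinP; exact: (proj1 (inner x)).
Qed.
End IteratedConvergence.

(** * Nearest points in the prefixes of a dense sequence *)

Section NearestPoint.
Context {dsp : measure_display} {B : measurableType dsp} {R : realType}.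
Variables (mu : probability B R) (dl : B -> B -> R) (s : nat -> B).
Hypothesis dl0 : forall x y, 0 <= dl x y.
Hypothesis mdl : forall a, measurable_fun setT (fun x => dl x a).
Hypothesis sdense : forall x e, 0 < e -> exists i, dl x (s i) < e.

(** Ties keep the earlier index. Indices instead of points give a measurable map into a discrete
    set, through which every function is measurable. *)
Fixpoint nearest i (x : B) : nat :=
  if i is i'.+1 then
    if dl x (s i) < dl x (s (nearest i' x)) then i else nearest i' x
  else 0%N.

Lemma nearest_le i x : (nearest i x <= i)%N.
Proof. by elim: i => //= i IH; case: ifP => // _; exact: leq_trans IH _. Qed.

Lemma nearest_min i j x : (j <= i)%N -> dl x (s (nearest i x)) <= dl x (s j).
Proof.
elim: i => [|i IH] /=; first by rewrite leqn0 => /eqP->.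
rewrite leq_eqVlt => /orP[/eqP->|ji].
  by case: ltP => // /ltW.
by case: ltP => [/ltW/le_trans|_]; [apply|]; exact: IH.
Qed.

Lemma nearest_small x e : 0 < e -> exists m, forall i, (m <= i)%N ->
  dl x (s (nearest i x)) < e.
Proof.
move=> e0; have [m hm] := sdense x e0; exists m => i mi.
exact: le_lt_trans (nearest_min x mi) hm.
Qed.

Lemma measurable_nearest i : measurable_fun setT (nearest i) /\
  measurable_fun setT (fun x => dl x (s (nearest i x))).
Proof.
elim: i => [|i [IH1 IH2]] /=; first by split => //; exact: mdl.
have mlt : measurable_fun setT
    (fun x => dl x (s i.+1) < dl x (s (nearest i x))).
  by apply: measurable_fun_ltr => //; exact: mdl.
split; first by apply: measurable_fun_ifT => //; exact: measurable_cst.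
rewrite (_ : (fun x => _) = (fun x =>
   if dl x (s i.+1) < dl x (s (nearest i x)) then dl x (s i.+1)
   else dl x (s (nearest i x)))); last by apply/funext => x; case: ifP.
by apply: measurable_fun_ifT => //; exact: mdl.
Qed.

Definition weight i l : R := fine (mu (nearest i @^-1` [set l])).

Lemma weight_ge0 i l : 0 <= weight i l.
Proof. exact: fine_ge0. Qed.

Lemma measurable_step i (h : nat -> R) :
  measurable_fun setT (fun x => h (nearest i x)).
Proof.
apply: (@measurableT_comp _ _ _ _ _ _ h) => //.
exact: (proj1 (measurable_nearest i)).
Qed.

Lemma integral_step i (h : nat -> R) : (forall l, 0 <= h l) ->
  (\int[mu]_x (h (nearest i x))%:E = (\sum_(l < i.+1) h l * weight i l)%:E)%E.
Proof.
move=> h0.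
have mpre l : measurable (nearest i @^-1` [set l]).
  by rewrite -[X in measurable X]setTI; exact: (proj1 (measurable_nearest i)).
have hE x : (h (nearest i x))%:E
    = (\sum_(l < i.+1) ((h l)%:E * (\1_(nearest i @^-1` [set val l]) x)%:E))%E.
  have li : (nearest i x < i.+1)%N by rewrite ltnS nearest_le.
  rewrite (bigD1 (Ordinal li))//= indicE mem_set// mule1 big1 ?adde0// => l ll.
  rewrite indicE memNset ?mule0//= => e; case/eqP: ll; exact: val_inj.
under eq_integral do rewrite hE.
rewrite ge0_integral_sum//; last 2 first.
- move=> l; apply/measurable_EFinP; apply: measurable_funM => //.
- by move=> l x _; rewrite -EFinM lee_fin mulr_ge0.
rewrite -sumEFin; apply: eq_bigr => l _.
rewrite ge0_integralZl_EFin//; last exact/measurable_EFinP.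
rewrite integral_indic// setIT EFinM /weight fineK//.
exact: fin_num_measure.
Qed.

Lemma integral_step2 i (h : nat -> nat -> R) : (forall k l, 0 <= h k l) ->
  (\int[mu]_x \int[mu]_y (h (nearest i x) (nearest i y))%:E
   = (\sum_(k < i.+1) \sum_(l < i.+1) weight i k * weight i l * h k l)%:E)%E.
Proof.
move=> h0; under eq_integral do rewrite (integral_step i (h0 _)).
rewrite (@integral_step i (fun k => \sum_(l < i.+1) h k l * weight i l)).
  congr (_%:E); apply: eq_bigr => k _; rewrite mulr_suml.
  by apply: eq_bigr => l _; ring.
by move=> k; apply: sumr_ge0 => l _; rewrite mulr_ge0// weight_ge0.
Qed.
End NearestPoint.

(** * Limits of powers and subadditivity of concave powers *)

Section RealTools.
Context {R : realType}.

(** At a positive limit, continuity follows from differentiability; at 0 it follows from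
    [u ^ q <= u] for [u <= 1]. *)
Lemma cvgn_powR (q : R) (u : nat -> R) (a : R) : 1 <= q ->
  (forall n, 0 <= u n) -> u n @[n --> \oo] --> a ->
  u n `^ q @[n --> \oo] --> a `^ q.
Proof.
move=> q1 u0 ua.
have q0 : 0 < q by exact: lt_le_trans q1.
have a0 : 0 <= a.
  rewrite -(cvg_lim _ ua)//; apply: limr_ge; first by apply/cvg_ex; exists a.
  exact: nearW.
have [aE|aN0] := eqVneq a 0; last first.
  have apos : 0 < a by rewrite lt_def aN0.
  apply: (@continuous_cvg _ _ _ _ _ _ (fun x => x `^ q)) => //.
  apply/differentiable_continuous/derivable1_diffP; apply: derivable_powR.
  by rewrite in_itv/= apos.
rewrite aE powR0 ?gt_eqF//; apply/cvgrPdist_lt => e e0.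
rewrite aE in ua; move/cvgrPdist_lt: ua => /(_ (Num.min e 1)).
rewrite lt_min e0 ltr01 => /(_ isT); apply: filterS => n.
rewrite !sub0r !normrN lt_min => /andP[une un1].
rewrite ger0_norm ?powR_ge0//; apply: le_lt_trans une.
rewrite ger0_norm// in un1 *.
have [->|un0] := eqVneq (u n) 0; first by rewrite powR0// gt_eqF.
by apply: ge1r_powR => //; rewrite lt_def un0 u0 ltW.
Qed.

(** The fractions [u / (u + v)] and [v / (u + v)] have sum 1 and lie in [0, 1], where a number is at
    most its power [t]. *)
Lemma powR_subadditive (t u v : R) : 0 < t -> t <= 1 -> 0 <= u -> 0 <= v ->
  (u + v) `^ t <= u `^ t + v `^ t.
Proof.
move=> t0 t1 u0 v0.
have [->|uN] := eqVneq u 0; first by rewrite add0r powR0 ?gt_eqF// add0r.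
have uv0 : 0 < u + v by rewrite ltr_pwDl// lt_def uN.
have part w : 0 <= w -> w <= u + v -> w / (u + v) <= w `^ t / (u + v) `^ t.
  move=> w0 wle; have [->|wN] := eqVneq w 0.
    by rewrite mul0r powR0 ?gt_eqF// mul0r.
  have wpos : 0 < w by rewrite lt_def wN.
  rewrite -powR_div// -[leLHS]powRr1 ?divr_ge0 ?(ltW uv0)//.
  by apply: ger_powR => //; rewrite divr_gt0//= ler_pdivrMr// mul1r.
rewrite -[leLHS]mul1r -ler_pdivlMr ?powR_gt0// mulrDl.
apply: le_trans (lerD (part u u0 _) (part v v0 _)); [|lra|lra].
by rewrite -mulrDl divff// gt_eqF.
Qed.
End RealTools.

(** * Finite families of coordinates as sequences in l_q(Y) *)

Section LqSequences.
Context {R : realType} {Y : normedModType R}.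
Variable q : R.
Hypothesis q1 : 1 <= q.

Let qn0 : q != 0. Proof. by rewrite gt_eqF// (lt_le_trans ltr01). Qed.

Lemma lq_series_finite (u : nat -> Y) (m : nat) :
  (forall l, (m <= l)%N -> u l = 0) ->
  (\sum_(i <oo) (`|u i| `^ q)%:E = (\sum_(i < m) `|u i| `^ q)%:E)%E.
Proof.
move=> u0; apply: lim_near_cst => //.
exists m => // n /= mn.
rewrite (@big_cat_nat _ _ _ m)//= [X in (_ + X)%E]big_nat_cond.
rewrite [X in (_ + X)%E]big1 => [|i]; last first.
  by rewrite andbT => /andP[mi _]; rewrite u0// normr0 powR0.
by rewrite adde0 big_mkord sumEFin.
Qed.

(* entries past the end of [G] are the default value 0 *)
Definition seq_map (T : Type) (G : seq (T -> Y)) (x : T) : nat -> Y :=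
  fun l => nth (fun=> 0) G l x.

Lemma seq_map_sum (T : Type) (G : seq (T -> Y)) (h : (T -> Y) -> R) :
  \sum_(l < size G) h (nth (fun=> 0) G l) = \sum_(g <- G) h g.
Proof. by rewrite (big_nth (fun=> 0)) big_mkord. Qed.

Lemma seq_map_in_lq (T : Type) (G : seq (T -> Y)) x : in_lq q (seq_map G x).
Proof.
rewrite /in_lq (@lq_series_finite _ (size G)) ?ltry// => l Gl.
by rewrite /seq_map nth_default.
Qed.

Lemma seq_map_norm (T : Type) (G : seq (T -> Y)) x :
  lq_norm q (seq_map G x) = (\sum_(g <- G) `|g x| `^ q) `^ q^-1.
Proof.
rewrite /lq_norm (@lq_series_finite _ (size G))/= => [|l Gl].
  by rewrite (seq_map_sum G (fun g => `|g x| `^ q)).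
by rewrite /seq_map nth_default.
Qed.

Lemma seq_map_dist (T : Type) (G : seq (T -> Y)) x y :
  lq_norm q (seq_map G x - seq_map G y) = (sumdist q G x y) `^ q^-1.
Proof.
rewrite /lq_norm (@lq_series_finite _ (size G))/= => [|l Gl].
  by rewrite (seq_map_sum G (fun g => `|g x - g y| `^ q)).
change (seq_map G x l - seq_map G y l = 0).
by rewrite /seq_map nth_default// subrr.
Qed.

Lemma sumdist_root_tri (T : Type) (G : seq (T -> Y)) x y z :
  (sumdist q G x z) `^ q^-1
  <= (sumdist q G x y) `^ q^-1 + (sumdist q G y z) `^ q^-1.
Proof.
apply: le_trans (minkowski_sum _ q1 (fun g => normr_ge0 _) (fun g => normr_ge0 _)).
have q0 : 0 <= q by exact: le_trans q1.
apply: ler_powR2; rewrite ?invr_ge0 ?sumdist_ge0//.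
apply: ler_sum => g _; apply: ler_powR2 => //.
by rewrite -[g x - g z](subrKA (g y)) ler_normD.
Qed.
End LqSequences.

(** * Ultralimits and diagonal extraction *)

Section Ultralimits.
Context {R : realType}.

Lemma free_ultrafilter : exists U : set (set nat),
  [/\ ultrafilter U, UltraFilter U & \oo `<=` U].
Proof.
have [U [UU sub]] := @ultraFilterLemma nat \oo _.
exists U; split=> //; split; first exact: filterT.
split; first exact: filter_not_empty.
split; first by move=> A B; exact: filterI.
split; first by move=> A B; exact: filterS.
by move=> A; exact: in_ultra_setVsetC.
Qed.

(** [ulim] chooses some limit along [U]; it is the ordinary one because two distinct limits would
    give disjoint members of [U]. *)
Lemma ulim_cvg (U : set (set nat)) (u : nat -> R) (l : R) :
  ultrafilter U -> \oo `<=` U -> u n @[n --> \oo] --> l -> ulim U u = l.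
Proof.
move=> [_ [U0 [UI [US _]]]] sub ul.
have hl e : 0 < e -> U [set i | `|u i - l| < e].
  move=> e0; apply: sub; move/cvgrPdist_lt : ul => /(_ _ e0).
  by apply: filterS => n; rewrite distrC.
rewrite /ulim; case: xgetP => [l' _ hl'|/(_ l)]; last by move/(_ hl).
apply: contrapT => /eqP ne.
have e0 : 0 < `|l' - l| / 2 by rewrite divr_gt0// normr_gt0 subr_eq0.
apply: U0; apply: US (UI _ _ (hl _ e0) (hl' _ e0)) => i [/= h1 h2].
have := ler_distD (u i) l' l; rewrite [`|l' - u i|]distrC; lra.
Qed.

(** The limit is the supremum of the [t] that are below [a i] for [U]-almost all [i]. *)
Lemma bounded_ultralimit (U : set (set nat)) (a : nat -> R) (M : R) :
  ultrafilter U -> (forall i, 0 <= a i) -> (forall i, a i <= M) ->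
  exists l, forall e, 0 < e -> U [set i | `|a i - l| < e].
Proof.
move=> [UT [U0 [UI [US UC]]]] a0 aM.
pose S := [set t : R | U [set i | t <= a i]].
have hS : has_sup S.
  split; first by exists 0; apply: US UT => i _ /=.
  exists M => t St; rewrite leNgt; apply/negP => Mt; apply: U0.
  by apply: US St => i /= ti; have := aM i; rewrite leNgt (lt_le_trans Mt ti).
exists (sup S) => e e0.
have [t St tS] := sup_adherent e0 hS.
have notS : ~ U [set i | sup S + e / 2 <= a i].
  move=> h; have : sup S + e / 2 <= sup S by apply: ub_le_sup => //; case: hS.
  lra.
have [//|UC'] := UC [set i | sup S + e / 2 <= a i].
apply: US (UI _ _ St UC') => i [/= h1 /negP]; rewrite -ltNge => h2.
by rewrite ltr_distl; apply/andP; split; lra.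
Qed.

(* diagonal extraction: an ultralimit serves as the common limit of all the
   sequences [r _ a b], so that no nested subsequences are needed *)
Lemma diagonal_subsequence (r : nat -> nat -> nat -> R) (M : nat -> nat -> R) :
  (forall i a b, 0 <= r i a b) -> (forall i a b, r i a b <= M a b) ->
  exists (l : nat -> nat -> R) (phi : nat -> nat),
    (forall m, (m <= phi m)%N) /\
    forall m a b, (a <= m)%N -> (b <= m)%N ->
      `|r (phi m) a b - l a b| < m.+1%:R^-1.
Proof.
move=> r0 rM; have [U [UU UF sub]] := free_ultrafilter.
have hl (ab : nat * nat) : exists l, forall e, 0 < e ->
    U [set i | `|r i ab.1 ab.2 - l| < e].
  exact: (@bounded_ultralimit U (fun i => r i ab.1 ab.2) (M ab.1 ab.2)).
have /choice[l hlP] := hl.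
have hphi m : exists i, (m <= i)%N /\ forall ab : 'I_m.+1 * 'I_m.+1,
    `|r i ab.1 ab.2 - l (val ab.1, val ab.2)| < m.+1%:R^-1.
  have m0 : 0 < m.+1%:R^-1 :> R by rewrite invr_gt0 ltr0n.
  have h1 : U [set i | (m <= i)%N] by apply: sub; exists m.
  have h2 : U [set i | forall ab : 'I_m.+1 * 'I_m.+1,
      `|r i ab.1 ab.2 - l (val ab.1, val ab.2)| < m.+1%:R^-1].
    by apply: filter_forall => -[a b]; exact: (hlP (val a, val b)).
  have h3 : U ([set i | (m <= i)%N] `&` [set i | forall ab : 'I_m.+1 * 'I_m.+1,
      `|r i ab.1 ab.2 - l (val ab.1, val ab.2)| < m.+1%:R^-1]).
    exact: filterI.
  by have /filter_ex[i [h4 h5]] := h3; exists i.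
have /choice[phi hphiP] := hphi.
exists (fun a b => l (a, b)), phi; split=> [m|m a b am bm].
  by have [] := hphiP m.
have [_ /(_ (Ordinal (am : (a < m.+1)%N), Ordinal (bm : (b < m.+1)%N)))] := hphiP m.
by [].
Qed.
End Ultralimits.

(** * Borel measurability of the distance to a point *)

Section BorelMetric.
Context {R : realType} {T : pointedType}.
Variable d : T -> T -> R.
Hypothesis dM : is_metric d.

Lemma borel_measurable_dist (a : T) :
  measurable_fun setT (fun x : borel_space d => d x a).
Proof.
have [d0 [_ [dsym dtri]]] := dM.
apply: (measurability _ (RGenInftyO.measurableE R)) => //.
move=> _ [_ [r ->] <-]; rewrite setTI.
apply: sub_sigma_algebra => x /=.
rewrite in_itv/= => xr; exists (r - d x a); first by rewrite subr_gt0.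
move=> y /= xy; rewrite in_itv/=.
apply: (le_lt_trans (dtri y x a)); rewrite [d y x]dsym; lra.
Qed.
End BorelMetric.

(** * Approximation of double integrals through nearest points *)

Section Approximation.
Context {R : realType} {T : pointedType}.
Variables (d : T -> T -> R) (mu : probability (borel_space d) R).
Variables (dl : T -> T -> R) (q : R) (s : nat -> T) (M1 : R).
Hypothesis q1 : 1 <= q.
Hypothesis dl0 : forall x y, 0 <= dl x y.
Hypothesis dlxx : forall x, dl x x = 0.
Hypothesis dlsym : forall x y, dl x y = dl y x.
Hypothesis dltri : forall x y z, dl x z <= dl x y + dl y z.
Hypothesis mdl : forall a, measurable_fun setT (fun x : borel_space d => dl x a).
Hypothesis sdense : forall x e, 0 < e -> exists i, dl x (s i) < e.
Hypothesis moment1 :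
  (\int[mu]_x ((fun x => dl x (s 0%N) `^ q) x)%:E = M1%:E)%E.

Let q0 : 0 <= q. Proof. exact: le_trans q1. Qed.
Let mom (x : borel_space d) : R := dl x (s 0%N) `^ q.

Definition near_index i (x : T) : nat := @nearest _ (borel_space d) R dl s i x.
Definition near_point i (x : T) : T := s (near_index i x).

Let mmom : measurable_fun setT mom.
Proof.
by apply: (@measurableT_comp _ _ _ _ _ _ (fun t => t `^ q)) => //; exact: mdl.
Qed.

Let mom0 x : 0 <= mom x. Proof. exact: powR_ge0. Qed.

Lemma near_index_le i x : (near_index i x <= i)%N. Proof. exact: nearest_le. Qed.

Lemma near_point_le i x : dl x (near_point i x) <= dl x (s 0%N).
Proof. exact: (@nearest_min _ (borel_space d) R dl s i 0%N x (leq0n i)). Qed.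

Lemma near_point_self i a : (a <= i)%N -> dl (s a) (near_point i (s a)) = 0.
Proof.
move=> ai; apply/eqP; rewrite eq_le dl0 andbT -(dlxx (s a)).
exact: (@nearest_min _ (borel_space d) R dl s i a).
Qed.

Lemma near_point_small (phi : nat -> nat) x e : (forall m, (m <= phi m)%N) -> 0 < e ->
  exists m, forall i, (m <= i)%N -> dl x (near_point (phi i) x) < e.
Proof.
move=> hphi e0.
have [m hm] := @nearest_small _ (borel_space d) R dl s sdense x e e0.
by exists m => i mi; apply: hm; exact: leq_trans (hphi i).
Qed.

Lemma near_point_bound i x y :
  dl (near_point i x) (near_point i y) <= 2 * (dl x (s 0%N) + dl y (s 0%N)).
Proof.
have := dltri (near_point i x) x (near_point i y); have := dltri x y (near_point i y).
have := dltri x (s 0%N) y; have := near_point_le i x; have := near_point_le i y.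
by rewrite [dl (near_point i x) x]dlsym [dl (s 0%N) y]dlsym; lra.
Qed.

Lemma near_point_powbound i x y :
  dl (near_point i x) (near_point i y) `^ q <= 4 `^ q * (mom x + mom y).
Proof.
apply: (@le_trans _ _ ((2 * (dl x (s 0%N) + dl y (s 0%N))) `^ q)).
  by apply: ler_powR2 => //; exact: near_point_bound.
rewrite powRM ?addr_ge0//.
have -> : 4 `^ q = 2 `^ q * 2 `^ q :> R.
  by rewrite -powRM//; congr (_ `^ _); lra.
by rewrite -mulrA ler_wpM2l ?powR_ge0//; exact: powR_add_le.
Qed.

Lemma measurable_step_pair i (h : nat -> nat -> R) : (forall k l, 0 <= h k l) ->
  (forall x, measurable_fun setT
     (fun y : borel_space d => h (near_index i x) (near_index i y))) /\
  measurable_fun setT (fun x : borel_space d =>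
     \int[mu]_y (h (near_index i x) (near_index i y))%:E)%E.
Proof.
move=> h0; split=> [x|].
  exact: (@measurable_step _ (borel_space d) R dl s mdl i (h (near_index i x))).
apply: (eq_measurable_fun (fun x : borel_space d =>
    (\sum_(l < i.+1) h (near_index i x) l
       * @weight _ (borel_space d) R mu dl s i l)%:E)).
  move=> x _; rewrite -(@integral_step _ (borel_space d) R mu dl s mdl i
    (h (near_index i x)))//.
apply/measurable_EFinP.
exact: (@measurable_step _ (borel_space d) R dl s mdl i
  (fun k => \sum_(l < i.+1) h k l * @weight _ (borel_space d) R mu dl s i l)).
Qed.

Lemma step_iterated_cvg (h_ : nat -> nat -> nat -> R) (h : T -> T -> R)
    (phi : nat -> nat) (c : R) :
  0 <= c -> (forall m k l, 0 <= h_ m k l) ->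
  (forall m x y, h_ m (near_index (phi m) x) (near_index (phi m) y)
     <= c * dl (near_point (phi m) x) (near_point (phi m) y) `^ q) ->
  (forall x y, h_ m (near_index (phi m) x) (near_index (phi m) y)
     @[m --> \oo] --> h x y) ->
  [/\ forall x, measurable_fun setT (fun y : borel_space d => h x y),
      measurable_fun setT
        (fun x : borel_space d => \int[mu]_y (h x y)%:E)%E &
      (\int[mu]_x \int[mu]_y
         (h_ m (near_index (phi m) x) (near_index (phi m) y))%:E)%E @[m --> \oo]
        --> (\int[mu]_x \int[mu]_y (h x y)%:E)%E].
Proof.
move=> c0 h0 hb hcvg.
apply: (@iterated_dominated_cvg _ (borel_space d) R mu mom M1 mmom mom0 moment1
  (fun m x y => h_ m (near_index (phi m) x) (near_index (phi m) y)) h (c * 4 `^ q)) => //.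
- by rewrite mulr_ge0 ?powR_ge0.
- by move=> m; exact: (proj1 (measurable_step_pair (phi m) (h0 m))).
- by move=> m; exact: (proj2 (measurable_step_pair (phi m) (h0 m))).
- move=> m x y; apply: (le_trans (hb m x y)); rewrite -mulrA ler_wpM2l//.
  exact: near_point_powbound.
Qed.

(** [r] changes by at most [c * (dl x x' + dl y y')] when both points move, hence converges along
    nearest points. Applied to [dl] and to the distances of an embedding, the lemma also supplies
    the measurability that their iterated integrals require. *)
Lemma lipschitz_iterated_cvg (r : T -> T -> R) (c : R) (phi : nat -> nat) :
  0 <= c -> (forall x y, 0 <= r x y) -> (forall x y, r x y = r y x) ->
  (forall x y z, r x z <= r x y + r y z) ->
  (forall x y, r x y <= c * dl x y) -> (forall m, (m <= phi m)%N) ->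
  [/\ forall x, measurable_fun setT (fun y : borel_space d => r x y `^ q),
      measurable_fun setT
        (fun x : borel_space d => \int[mu]_y (r x y `^ q)%:E)%E &
      (\int[mu]_x \int[mu]_y
         (r (near_point (phi m) x) (near_point (phi m) y) `^ q)%:E)%E @[m --> \oo]
        --> (\int[mu]_x \int[mu]_y (r x y `^ q)%:E)%E].
Proof.
move=> c0 r0 rsym rtri rle hphi.
apply: (@step_iterated_cvg (fun _ k l => r (s k) (s l) `^ q)
  (fun x y => r x y `^ q) phi (c `^ q)); first exact: powR_ge0.
- by move=> *; exact: powR_ge0.
- move=> m x y; rewrite -powRM//; apply: ler_powR2 => //; exact: rle.
move=> x y; apply: cvgn_powR => //.
apply/cvgrPdist_lt => e e0.
have c1 : 0 < 2 * c + 1 by lra.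
have [m1 h1] := near_point_small x hphi (divr_gt0 e0 c1).
have [m2 h2] := near_point_small y hphi (divr_gt0 e0 c1).
exists (maxn m1 m2) => // m /=; rewrite geq_max => /andP[mm1 mm2].
have hx := h1 m mm1; have hy := h2 m mm2.
rewrite -/(near_point (phi m) x) -/(near_point (phi m) y).
set x' := near_point (phi m) x in hx *; set y' := near_point (phi m) y in hy *.
have t1 := rtri x x' y; have t2 := rtri x' y' y.
have t3 := rtri x' x y'; have t4 := rtri x y y'.
rewrite [r x' x]rsym in t3; rewrite [r y' y]rsym in t2.
have rx := rle x x'; have ry := rle y y'.
have b1 : r x x' + r y y' < e.
  have : c * dl x x' + c * dl y y' <= 2 * c * (e / (2 * c + 1)).
    have e1 : c * dl x x' <= c * (e / (2 * c + 1)) by rewrite ler_wpM2l// ltW.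
    have e2 : c * dl y y' <= c * (e / (2 * c + 1)) by rewrite ler_wpM2l// ltW.
    lra.
  have : 2 * c * (e / (2 * c + 1)) < e by rewrite mulrA ltr_pdivrMr//; lra.
  lra.
by rewrite ltr_norml; apply/andP; split; lra.
Qed.

(** [s 0] is always a candidate for the nearest point, so the distance to it dominates all
    errors. *)
Lemma near_point_error_cvg :
  (\int[mu]_x (dl x (near_point i x) `^ q)%:E)%E @[i --> \oo] --> 0%E.
Proof.
suff [_] : measurable_fun setT (fun _ : borel_space d => 0%E : \bar R) /\
    (\int[mu]_x (dl x (near_point i x) `^ q)%:E)%E @[i --> \oo]
      --> (\int[mu]_(x in setT) (0%E : \bar R))%E by rewrite integral0.
apply: (@dominated_ge0_cvg _ (borel_space d) R mu
  (fun i x => (dl x (near_point i x) `^ q)%:E) (fun=> 0%E) (fun x => (mom x)%:E)).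
- move=> i; apply/measurable_EFinP.
  apply: (@measurableT_comp _ _ _ _ _ _ (fun t => t `^ q)) => //.
  exact: (proj2 (@measurable_nearest _ (borel_space d) R dl s mdl i)).
- exact/measurable_EFinP.
- by move=> i x; rewrite lee_fin powR_ge0.
- by move=> i x; rewrite lee_fin; apply: ler_powR2 => //; exact: near_point_le.
- by rewrite moment1 ltry.
- move=> x; apply: cvg_EFin; first exact: nearW.
  rewrite -[X in _ --> X](@powR0 R q) ?gt_eqF ?(lt_le_trans ltr01)//.
  apply: cvgn_powR => //; apply/cvgrPdist_lt => e e0.
  have [m hm] := @near_point_small id x e (fun m => leqnn m) e0.
  by exists m => // i mi; rewrite sub0r normrN ger0_norm//; exact: hm.
Qed.

Lemma iterated_integral_le (u n : T -> T -> R) (e : T -> R) (c1 c2 E : R) :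
  0 <= c1 -> 0 <= c2 ->
  (forall x y, 0 <= u x y) -> (forall x y, 0 <= n x y) -> (forall x, 0 <= e x) ->
  (forall x, measurable_fun setT (fun y : borel_space d => u x y)) ->
  measurable_fun setT (fun x : borel_space d => \int[mu]_y (u x y)%:E)%E ->
  (forall x, measurable_fun setT (fun y : borel_space d => n x y)) ->
  measurable_fun setT (fun x : borel_space d => \int[mu]_y (n x y)%:E)%E ->
  measurable_fun setT (e : borel_space d -> R) ->
  (\int[mu]_x (e x)%:E = E%:E)%E ->
  (forall x y, u x y <= c1 * n x y + c2 * (e x + e y)) ->
  (\int[mu]_x \int[mu]_y (u x y)%:E
   <= c1%:E * \int[mu]_x \int[mu]_y (n x y)%:E + (c2 * (E + E))%:E)%E.
Proof.
move=> c10 c20 u0 n0 e0 mu_ mou mn mon me eE hle.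
have maff a : measurable_fun setT (fun y : borel_space d => (c2 * (a + e y))%:E).
  apply/measurable_EFinP; apply: measurable_funM => //.
  exact: measurable_funD.
have E0 : 0 <= E.
  by rewrite -lee_fin -eE; apply: integral_ge0 => y _; rewrite lee_fin.
have inner x : (\int[mu]_y (u x y)%:E
    <= c1%:E * \int[mu]_y (n x y)%:E + (c2 * (E + e x))%:E)%E.
  apply: (@le_trans _ _ (\int[mu]_y (c1%:E * (n x y)%:E + (c2 * (e x + e y))%:E))%E).
    apply: ge0_le_integral => //.
    - by move=> y _; rewrite lee_fin.
    - exact/measurable_EFinP.
    - apply: emeasurable_funD => //; apply: emeasurable_funM => //.
      exact/measurable_EFinP.
    - by move=> y _; rewrite -EFinM -EFinD lee_fin.
  rewrite ge0_integralD//.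
  - rewrite ge0_integralZl_EFin//; last 2 first.
    + by move=> y _; rewrite lee_fin.
    + exact/measurable_EFinP.
    by rewrite (integral_affine me e0 eE)// [E + e x]addrC.
  - by move=> y _; rewrite -EFinM lee_fin mulr_ge0.
  - by apply: emeasurable_funM => //; exact/measurable_EFinP.
  - by move=> y _; rewrite lee_fin mulr_ge0// addr_ge0.
have in0 x : (0 <= \int[mu]_y (n x y)%:E)%E.
  by apply: integral_ge0 => y _; rewrite lee_fin.
apply: (@le_trans _ _ (\int[mu]_x (c1%:E * \int[mu]_y (n x y)%:E
    + (c2 * (E + e x))%:E))%E).
  apply: ge0_le_integral => //.
  - by move=> x _; apply: integral_ge0 => y _; rewrite lee_fin.
  - by apply: emeasurable_funD => //; exact: emeasurable_funM.
rewrite ge0_integralD//.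
- by rewrite ge0_integralZl_EFin// (integral_affine me e0 eE).
- by move=> x _; rewrite mule_ge0// lee_fin.
- exact: emeasurable_funM.
- by move=> x _; rewrite lee_fin mulr_ge0// addr_ge0.
Qed.
End Approximation.

(** * Embeddings with respect to a given measure *)

Section Embeddings.
Context {R : realType} {T : pointedType} {Y : completeNormedModType R}.
Variables (d : T -> T -> R) (mu : probability (borel_space d) R).
Variables (dl : T -> T -> R) (q C : R) (s : nat -> T).
Hypothesis q1 : 1 <= q.
Hypothesis C1 : 1 <= C.
Hypothesis dl0 : forall x y, 0 <= dl x y.
Hypothesis dlxx : forall x, dl x x = 0.
Hypothesis dlpos : forall x y, x != y -> 0 < dl x y.
Hypothesis dlsym : forall x y, dl x y = dl y x.
Hypothesis dltri : forall x y z, dl x z <= dl x y + dl y z.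
Hypothesis mdl : forall a, measurable_fun setT (fun x : borel_space d => dl x a).
Hypothesis sdense : forall x e, 0 < e -> exists i, dl x (s i) < e.
Hypothesis gammaC : forall (n : nat) (A : 'M[R]_n), sym_stochastic A ->
  (gamma_const A (fun x y => (dl x y `^ q)%R)
   <= C%:E * gamma_const A (fun x y : Y => (`|x - y| `^ q)%R))%E.

Let q0 : 0 <= q. Proof. exact: le_trans q1. Qed.
Let qn0 : q != 0. Proof. by rewrite gt_eqF// (lt_le_trans ltr01). Qed.
Let qi0 : 0 <= q^-1. Proof. by rewrite invr_ge0. Qed.
Let C0 : 0 <= C. Proof. exact: le_trans C1. Qed.
Let K x y := dl x y `^ q.
Let K0 x y : 0 <= K x y. Proof. exact: powR_ge0. Qed.
Let Kxx x : K x x = 0. Proof. by rewrite /K dlxx powR0. Qed.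
Let Ksym x y : K x y = K y x. Proof. by rewrite /K dlsym. Qed.
Let Kpos x y : x != y -> 0 < K x y.
Proof. by move=> /dlpos; exact: powR_gt0. Qed.

(** The sequence may repeat points, whereas [finite_embedding] wants distinct ones: the masses of
    equal points are added, and the maps are extended by 0 to the whole space. *)
Lemma prefix_embedding (w : nat -> R) i : (forall k, 0 <= w k) ->
  exists G : seq (T -> Y),
    (forall a b, (a <= i)%N -> (b <= i)%N ->
       sumdist q G (s a) (s b) <= 2 `^ q * C * K (s a) (s b)) /\
    \sum_(k < i.+1) \sum_(l < i.+1) w k * w l * K (s k) (s l)
    <= \sum_(k < i.+1) \sum_(l < i.+1) w k * w l * sumdist q G (s k) (s l).
Proof.
move=> w0; pose pts := [seq s j | j <- iota 0 i.+1].
have inp k : (k <= i)%N -> s k \in pts by move=> ki; rewrite map_f// mem_iota.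
have inp' (k : 'I_i.+1) : s k \in pts by apply: inp; rewrite -ltnS.
pose I : finType := seq_sub pts.
pose x (t : I) : T := val t.
pose tau (k : 'I_i.+1) : I := SeqSub (inp' k).
pose m (t : I) := \sum_(k | tau k == t) w k.
have sumtau (F : I -> R) : \sum_(k < i.+1) w k * F (tau k) = \sum_t m t * F t.
  rewrite (partition_big tau xpredT)//=; apply: eq_bigr => t _.
  by rewrite /m mulr_suml; apply: eq_bigr => k /eqP ->.
have sumtau2 (F : I -> I -> R) :
    \sum_(k < i.+1) \sum_(l < i.+1) w k * w l * F (tau k) (tau l)
    = \sum_t \sum_u m t * m u * F t u.
  under eq_bigr do under eq_bigr do rewrite -mulrA.
  under eq_bigr do rewrite -mulr_sumr sumtau.
  rewrite (sumtau (fun t => \sum_u m u * F t u)); apply: eq_bigr => t _.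
  by rewrite mulr_sumr; apply: eq_bigr => u _; rewrite mulrA.
have m0 t : 0 <= m t by exact: sumr_ge0.
have xpos t u : t != u -> 0 < K (x t) (x u).
  by move=> tu; apply: Kpos; apply: contraNneq tu => /val_inj ->.
have [G Gle GS] := finite_embedding q1 C1 K0 Kxx Ksym gammaC m0 xpos.
pose ext (g : I -> Y) (t : T) : Y := if insub t is Some u then g u else 0.
have extE g (u : I) : ext g (x u) = g u by rewrite /ext valK.
have extG (t u : I) : sumdist q (map ext G) (x t) (x u) = sumdist q G t u.
  by rewrite /sumdist big_map; apply: eq_bigr => g _; rewrite !extE.
exists (map ext G); split=> [a b ai bi|].
  pose ta : I := SeqSub (inp a ai); pose tb : I := SeqSub (inp b bi).
  by rewrite (extG ta tb); exact: Gle.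
rewrite (sumtau2 (fun t u => K (x t) (x u))).
by rewrite (sumtau2 (fun t u => sumdist q (map ext G) (x t) (x u)));
   under [leRHS]eq_bigr do under eq_bigr do rewrite extG.
Qed.

Section FiniteMoment.
Variable M1 : R.
Hypothesis moment1 : (\int[mu]_x (dl x (s 0%N) `^ q)%:E = M1%:E)%E.

Local Notation near_point := (@near_point R T d dl s).
Let step_int i (h : nat -> nat -> R) (h0 : forall k l, 0 <= h k l) :=
  @integral_step2 _ (borel_space d) R mu dl s mdl i h h0.
Let wt i := @weight _ (borel_space d) R mu dl s i.

Lemma near_point_embedding i : exists G : seq (T -> Y),
  (forall a b, (a <= i)%N -> (b <= i)%N ->
     sumdist q G (s a) (s b) <= 2 `^ q * C * K (s a) (s b)) /\
  (\int[mu]_x \int[mu]_y (K (near_point i x) (near_point i y))%:E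
   <= \int[mu]_x \int[mu]_y (sumdist q G (near_point i x) (near_point i y))%:E)%E.
Proof.
have w0 k : 0 <= wt i k by exact: weight_ge0.
have [G [G1 G2]] := prefix_embedding i w0.
exists G; split=> //.
rewrite (@step_int i (fun k l => K (s k) (s l)))//.
rewrite (@step_int i (fun k l => sumdist q G (s k) (s l))) ?lee_fin//.
by move=> *; exact: sumdist_ge0.
Qed.

(** Dominated convergence needs a limit along a sequence, which an ultralimit does not give; hence
    the subsequence [phi]. Along it the distances converge on pairs of the dense sequence by
    extraction, and on all pairs because [rr] is Lipschitz up to an error that vanishes. The
    ultralimit is then the ordinary limit, for every [U] containing the cofinite sets. *)
Lemma ultrapower_embedding (U : set (set nat)) :
  ultrafilter U -> \oo `<=` U ->
  exists f : nat -> T -> nat -> Y,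
    (forall i x, in_lq q (f i x)) /\
    (forall x, exists B : R, forall i, lq_norm q (f i x) <= B) /\
    (forall x y, ulim U (fun i => lq_norm q (f i x - f i y))
       <= 2 * C `^ q^-1 * dl x y) /\
    (\int[mu]_x \int[mu]_y
       ((ulim U (fun i => lq_norm q (f i x - f i y))) `^ q)%:E
     >= \int[mu]_x \int[mu]_y ((dl x y) `^ q)%:E)%E.
Proof.
move=> UU sub.
have /choice[G GP] := near_point_embedding.
set c := 2 * C `^ q^-1.
have c0 : 0 <= c by rewrite mulr_ge0 ?powR_ge0.
have cq : c `^ q = 2 `^ q * C by rewrite powRM ?powR_ge0// powR_rootK.
clearbody c.
pose rr i x y := (sumdist q (G i) (near_point i x) (near_point i y)) `^ q^-1.
have rr0 i x y : 0 <= rr i x y by exact: powR_ge0.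
have rrq i x y : rr i x y `^ q = sumdist q (G i) (near_point i x) (near_point i y).
  by rewrite powR_rootK ?sumdist_ge0.
have sd_le i x y : sumdist q (G i) (near_point i x) (near_point i y)
    <= 2 `^ q * C * K (near_point i x) (near_point i y).
  by apply: (proj1 (GP i)); exact: near_index_le.
have rr_le i x y : rr i x y <= c * dl (near_point i x) (near_point i y).
  have cd0 : 0 <= c * dl (near_point i x) (near_point i y) by exact: mulr_ge0.
  rewrite -(powRK_root qn0 cd0); apply: ler_powR2 => //.
    exact: sumdist_ge0.
  by rewrite powRM// cq; exact: sd_le.
have rr_tri i x y z : rr i x z <= rr i x y + rr i y z.
  exact: sumdist_root_tri.
have rr_sym i x y : rr i x y = rr i y x by rewrite /rr sumdist_sym.
have [l [phi [hphi hl]]] := @diagonal_subsequence R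
  (fun i a b => rr i (s a) (s b))
  (fun a b => c * (2 * (dl (s a) (s 0%N) + dl (s b) (s 0%N))))
  (fun i a b => rr0 i _ _)
  (fun i a b => le_trans (rr_le i _ _)
     (ler_wpM2l c0 (near_point_bound d s dlsym dltri i (s a) (s b)))).
have rr_small x a e : 0 < e -> c * dl x (s a) < e ->
    \forall m \near \oo, rr (phi m) x (s a) < e.
  move=> e0 xa.
  have e1 : 0 < (e - c * dl x (s a)) / (c + 1) by rewrite divr_gt0 ?subr_gt0//; lra.
  have [m0 hm0] := near_point_small d sdense x hphi e1.
  exists (maxn m0 a) => // m /=; rewrite geq_max => /andP[mm0 ma].
  have h1 := hm0 m mm0; have h2 := rr_le (phi m) x (s a).
  apply: (le_lt_trans h2).
  have h3 := dltri (near_point (phi m) x) x (near_point (phi m) (s a)).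
  have h4 := dltri x (s a) (near_point (phi m) (s a)).
  rewrite (@near_point_self _ _ d) ?(leq_trans ma)// addr0 in h4.
  rewrite [dl (near_point (phi m) x) x]dlsym in h3.
  apply: (@le_lt_trans _ _ (c * (dl x (near_point (phi m) x) + dl x (s a)))).
    by rewrite ler_wpM2l//; lra.
  rewrite mulrDr -ltrBrDr.
  apply: (@le_lt_trans _ _ (c * ((e - c * dl x (s a)) / (c + 1)))).
    by rewrite ler_wpM2l// ltW.
  by rewrite mulrA ltr_pdivrMr; [|lra]; nra.
have rr_cvg x y : cvg (rr (phi m) x y @[m --> \oo]).
  apply/cauchy_cvgP/cauchy_exP => e e0.
  have e3 : 0 < e / 3 by lra.
  have e4 : 0 < e / 3 / (c + 1) by rewrite divr_gt0//; lra.
  have close z : exists a, c * dl z (s a) < e / 3.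
    have [a ha] := sdense z e4; exists a.
    apply: (@le_lt_trans _ _ (c * (e / 3 / (c + 1)))).
      by rewrite ler_wpM2l// ltW.
    by rewrite mulrA ltr_pdivrMr; [|lra]; nra.
  have [a ha] := close x; have [b hb] := close y.
  exists (l a b).
  have hm : \forall m \near \oo, m.+1%:R^-1 < e / 3 :> R.
    exists (Num.truncn (e / 3)^-1) => // m /= mm.
    rewrite -[ltRHS]invrK ltf_pV2 ?posrE ?ltr0n ?invr_gt0//.
    by apply: (lt_le_trans (truncnS_gt _)); rewrite ler_nat ltnS.
  have hab : \forall m \near \oo, (a <= m)%N && (b <= m)%N.
    by exists (maxn a b) => // m /=; rewrite geq_max.
  have hmab : \forall m \near \oo,
      m.+1%:R^-1 < e / 3 /\ (a <= m)%N && (b <= m)%N by exact: filterI.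
  move: (rr_small x a _ e3 ha) (rr_small y b _ e3 hb) hmab.
  apply: filterS3 => m hx hy [{}hm /andP[am bm]].
  rewrite -ball_normE/=.
  have := hl m a b am bm; rewrite ltr_distl => /andP[l1 l2].
  have t1 := rr_tri (phi m) x (s a) y; have t2 := rr_tri (phi m) (s a) (s b) y.
  have t3 := rr_tri (phi m) (s a) x (s b); have t4 := rr_tri (phi m) x y (s b).
  rewrite [rr (phi m) (s a) x]rr_sym in t3.
  rewrite [rr (phi m) (s b) y]rr_sym in t2.
  rewrite ltr_distl; move: t1 t2 t3 t4 hx hy l1 l2 hm; clear - e0.
  move: (m.+1%:R^-1) (rr (phi m) x y) (rr (phi m) x (s a)) (rr (phi m) y (s b))
    (rr (phi m) (s a) (s b)) (rr (phi m) (s a) y) (rr (phi m) x (s b)) (l a b).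
  by move=> *; apply/andP; split; lra.
pose ell x y := lim (rr (phi m) x y @[m --> \oo]).
have ellP x y : rr (phi m) x y @[m --> \oo] --> ell x y by exact: rr_cvg.
(* Translating each coordinate to vanish at [s 0] keeps the distances and makes the family bounded
   at every point. *)
pose G0 i := [seq (fun t => g t - g (s 0%N)) | g <- G i].
have G0E i x y : sumdist q (G0 i) x y = sumdist q (G i) x y.
  rewrite /sumdist big_map; apply: eq_bigr => g _.
  by rewrite opprB addrA subrK.
pose f m x := seq_map (G0 (phi m)) (near_point (phi m) x).
have fdist m x y : lq_norm q (f m x - f m y) = rr (phi m) x y.
  by rewrite /rr -G0E; exact: seq_map_dist.
have ulimE x y : ulim U (fun i => lq_norm q (f i x - f i y)) = ell x y.
  apply: ulim_cvg => //; rewrite (_ : (fun i => _) = (fun i => rr (phi i) x y))//.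
  by apply/funext => m; exact: fdist.
exists f; split; first by move=> i x; exact: seq_map_in_lq.
split.
  move=> x; exists (c * (2 * (dl x (s 0%N) + dl (s 0%N) (s 0%N)))) => m.
  apply: le_trans (le_trans (rr_le (phi m) x (s 0%N)) _); last first.
    by rewrite ler_wpM2l//; exact: near_point_bound.
  have -> : lq_norm q (f m x) =
      (\sum_(g <- G0 (phi m)) `|g (near_point (phi m) x)| `^ q) `^ q^-1.
    exact: seq_map_norm.
  have p0 : near_point (phi m) (s 0%N) = s 0%N.
    apply/eqP; apply: contraT => /dlpos.
    by rewrite dlsym (@near_point_self _ _ d)// ltxx.
  by rewrite /rr p0 /sumdist big_map.
have dlrr x y e : 0 < e -> \forall m \near \oo,
    rr (phi m) x y <= c * dl x y + e.
  move=> e0; have e1 : 0 < e / (2 * c + 1) by rewrite divr_gt0//; lra.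
  have [m1 h1] := near_point_small d sdense x hphi e1.
  have [m2 h2] := near_point_small d sdense y hphi e1.
  exists (maxn m1 m2) => // m /=; rewrite geq_max => /andP[mm1 mm2].
  have hx := h1 m mm1; have hy := h2 m mm2.
  apply: (le_trans (rr_le _ _ _)).
  have h3 := dltri (near_point (phi m) x) x (near_point (phi m) y).
  have h4 := dltri x y (near_point (phi m) y).
  rewrite [dl (near_point (phi m) x) x]dlsym in h3.
  apply: (@le_trans _ _ (c * (dl x y + 2 * (e / (2 * c + 1))))).
    by rewrite ler_wpM2l//; lra.
  have c20 : 0 < 2 * c + 1 by lra.
  rewrite mulrDr lerD2l !mulrA ler_pdivrMr//.
  by nra.
split.
  move=> x y; rewrite ulimE; apply/ler_addgt0Pr => e e0.
  by apply: limr_le; [exact: rr_cvg | exact: dlrr].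
under [leRHS]eq_integral do under eq_integral do rewrite ulimE.
have [_ _ c1] := @lipschitz_iterated_cvg R T d mu dl q s M1 q1 dl0 dlsym dltri
  mdl sdense moment1 dl 1 phi ler01 dl0 dlsym dltri
  (fun x y => ltac:(by rewrite mul1r)) hphi.
have [_ _ c2] := @step_iterated_cvg R T d mu dl q s M1 q1 dl0 dlsym dltri
  mdl moment1 (fun m k l => sumdist q (G (phi m)) (s k) (s l))
  (fun x y => ell x y `^ q) phi (2 `^ q * C)
  (mulr_ge0 (powR_ge0 _ _) C0) (fun m k l => sumdist_ge0 _ _ _ _)
  (fun m x y => sd_le _ _ _)
  (fun x y => ltac:(by rewrite (_ : (fun m => _) = (fun m => rr (phi m) x y `^ q));
     [apply: cvgn_powR | apply/funext => m; rewrite rrq])).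
apply: (lee_cvg_to c1 c2); apply: nearW => m.
exact: (proj2 (GP (phi m))).
Qed.

Variables (Kc M : R).
Hypothesis Kc1 : 1 <= Kc.
Hypothesis M11 : 1 <= M.
Hypothesis Kuc : forall x y : Y, `|y| `^ q <=
  Kc `^ q * ((`|x + y| `^ q + `|x - y| `^ q) / 2 - `|x| `^ q).
Hypothesis Kmarkov : forall (n : nat) (pi : 'I_n -> R) (A : 'M[R]_n)
    (x : 'I_n -> T) (s : nat),
  (forall i, 0 <= pi i) -> \sum_i pi i = 1 -> stochastic A ->
  (forall i j, pi i * A i j = pi j * A j i) ->
  \sum_i \sum_j pi i * (A ^+ s) i j * K (x i) (x j)
  <= M * s%:R * \sum_i \sum_j pi i * A i j * K (x i) (x j).

Let b : R := 2 `^ q.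
(** [A] equals [b ^+ 5]. Going to nearest points and coming back cost [b ^+ 2] each; the remaining
    factor [b] is at least 2, one unit for the result and one for the errors. *)
Let A : R := 32 `^ q.

(** The constant of [full_extension] for the enlarged map, whose Lipschitz constant is
    [A * (b * C)], with the Markov constant [M] of the kernel [K]. *)
Definition ext_const : R := 8 * Kc `^ q * b ^+ 10 * (A * (b * C)) * M.

Let b1 : 1 <= b.
Proof. by have := @ler_powR R 2 (ler1n _ 2) 0 q q0; rewrite powRr0. Qed.

Let Ktri x y z : K x z <= b * (K x y + K y z).
Proof.
apply: le_trans (powR_add_le q0 (dl0 _ _) (dl0 _ _)).
by apply: ler_powR2 => //; exact: dltri.
Qed.

Let KcQ : 1 <= Kc `^ q.
Proof. by have := @ler_powR R Kc Kc1 0 q q0; rewrite powRr0. Qed.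

Lemma Kdense x e : 0 < e -> exists i, K x (s i) < e.
Proof.
move=> e0; have e1 : 0 < e `^ q^-1 by rewrite powR_gt0.
have [i hi] := sdense x e1; exists i.
rewrite -[ltRHS](@powR_rootK _ q) ?(ltW e0)//.
by rewrite gt0_ltr_powR ?nnegrE ?powR_ge0// (lt_le_trans ltr01).
Qed.

(** All coordinates, multiplied by [A ^ (1/q)], are extended together as one map into finitely many
    coordinates. The extension at [x] is close to the given map at the nearest point of [x], so a
    four-point inequality compares the two families. *)
Lemma extended_embedding i (G : seq (T -> Y)) :
  (forall j k, (j <= i)%N -> (k <= i)%N ->
     sumdist q G (s j) (s k) <= b * C * K (s j) (s k)) ->
  exists F : seq (T -> Y),
    (forall x y, sumdist q F x y <= ext_const * K x y) /\
    (forall x y, A * sumdist q G (near_point i x) (near_point i y) <=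
       b ^+ 2 * sumdist q F x y
       + b ^+ 2 * ext_const * (K x (near_point i x) + K y (near_point i y))).
Proof.
move=> Gle.
have A0 : 0 < A by rewrite powR_gt0.
pose m := size G.
pose G' := [seq (fun k => A `^ q^-1 *: g k) | g <- G].
have G'E x y : sumdist q G' x y = A * sumdist q G x y.
  by rewrite sumdist_scale// ltW.
have szG' : size G' = m by rewrite size_map.
pose f (t : T) : {ffun 'I_m -> Y} := [ffun l : 'I_m => nth (fun=> 0) G' l t].
have fE x y : lqpow q (f x - f y) = A * sumdist q G x y.
  rewrite -G'E /sumdist.
  have := seq_map_sum G' (fun g => `|g x - g y| `^ q); rewrite /= szG' => <-.
  by apply: eq_bigr => l _; rewrite !ffunE.
pose pts := [seq s j | j <- iota 0 i.+1].
have inp k : (k <= i)%N -> s k \in pts by move=> ki; rewrite map_f// mem_iota.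
have L0 : 0 < A * (b * C).
  by rewrite !mulr_gt0 ?powR_gt0// (lt_le_trans ltr01).
have fLip : {in pts &, forall r r', lqpow q (f r - f r') <= A * (b * C) * K r r'}.
  move=> _ _ /mapP[j + ->] /mapP[k + ->]; rewrite !mem_iota /= !add0n !ltnS.
  by move=> ji ki; rewrite fE -mulrA ler_pM2l//; exact: Gle.
have [F [F1 F2]] := @full_extension R T {ffun 'I_m -> Y} (lqpow q) b (Kc `^ q) K M
  (lqpow_ge0 q) (lqpow0 q1) (lqpowN q) (lqpow_jensen q1) b1 KcQ M11
  (lqpow_add q1) (lqpow_uc Kuc) K0 Kxx Kpos Ksym Ktri Kmarkov
  (lqpow_complete q1) s Kdense pts f (A * (b * C)) (s 0%N) (inp 0%N (leq0n i)) L0 fLip.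
pose GF := [seq (fun x => F x l) | l <- index_enum 'I_m].
have GFE x y : sumdist q GF x y = lqpow q (F x - F y).
  rewrite /sumdist /GF big_map; apply: eq_bigr => l _.
  by rewrite !ffunE.
exists GF; split=> [x y|x y]; first by rewrite GFE; exact: F1.
have innear z : near_point i z \in pts by apply: inp; exact: near_index_le.
rewrite -fE GFE.
have N3 (z1 z2 z3 z4 : {ffun 'I_m -> Y}) : lqpow q (z1 - z4)
    <= b ^+ 2 * (lqpow q (z1 - z2) + lqpow q (z2 - z3) + lqpow q (z3 - z4)).
  have h1 : lqpow q (z1 - z4) <= b * (lqpow q (z1 - z2) + lqpow q (z2 - z4)).
    by apply: le_trans (lqpow_add q1 _ _); rewrite addrA subrK.
  have h2 : lqpow q (z2 - z4) <= b * (lqpow q (z2 - z3) + lqpow q (z3 - z4)).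
    by apply: le_trans (lqpow_add q1 _ _); rewrite addrA subrK.
  have b0 : 0 <= b by exact: powR_ge0.
  apply: (le_trans h1); rewrite expr2 -mulrA ler_wpM2l// -addrA mulrDr.
  by apply: lerD => //; rewrite ler_peMl ?lqpow_ge0.
apply: (le_trans (N3 _ (F x) (F y) _)).
rewrite -mulrA -mulrDr ler_wpM2l ?exprn_ge0 ?powR_ge0//.
have h1 : lqpow q (F x - f (near_point i x)) <= ext_const * K x (near_point i x).
  exact: F2 (innear x).
have h2 : lqpow q (F y - f (near_point i y)) <= ext_const * K y (near_point i y).
  exact: F2 (innear y).
rewrite (_ : lqpow q (f (near_point i x) - F x) = lqpow q (F x - f (near_point i x))).
  rewrite mulrDr; move: ext_const h1 h2 => D h1 h2.
  by rewrite addrC addrA [X in _ <= X]addrC lerD// addrC lerD.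
by rewrite -lqpowN opprB.
Qed.

(** Three comparisons: the mean of [K] with its mean over nearest points, that with the mean of
    [sumdist q G] there, and the latter, times [A], with the mean of [sumdist q F]. The first and
    the last have errors that tend to 0 with the distance to nearest points, so one finite stage
    suffices. *)
Lemma lq_embedding : exists F : seq (T -> Y),
  (forall x y, sumdist q F x y <= ext_const * K x y) /\
  (\int[mu]_x \int[mu]_y (K x y)%:E
   <= \int[mu]_x \int[mu]_y (sumdist q F x y)%:E)%E.
Proof.
have b0 : 0 < b by rewrite powR_gt0.
have A0 : 0 < A by rewrite powR_gt0.
have D0 : 0 <= ext_const.
  rewrite !mulr_ge0 ?exprn_ge0 ?(ltW b0) ?(ltW A0)//; first exact: powR_ge0.
  exact: le_trans M11.
have lip := @lipschitz_iterated_cvg R T d mu dl q s M1 q1 dl0 dlsym dltri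
  mdl sdense moment1.
have [mK moK _] := lip dl 1 id ler01 dl0 dlsym dltri
  (fun x y => eq_ind_r (fun t => dl x y <= t) (lexx _) (mul1r _)) leqnn.
set X := (\int[mu]_x \int[mu]_y (K x y)%:E)%E.
have X0 : (0 <= X)%E.
  by apply: integral_ge0 => x _; apply: integral_ge0 => y _; rewrite lee_fin.
have mom_m : measurable_fun setT (fun x : borel_space d => K x (s 0%N)).
  by apply: (@measurableT_comp _ _ _ _ _ _ (fun t => t `^ q)) => //; exact: mdl.
have Xfin : (X < +oo)%E.
  have h := @iterated_integral_le R T d mu K (fun _ _ => 0) (fun x => K x (s 0%N))
    0 b M1 (lexx 0) (ltW b0) K0 (fun _ _ => lexx 0) (fun x => K0 _ _) mK moK.
  apply: (le_lt_trans (h _ _ mom_m moment1 _)) => //.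
  - by move=> x y; rewrite mulr0 add0r [K y _]Ksym.
  - by rewrite mul0e add0e ltry.
have [De XE] : exists De, X = De%:E.
  by exists (fine X); rewrite fineK// ge0_fin_numE.
have De0 : 0 <= De by rewrite -lee_fin -XE.
have [DeE|DeN] := eqVneq De 0.
  exists [::]; split=> [x y|]; first by rewrite /sumdist big_nil mulr_ge0.
  rewrite XE DeE; apply: integral_ge0 => x _; apply: integral_ge0 => y _.
  by rewrite lee_fin sumdist_ge0.
have {}De0 : 0 < De by rewrite lt_def DeN.
(* [c * E] is the sum of the errors of [ineq1], multiplied by [A], and of [ineq2], multiplied by
   [b ^+ 2]; the stage [i] makes it at most [b ^+ 4 * De]. *)
pose c := 2 * b ^+ 4 * ext_const + 2 * b ^+ 2 * A.
have c0 : 0 < c.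
  have b2 : 0 < b ^+ 2 by exact: exprn_gt0.
  have b4 : 0 < b ^+ 4 by exact: exprn_gt0.
  apply: ltr_wpDl; last by apply: mulr_gt0 => //; exact: mulr_gt0.
  by apply: mulr_ge0 => //; apply: mulr_ge0 => //; exact: ltW.
have e0 : 0 < b ^+ 4 * De / c by rewrite divr_gt0// mulr_gt0 ?exprn_gt0.
have [i [E EE Ele]] : exists i, exists2 E,
    (\int[mu]_x (K x (near_point i x))%:E = E%:E)%E & E <= b ^+ 4 * De / c.
  have /fine_cvgP[nfin] := near_point_error_cvg q1 dl0 mdl sdense moment1.
  move/cvgrPdist_lt => /(_ _ e0) => nlt.
  have [N _ hN] := filterI nfin nlt; have [/= h1 h2] := hN N (leqnn N).
  exists N; eexists; first by rewrite -[LHS]fineK//.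
  by apply: ltW; move: h2; rewrite sub0r normrN; exact: le_lt_trans (ler_norm _).
have [G [G1 G2]] := near_point_embedding i.
have [F [F1 F2]] := extended_embedding G1.
exists F; split; first exact: F1.
rewrite -/X XE.
pose rF x y := (sumdist q F x y) `^ q^-1.
have rFq x y : rF x y `^ q = sumdist q F x y by rewrite powR_rootK ?sumdist_ge0.
have rF_le x y : rF x y <= ext_const `^ q^-1 * dl x y.
  have cd0 : 0 <= ext_const `^ q^-1 * dl x y by rewrite mulr_ge0 ?powR_ge0.
  rewrite -(powRK_root qn0 cd0); apply: ler_powR2 => //; first exact: sumdist_ge0.
  by rewrite powRM ?powR_ge0// powR_rootK//; exact: F1.
have rF_sym x y : rF x y = rF y x by rewrite /rF sumdist_sym.
have [mF moF _] := lip rF (ext_const `^ q^-1) id (powR_ge0 _ _)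
  (fun x y => powR_ge0 _ _) rF_sym (sumdist_root_tri q1 F) rF_le leqnn.
have mF' x : measurable_fun setT (fun y : borel_space d => sumdist q F x y).
  by apply: eq_measurable_fun (mF x) => y _; exact: rFq.
have moF' : measurable_fun setT
    (fun x : borel_space d => \int[mu]_y (sumdist q F x y)%:E)%E.
  apply: eq_measurable_fun moF => x _; apply: eq_integral => y _.
  by rewrite rFq.
pose Sk := \sum_(k < i.+1) \sum_(l < i.+1) wt i k * wt i l * K (s k) (s l).
pose Sg := \sum_(k < i.+1) \sum_(l < i.+1)
  wt i k * wt i l * sumdist q G (s k) (s l).
have SkE : (\int[mu]_x \int[mu]_y (K (near_point i x) (near_point i y))%:E = Sk%:E)%E.
  by apply: (@step_int i (fun k l => K (s k) (s l))).
have SgE : (\int[mu]_x \int[mu]_y (sumdist q G (near_point i x) (near_point i y))%:E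
    = Sg%:E)%E.
  apply: (@step_int i (fun k l => sumdist q G (s k) (s l))).
  by move=> *; exact: sumdist_ge0.
rewrite SkE SgE lee_fin in G2.
have [mk mok] := @measurable_step_pair R T d mu dl s mdl i
  (fun k l => K (s k) (s l)) (fun k l => K0 _ _).
have [mg mog] := @measurable_step_pair R T d mu dl s mdl i
  (fun k l => A * sumdist q G (s k) (s l))
  (fun k l => mulr_ge0 (ltW A0) (sumdist_ge0 _ _ _ _)).
have merr : measurable_fun setT (fun x : borel_space d => K x (near_point i x)).
  apply: (@measurableT_comp _ _ _ _ _ _ (fun t => t `^ q)) => //.
  exact: (proj2 (@measurable_nearest _ (borel_space d) R dl s mdl i)).
have b20 : 0 <= b ^+ 2 by rewrite exprn_ge0// ltW.
have ineq1 : De <= b ^+ 2 * Sk + b ^+ 2 * (E + E).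
  rewrite -lee_fin EFinD EFinM -XE -SkE.
  apply: (@iterated_integral_le R T d mu K
    (fun x y => K (near_point i x) (near_point i y))
    (fun x => K x (near_point i x)) (b ^+ 2) (b ^+ 2) E b20 b20 K0 (fun x y => K0 _ _)
    (fun x => K0 _ _) mK moK mk mok merr EE) => x y.
  have h1 := Ktri x (near_point i x) y.
  have h2 := Ktri (near_point i x) (near_point i y) y.
  rewrite [K (near_point i y) y]Ksym in h2.
  have h3 : K x (near_point i x) <= b * K x (near_point i x) by rewrite ler_peMl.
  apply: (le_trans h1).
  have -> : b ^+ 2 * K (near_point i x) (near_point i y)
      + b ^+ 2 * (K x (near_point i x) + K y (near_point i y))
    = b * (b * K x (near_point i x)
        + b * (K (near_point i x) (near_point i y) + K y (near_point i y))) by ring.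
  by rewrite ler_pM2l//; exact: lerD.
have ineq2 : ((A * Sg)%:E <= (b ^+ 2)%:E
    * \int[mu]_x \int[mu]_y (sumdist q F x y)%:E
    + (b ^+ 2 * ext_const * (E + E))%:E)%E.
  have <- : (\int[mu]_x \int[mu]_y (A * sumdist q G (near_point i x) (near_point i y))%:E
      = (A * Sg)%:E)%E.
    rewrite (@step_int i (fun k l => A * sumdist q G (s k) (s l))).
      congr (_%:E); rewrite mulr_sumr; apply: eq_bigr => k _.
      by rewrite mulr_sumr; apply: eq_bigr => l _; rewrite mulrCA.
    by move=> k l; rewrite mulr_ge0 ?(ltW A0)// sumdist_ge0.
  apply: (@iterated_integral_le R T d mu
    (fun x y => A * sumdist q G (near_point i x) (near_point i y)) (sumdist q F)
    (fun x => K x (near_point i x)) (b ^+ 2) (b ^+ 2 * ext_const) E) => //.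
  - by rewrite mulr_ge0.
  - by move=> x y; rewrite mulr_ge0 ?(ltW A0)// sumdist_ge0.
  - by move=> x y; exact: sumdist_ge0.
set Xf := (\int[mu]_x \int[mu]_y (sumdist q F x y)%:E)%E in ineq2 *.
have Xf0 : (0 <= Xf)%E.
  apply: integral_ge0 => x _; apply: integral_ge0 => y _.
  by rewrite lee_fin sumdist_ge0.
move: Xf Xf0 ineq2 => [y| |] // Xf0; last by move=> _; rewrite leey.
rewrite -EFinM -EFinD !lee_fin => ineq2.
have AE : A = b ^+ 4 * b.
  rewrite /A /b -exprSr.
  have pw n : (2 `^ q) ^+ n = (2 ^+ n) `^ q :> R.
    elim: n => [|n IH]; first by rewrite !expr0 powR1.
    by rewrite !exprS IH powRM ?exprn_ge0.
  by rewrite pw; congr (_ `^ _); rewrite -natrX.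
have b2 : 2 <= b by apply: le1r_powR => //; rewrite ler1n.
have b40 : 0 < b ^+ 4 by rewrite exprn_gt0.
have i1 : A * De <= A * (b ^+ 2 * Sk + b ^+ 2 * (E + E)) by rewrite ler_pM2l.
have i2 : b ^+ 2 * (A * Sk) <= b ^+ 2 * (A * Sg).
  by rewrite ler_wpM2l// ler_pM2l.
have i3 : b ^+ 2 * (A * Sg) <= b ^+ 2 * (b ^+ 2 * y + b ^+ 2 * ext_const * (E + E)).
  by rewrite ler_wpM2l.
have i4 : c * E <= b ^+ 4 * De by rewrite mulrC -ler_pdivlMr.
have i5 : b ^+ 4 * (2 * De) <= A * De.
  by rewrite AE -mulrA ler_pM2l// ler_pM2r.
have i6 : A * (b ^+ 2 * Sk + b ^+ 2 * (E + E))
  = b ^+ 2 * (A * Sk) + 2 * b ^+ 2 * A * E by ring.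
have i7 : b ^+ 2 * (b ^+ 2 * y + b ^+ 2 * ext_const * (E + E))
  = b ^+ 4 * y + 2 * b ^+ 4 * ext_const * E by ring.
rewrite -(ler_pM2l b40).
have i8 : b ^+ 4 * (2 * De) = b ^+ 4 * De + b ^+ 4 * De by ring.
have i9 : c * E = 2 * b ^+ 4 * ext_const * E + 2 * b ^+ 2 * A * E.
  by rewrite /c; ring.
rewrite i6 in i1; rewrite i7 in i3; rewrite i8 in i5; rewrite i9 in i4.
by lra.
Qed.
End FiniteMoment.

(** If [Y] were zero, weights equal to 0 would satisfy the Poincare inequality on two points, and
    its transfer would give [K x y <= 0]. *)
Lemma nontrivial_target (x y : T) : x != y -> exists v : Y, `|v| = 1.
Proof.
move=> xy; apply: contrapT => nov.
have Y0 (v : Y) : v = 0.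
  apply: contrapT => /eqP v0; apply: nov; exists (`|v|^-1 *: v).
  by rewrite normrZ normfV normr_id mulVf// normr_eq0.
have := @poincare_transfer R T Y q C K q1 C1 K0 Kxx gammaC bool
  (fun c => if c then x else y) (fun _ _ => 0) (fun _ _ => lexx 0)
  (fun _ _ => erefl).
rewrite [X in C * X]big1 ?mulr0; last first.
  by move=> c _; rewrite big1// => c' _; rewrite mul0r.
have hh : forall g : bool -> Y, \sum_a \sum_b `|g a - g b| `^ q
    <= \sum_(a : bool) \sum_(b : bool) 0 * `|g a - g b| `^ q.
  move=> g; rewrite !big_bool/= !mul0r !addr0.
  by rewrite [g true]Y0 [g false]Y0 subrr normr0 powR0// !addr0.
move=> /(_ hh); rewrite !big_bool/= !Kxx add0r addr0 [K y x]Ksym.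
by have := Kpos xy; lra.
Qed.

(** If the inner integral were finite for one [x], the bound of [dl y (s 0)] by [dl x (s 0)] plus
    the difference of the two would make the moment finite. So every inner integral is infinite. *)
Lemma infinite_moment_embedding (v : Y) : `|v| = 1 ->
  (\int[mu]_x (dl x (s 0%N) `^ q)%:E = +oo)%E ->
  exists F : seq (T -> Y), (forall x y, sumdist q F x y <= K x y) /\
    (\int[mu]_x \int[mu]_y (sumdist q F x y)%:E = +oo)%E.
Proof.
move=> v1 momoo; exists [:: fun x => dl x (s 0%N) *: v].
set F := [:: _].
have FE x y : sumdist q F x y = `|dl x (s 0%N) - dl y (s 0%N)| `^ q.
  by rewrite /sumdist big_seq1 -scalerBl normrZ v1 mulr1.
split=> [x y|].
  rewrite FE; apply: ler_powR2 => //.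
  have := dltri x y (s 0%N); have := dltri y x (s 0%N).
  by rewrite [dl y x]dlsym ler_norml => h1 h2; apply/andP; split; lra.
have b0 : 0 <= 2 `^ q :> R by exact: powR_ge0.
have mF x : measurable_fun setT (fun y : borel_space d => sumdist q F x y).
  apply: (eq_measurable_fun (fun y : borel_space d =>
    `|dl x (s 0%N) - dl y (s 0%N)| `^ q)); first by move=> y _; rewrite FE.
  apply: (@measurableT_comp _ _ _ _ _ _ (fun t => t `^ q)) => //.
  apply: (@measurableT_comp _ _ _ _ _ _ (fun t : R => `|t|)) => //.
  by apply: measurable_funB => //; exact: mdl.
have inner x : (\int[mu]_y (sumdist q F x y)%:E = +oo)%E.
  apply/eqP; rewrite -leye_eq leNgt; apply/negP => fin.
  have Ige0 : (0 <= \int[mu]_y (sumdist q F x y)%:E)%E.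
    by apply: integral_ge0 => y _; rewrite lee_fin sumdist_ge0.
  have IE : (\int[mu]_y (sumdist q F x y)%:E
      = (fine (\int[mu]_y (sumdist q F x y)%:E))%:E)%E.
    by rewrite fineK// ge0_fin_numE.
  suff : (\int[mu]_y (dl y (s 0%N) `^ q)%:E < +oo)%E by rewrite momoo ltxx.
  apply: (@le_lt_trans _ _
    (\int[mu]_y (2 `^ q * (dl x (s 0%N) `^ q + sumdist q F x y))%:E)%E).
    apply: ge0_le_integral => //.
    - by move=> y _; rewrite lee_fin powR_ge0.
    - apply/measurable_EFinP.
      exact: (@measurableT_comp _ _ _ _ _ _ (fun t => t `^ q)).
    - apply/measurable_EFinP; apply: measurable_funM => //.
      exact: measurable_funD.
    - move=> y _; rewrite lee_fin FE.
      apply: le_trans (powR_add_le q0 (dl0 _ _) (normr_ge0 _)).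
      apply: ler_powR2 => //.
      have := ler_norm (dl y (s 0%N) - dl x (s 0%N)).
      by rewrite distrC; lra.
  rewrite (integral_affine (mF x) (fun y => sumdist_ge0 q F x y) IE) ?ltry//.
  exact: powR_ge0.
under eq_integral do rewrite inner.
rewrite (integral_cst mu measurableT +oo%E).
transitivity (+oo * 1 : \bar R)%E; last by rewrite mule1.
by congr (_ * _)%E; exact: probability_setT.
Qed.
End Embeddings.

(** * The snowflake metric and the final constants *)

Section Snowflake.
Context {R : realType} {T : pointedType} {Y : completeNormedModType R}.
Variables (p q C : R) (d : T -> T -> R).
Hypothesis p1 : 1 <= p.
Hypothesis q1 : 1 <= q.
Hypothesis C1 : 1 <= C.
Hypothesis pq : p <= q.
Hypothesis dM : is_metric d.
Hypothesis dS : separable d.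
Hypothesis gammaC : forall (n : nat) (A : 'M[R]_n), sym_stochastic A ->
  (gamma_const A (fun x y => (d x y `^ p)%R)
   <= C%:E * gamma_const A (fun x y : Y => (`|x - y| `^ q)%R))%E.

Let dl x y := d x y `^ (p / q).

Let p0 : 0 < p. Proof. exact: lt_le_trans p1. Qed.
Let q0 : 0 < q. Proof. exact: lt_le_trans q1. Qed.
Let qn0 : q != 0. Proof. by rewrite gt_eqF. Qed.
Let t0 : 0 < p / q. Proof. exact: divr_gt0. Qed.
Let t1 : p / q <= 1. Proof. by rewrite ler_pdivrMr// mul1r. Qed.
Let d0 x y : 0 <= d x y. Proof. by case: dM. Qed.

Let dlq x y : dl x y `^ q = d x y `^ p.
Proof. by rewrite /dl -powRrM divfK. Qed.

Let dl0 x y : 0 <= dl x y. Proof. exact: powR_ge0. Qed.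

Let dlxx x : dl x x = 0.
Proof.
have [_ [dE _]] := dM.
by rewrite /dl (proj2 (dE x x))// powR0// gt_eqF.
Qed.

Let dlpos x y : x != y -> 0 < dl x y.
Proof.
move=> xy; apply: powR_gt0; have [_ [dE _]] := dM.
by rewrite lt_def d0 andbT; apply: contraNneq xy => /dE ->.
Qed.

Let dlsym x y : dl x y = dl y x.
Proof. by rewrite /dl; have [_ [_ [ds _]]] := dM; rewrite ds. Qed.

Let dltri x y z : dl x z <= dl x y + dl y z.
Proof.
have [_ [_ [_ dtri]]] := dM.
apply: le_trans (powR_subadditive t0 t1 (d0 _ _) (d0 _ _)).
by apply: ler_powR2; rewrite ?(ltW t0).
Qed.

Let mdl a : measurable_fun setT (fun x : borel_space d => dl x a).
Proof.
apply: (@measurableT_comp _ _ _ _ _ _ (fun t => t `^ (p / q))) => //.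
exact: borel_measurable_dist.
Qed.

Let gammaD : forall (n : nat) (A : 'M[R]_n), sym_stochastic A ->
  (gamma_const A (fun x y => (dl x y `^ q)%R)
   <= C%:E * gamma_const A (fun x y : Y => (`|x - y| `^ q)%R))%E.
Proof.
move=> n A stA; rewrite (_ : (fun x y => (dl x y `^ q)%R) = fun x y => d x y `^ p).
  exact: gammaC.
by apply/funext => x; apply/funext => y; exact: dlq.
Qed.

Lemma dense_sequence : exists s : nat -> T,
  forall x e, 0 < e -> exists i, dl x (s i) < e.
Proof.
have [S [/countable_injP[f finj] Sd]] := dS.
(* Indices that are not values of [f] give the default [point]; density comes from the others. *)
exists (fun n => xget point [set t | S t /\ f t = n]) => x e e0.
have e1 : 0 < e `^ (p / q)^-1 by rewrite powR_gt0.
have [t St xt] := Sd x _ e1; exists (f t).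
have -> : xget point [set u | S u /\ f u = f t] = t.
  case: xgetP => [u _ [Su fu]|/(_ t)]; last by case.
  by apply: finj => //; rewrite inE.
rewrite /dl -[ltRHS](@powR_rootK _ (p / q)) ?gt_eqF ?(ltW e0)//.
by rewrite gt0_ltr_powR ?nnegrE ?powR_ge0.
Qed.

Section Measure.
Variables (mu : probability (borel_space d) R) (s : nat -> T).
Hypothesis sdense : forall x e, 0 < e -> exists i, dl x (s i) < e.

(** An infinite moment excludes a one-point space, and two distinct points force a unit vector in
    [Y]. *)
Lemma moment_dichotomy :
  (exists M1, (\int[mu]_x (dl x (s 0%N) `^ q)%:E = M1%:E)%E) \/
  exists F : seq (T -> Y),
    (forall x y, sumdist q F x y <= dl x y `^ q) /\
    (\int[mu]_x \int[mu]_y (sumdist q F x y)%:E = +oo)%E.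
Proof.
have I0 : (0 <= \int[mu]_x (dl x (s 0%N) `^ q)%:E)%E.
  by apply: integral_ge0 => x _; rewrite lee_fin powR_ge0.
case E : (\int[mu]_x (dl x (s 0%N) `^ q)%:E)%E I0 => [M1| |] // _.
  by left; exists M1.
right.
have [[x xs]|all0] := pselect (exists x, x != s 0%N).
  have [v v1] := nontrivial_target q1 C1 dlxx dlpos dlsym gammaD xs.
  exact: infinite_moment_embedding q1 dl0 dlsym dltri mdl _ v1 E.
suff : (\int[mu]_x (dl x (s 0%N) `^ q)%:E = 0)%E by rewrite E.
rewrite -[RHS](integral0 mu setT); apply: eq_integral => x _.
suff -> : x = s 0%N by rewrite dlxx powR0.
by apply: contrapT => /eqP xs; apply: all0; exists x.
Qed.

Lemma snowflake_ultrapower (U : set (set nat)) :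
  ultrafilter U -> \oo `<=` U ->
  exists f : nat -> T -> nat -> Y,
    (forall i x, in_lq q (f i x)) /\
    (forall x, exists B : R, forall i, lq_norm q (f i x) <= B) /\
    (forall x y, ulim U (fun i => lq_norm q (f i x - f i y))
       <= 2 * C `^ q^-1 * dl x y) /\
    (\int[mu]_x \int[mu]_y
       ((ulim U (fun i => lq_norm q (f i x - f i y))) `^ q)%:E
     >= \int[mu]_x \int[mu]_y ((dl x y) `^ q)%:E)%E.
Proof.
move=> UU sub; have [[M1 E]|[F [F1 F2]]] := moment_dichotomy.
  exact: (@ultrapower_embedding R T Y d mu dl q C s q1 C1 dl0 dlxx dlpos dlsym
    dltri mdl sdense gammaD M1 E).
have ulimE x y : ulim U (fun i => lq_norm q (seq_map F x - seq_map F y))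
    = (sumdist q F x y) `^ q^-1.
  by apply: ulim_cvg => //; rewrite seq_map_dist//; exact: cvg_cst.
(* A single map into l_q(Y) is taken as a constant family. *)
exists (fun _ => seq_map F); split; first by move=> _ x; exact: seq_map_in_lq.
split; first by move=> x; exists (lq_norm q (seq_map F x)).
split.
  move=> x y; rewrite ulimE.
  apply: (@le_trans _ _ (dl x y)).
    rewrite -[leRHS](powRK_root qn0)//; apply: ler_powR2 => //.
      by rewrite invr_ge0 ltW.
    exact: sumdist_ge0.
  rewrite ler_peMl//.
  have : 1 <= C `^ q^-1.
    have qi : 0 <= q^-1 by rewrite invr_ge0 ltW.
    by have := @ler_powR R C C1 0 q^-1 qi; rewrite powRr0.
  by lra.
under [leRHS]eq_integral do under eq_integral do
  rewrite ulimE powR_rootK ?sumdist_ge0//.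
by rewrite F2 leey.
Qed.

Variables (Kc M : R).
Hypothesis Kc1 : 1 <= Kc.
Hypothesis M11 : 1 <= M.
Hypothesis Kuc : forall x y : Y, `|y| `^ q <=
  Kc `^ q * ((`|x + y| `^ q + `|x - y| `^ q) / 2 - `|x| `^ q).
Hypothesis Mmarkov : forall (n : nat) (pi : 'I_n -> R) (A : 'M[R]_n)
    (x : 'I_n -> T) (s : nat),
  (forall i, 0 <= pi i) -> \sum_i pi i = 1 -> stochastic A ->
  (forall i j, pi i * A i j = pi j * A j i) ->
  (\sum_i \sum_j pi i * (A ^+ s) i j * d (x i) (x j) `^ p) `^ p^-1
  <= M * s%:R `^ p^-1 *
     (\sum_i \sum_j pi i * A i j * d (x i) (x j) `^ p) `^ p^-1.

(** Raised to the power [p], the Markov type inequality becomes linear in the kernel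
    [dl ^ q = d ^ p], as the extension argument needs. *)
Lemma markov_power (n : nat) (pi : 'I_n -> R) (A : 'M[R]_n)
    (x : 'I_n -> T) (k : nat) :
  (forall i, 0 <= pi i) -> \sum_i pi i = 1 -> stochastic A ->
  (forall i j, pi i * A i j = pi j * A j i) ->
  \sum_i \sum_j pi i * (A ^+ k) i j * dl (x i) (x j) `^ q
  <= M `^ p * k%:R * \sum_i \sum_j pi i * A i j * dl (x i) (x j) `^ q.
Proof.
move=> pi0 pi1 stA revA; have h := Mmarkov x k pi0 pi1 stA revA.
have pn0 : p != 0 by rewrite gt_eqF.
have nn (B : 'M[R]_n) : stochastic B ->
    0 <= \sum_i \sum_j pi i * B i j * d (x i) (x j) `^ p.
  move=> [B0 _]; do 2 (apply: sumr_ge0 => ? _).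
  by apply: mulr_ge0; [exact: mulr_ge0|exact: powR_ge0].
have dlE (B : 'M[R]_n) : \sum_i \sum_j pi i * B i j * dl (x i) (x j) `^ q
    = \sum_i \sum_j pi i * B i j * d (x i) (x j) `^ p.
  by apply: eq_bigr => i _; apply: eq_bigr => j _; rewrite dlq.
rewrite !dlE.
rewrite -[leLHS](powR_rootK pn0); last exact: nn (stochasticX stA k).
apply: (le_trans (ler_powR2 (ltW p0) (powR_ge0 _ _) h)).
rewrite !powRM ?powR_ge0 ?mulr_ge0 ?(le_trans ler01 M11) ?powR_ge0//.
by rewrite !powR_rootK// nn.
Qed.

Lemma snowflake_lq : exists f : T -> nat -> Y,
  (forall x, in_lq q (f x)) /\
  (forall x y, lq_norm q (f x - f y)
     <= 2 ^+ 19 * M `^ (p / q) * Kc * C `^ q^-1 * dl x y) /\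
  (\int[mu]_x \int[mu]_y ((lq_norm q (f x - f y)) `^ q)%:E >=
   \int[mu]_x \int[mu]_y ((dl x y) `^ q)%:E)%E.
Proof.
have qi : 0 <= q^-1 by rewrite invr_ge0 ltW.
have M0 : 0 <= M by exact: le_trans M11.
have Kc0 : 0 <= Kc by exact: le_trans Kc1.
have C0 : 0 <= C by exact: le_trans C1.
set D := 2 ^+ 19 * M `^ (p / q) * Kc * C `^ q^-1.
have D0 : 0 <= D.
  do 2 (apply: mulr_ge0; last by rewrite ?powR_ge0).
  by apply: mulr_ge0; [apply: exprn_ge0; rewrite ler0n|exact: powR_ge0].
have pw (x : R) n : 0 <= x -> (x `^ q) ^+ n = (x ^+ n) `^ q.
  move=> x0; elim: n => [|n IH]; first by rewrite !expr0 powR1.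
  by rewrite !exprS IH powRM ?exprn_ge0.
have DE : D `^ q = (2 ^+ 19) `^ q * M `^ p * Kc `^ q * C.
  rewrite /D !powRM ?mulr_ge0 ?powR_ge0 ?exprn_ge0// powR_rootK//.
  by rewrite -powRrM divfK.
clearbody D.
(* [2 ^+ 19] is [8 * 2 ^+ 10 * 32 * 2], from the factors of [ext_const]. The 8 there has no exponent
   [q] and is bounded by [8 ^ q]. *)
have constD : ext_const q C Kc (M `^ p) <= D `^ q.
  rewrite DE /ext_const pw//.
  have -> : (2 ^+ 19) `^ q = 8 `^ q * (2 ^+ 10) `^ q * 32 `^ q * 2 `^ q :> R.
    rewrite -!powRM ?mulr_ge0 ?exprn_ge0//; congr (_ `^ _).
    by ring.
  set b := 2 `^ q; set b10 := (2 ^+ 10) `^ q; set A := 32 `^ q.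
  have h8 : 8 <= 8 `^ q :> R by apply: le1r_powR => //; rewrite ler1n.
  have -> : 8 * Kc `^ q * b10 * (A * (b * C)) * M `^ p
     = 8 * (Kc `^ q * b10 * A * b * C * M `^ p) by ring.
  have -> : 8 `^ q * b10 * A * b * M `^ p * Kc `^ q * C
     = 8 `^ q * (Kc `^ q * b10 * A * b * C * M `^ p) by ring.
  by rewrite ler_wpM2r// !mulr_ge0 ?powR_ge0.
have ge1 (x t : R) : 1 <= x -> 0 <= t -> 1 <= x `^ t.
  by move=> x1 tt; have := @ler_powR R x x1 0 t tt; rewrite powRr0.
have D1 : 1 <= D `^ q.
  rewrite DE; apply: mulr_ege1 C1; apply: mulr_ege1 (ge1 _ _ Kc1 (ltW q0)).
  apply: mulr_ege1 (ge1 _ _ M11 (ltW p0)).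
  exact: ge1 _ _ (exprn_ege1 19 (ler1n R 2)) (ltW q0).
suff [F [F1 F2]] : exists F : seq (T -> Y),
    (forall x y, sumdist q F x y <= D `^ q * dl x y `^ q) /\
    (\int[mu]_x \int[mu]_y (dl x y `^ q)%:E
     <= \int[mu]_x \int[mu]_y (sumdist q F x y)%:E)%E.
  exists (seq_map F); split; first by move=> x; exact: seq_map_in_lq.
  split=> [x y|].
    have Dd0 : 0 <= D * dl x y by exact: mulr_ge0.
    rewrite (seq_map_dist q1) -(powRK_root qn0 Dd0).
    apply: ler_powR2 qi (sumdist_ge0 _ _ _ _) _.
    by rewrite (powRM _ D0 (dl0 x y)); exact: F1.
  under [leRHS]eq_integral do under eq_integral do
    rewrite seq_map_dist// powR_rootK ?sumdist_ge0//.
  exact: F2.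
have [[M1 E]|[F [F1 F2]]] := moment_dichotomy.
  have Mp1 : 1 <= M `^ p.
    by have := @ler_powR R M M11 0 p (ltW p0); rewrite powRr0.
  have [F [F1 F2]] := @lq_embedding R T Y d mu dl q C s q1 C1 dl0 dlxx dlpos dlsym
    dltri mdl sdense gammaD M1 E Kc (M `^ p) Kc1 Mp1 Kuc markov_power.
  exists F; split=> // x y; apply: (le_trans (F1 x y)).
  by rewrite ler_wpM2r ?powR_ge0.
exists F; split; last by rewrite F2 leey.
move=> x y; apply: (le_trans (F1 x y)).
by rewrite ler_peMl ?powR_ge0.
Qed.
End Measure.
End Snowflake.

(* The constants in the statement are infima of sets of admissible constants
   bounded below by 1; an admissible constant within a factor 2 is enough. *)
Lemma near_ereal_inf {R : realType} (S : set R) : (forall x, S x -> 1 <= x) ->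
  (ereal_inf [set x%:E | x in S] < +oo)%E ->
  1 <= fine (ereal_inf [set x%:E | x in S]) /\
  exists2 x, S x & x <= 2 * fine (ereal_inf [set x%:E | x in S]).
Proof.
move=> S1 fin; set I := ereal_inf _ in fin *.
have I1 : (1%:E <= I)%E.
  by apply: le_ereal_inf_tmp => _ [x Sx <-]; rewrite lee_fin S1.
have If : I \is a fin_num.
  by rewrite fin_numE; apply/andP; split; apply/eqP => IE; rewrite IE in I1 fin.
have I1' : 1 <= fine I by rewrite -lee_fin fineK.
split=> //.
have lt2 : (I < (2 * fine I)%:E)%E.
  by rewrite -{1}(fineK If) lte_fin; lra.
have [_ [x Sx <-]] := ereal_inf_lt lt2.
by rewrite lte_fin => /ltW xle; exists x.
Qed.

Theorem theorem2p3 (R : realType) :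
  (forall (p q C : R) (T : pointedType) (d : T -> T -> R)
          (Y : completeNormedModType R),
     1 <= p -> 1 <= q -> 1 <= C -> p <= q ->
     is_metric d -> separable d ->
     (forall (n : nat) (A : 'M[R]_n), sym_stochastic A ->
        (gamma_const A (fun x y => (d x y `^ p)%R)
         <= C%:E * gamma_const A (fun x y : Y => (`|x - y| `^ q)%R))%E) ->
     exists (I : Type) (U : set (set I)), ultrafilter U /\
       avg_embeds_ultrapower_lq d (fun x y => d x y `^ (p / q)) Y q
         (2 * C `^ q^-1) U)
  /\
  exists kappa : R, 0 < kappa /\
  forall (p q C : R) (T : pointedType) (d : T -> T -> R)
         (Y : completeNormedModType R),
     1 <= p -> 1 <= q -> 1 <= C -> p <= q ->
     is_metric d -> separable d ->
     (forall (n : nat) (A : 'M[R]_n), sym_stochastic A ->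
        (gamma_const A (fun x y => (d x y `^ p)%R)
         <= C%:E * gamma_const A (fun x y : Y => (`|x - y| `^ q)%R))%E) ->
     has_markov_type d p -> (unif_convex_const Y q < +oo)%E ->
     exists D : R, 1 <= D /\
       D <= kappa * (fine (markov_type_const d p)) `^ (p / q)
              * fine (unif_convex_const Y q) * C `^ q^-1 /\
       avg_embeds_lq d (fun x y => d x y `^ (p / q)) Y q D.
Proof.
split.
  move=> p q C T d Y p1 q1 C1 pq dM dS gammaC.
  have [s sdense] := dense_sequence p1 q1 dM dS.
  have [U [UU _ sub]] := free_ultrafilter.
  exists nat, U; split=> // mu.
  exact: snowflake_ultrapower p1 q1 C1 pq dM gammaC mu s sdense U UU sub.
(* [2 ^+ 19] from [snowflake_lq], and two factors 2 because [M] and [Kc] are only within a factor 2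
   of the infima; the first enters with the exponent [p / q <= 1]. *)
exists (2 ^+ 21); split; first by apply: exprn_gt0; rewrite ltr0n.
move=> p q C T d Y p1 q1 C1 pq dM dS gammaC mtype uconv.
have [s sdense] := dense_sequence p1 q1 dM dS.
have [m1 [M [M1 Mm] Mle]] := near_ereal_inf (fun _ h => proj1 h) mtype.
have [k1 [Kc [Kc1 Kcm] Kcle]] := near_ereal_inf (fun _ h => proj1 h) uconv.
rewrite -/(markov_type_const d p) in m1 Mle.
rewrite -/(unif_convex_const Y q) in k1 Kcle.
set m := fine (markov_type_const d p) in m1 Mle *.
set k := fine (unif_convex_const Y q) in k1 Kcle *.
have p0 : 0 < p by exact: lt_le_trans p1.
have q0 : 0 < q by exact: lt_le_trans q1.
have t0 : 0 < p / q by exact: divr_gt0.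
have t1 : p / q <= 1 by rewrite ler_pdivrMr// mul1r.
have Mpos : 0 <= M by exact: le_trans M1.
have ge1 (x t : R) : 1 <= x -> 0 <= t -> 1 <= x `^ t.
  by move=> x1 tt; have := @ler_powR R x x1 0 t tt; rewrite powRr0.
have Mt : M `^ (p / q) <= 2 * m `^ (p / q).
  apply: (le_trans (ler_powR2 (ltW t0) Mpos Mle)).
  rewrite powRM ?(le_trans ler01 m1)// ler_wpM2r ?powR_ge0//.
  by apply: ler1_powR => //; rewrite ler1n.
have Cq1 : 1 <= C `^ q^-1 by apply: ge1 => //; rewrite invr_ge0 ltW.
have Mt1 : 1 <= M `^ (p / q) by apply: ge1 => //; exact: ltW.
have [c cE] : exists c : R, c = 2 ^+ 19 by eexists.
have c1 : 1 <= c by rewrite cE; apply: exprn_ege1; rewrite ler1n.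
have c0 : 0 < c by exact: lt_le_trans c1.
have ckE : 2 ^+ 21 = c * 2 * 2 :> R by rewrite cE -!exprSr.
exists (c * M `^ (p / q) * Kc * C `^ q^-1); split.
  exact: mulr_ege1 (mulr_ege1 (mulr_ege1 c1 Mt1) Kc1) Cq1.
split.
  rewrite ckE ler_wpM2r ?powR_ge0//.
  apply: (@le_trans _ _ (c * (2 * m `^ (p / q)) * (2 * k))).
    apply: ler_pM => //; first by rewrite mulr_ge0 ?powR_ge0// ltW.
      exact: le_trans Kc1.
    by rewrite ler_pM2l.
  by rewrite le_eqVlt; apply/orP; left; apply/eqP; ring.
rewrite cE.
move=> mu.
exact: snowflake_lq p1 q1 C1 pq dM gammaC mu s sdense Kc M Kc1 M1 Kcm Mm.
Qed.
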